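(* Let $n\ge 3$, $G=\mathrm{SL}_n(\mathbb{R})$, $\Gamma=\mathrm{SL}_n(\mathbb{Z})$, $\pi:G\to G/\Gamma$ the natural projection, and let $\mathcal{Z}$ be a nonempty $\Gamma$-invariant subset of $\mathbb{Z}^n\setminus\{\vec 0\}$. Then: (1) Let $n=2s+t$ with integers $s>0$ and $t\ge 0$. There exists a form $f\in\mathbb{R}[x_1,\dots,x_n]$ of degree $n$ in $n$ variables, with $s$ the number of pairs of complex-conjugate linear forms dividing $f$, which is neither a norm form nor a quasi-norm form, although $f$ does not represent $0$ over $\mathbb{Q}$ non-trivially and $f(\mathcal{Z})$ is discrete at $0$. (2) If $H$ is a maximal torus of the real algebraic group $G$ which is not diagonalizable over $\mathbb{R}$, then there exists $g\in G$ such that the orbit $H\pi(g)$ is relatively compact in $G/\Gamma$ but not compact.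
   Context: A form of degree $n$ in $n$ variables is a homogeneous polynomial $f(\vec x)\in\mathbb{R}[\vec x]$, $\vec x=(x_1,\dots,x_n)$, which factors as $f=l_1\cdots l_n$ with $l_1,\dots,l_n$ linear forms with complex coefficients, linearly independent over $\mathbb{C}$. Up to scaling the factors, the $l_i$ consist of $s$ pairs of complex-conjugate (non-real) linear forms and $t$ real linear forms, $n=2s+t$. $f$ represents $0$ over $\mathbb{Q}$ non-trivially if $f(\vec v)=0$ for some $\vec v\in\mathbb{Q}^n\setminus\{\vec 0\}$. $f(\mathcal{Z})$ is discrete at $0$ if $f(\mathcal{Z})\cap(-\varepsilon,\varepsilon)\subseteq\{0\}$ for some $\varepsilon>0$. A torus of $G$ is a Zariski closed and Zariski connected subgroup of the real algebraic group $G$ that is diagonalizable over $\mathbb{C}$; $G$ acts on $G/\Gamma$ by left translations. $G$ acts on $\mathbb{R}[\vec x]$ by $(gp)(\vec x)=p(g^{-1}\vec x)$; forms $f$ and $gf$ with $g\in\mathrm{SL}_n(\mathbb{Q})$ are called $\mathbb{Q}$-equivalent. Norm form: let $K=\mathbb{Q}\alpha_1+\dots+\mathbb{Q}\alpha_n$ be a number field of degree $n$ and $\theta_1,\dots,\theta_n$ all the embeddings of $K$ into $\mathbb{C}$. Put $l_i(\vec x)=\theta_i(\alpha_1)x_1+\dots+\theta_i(\alpha_n)x_n$ and $\mathfrak{N}_K(\vec x)=\prod_{i=1}^n l_i(\vec x)$. A norm form is a form $\mathbb{Q}$-equivalent to $c\cdot\mathfrak{N}_K(\vec x)$ for some such $K$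 and some $c\in\mathbb{R}^*$. Quasi-norm form: let $F=\mathbb{Q}\alpha_1+\dots+\mathbb{Q}\alpha_s$ be a totally real number field of degree $s\ge1$ with real embeddings $\theta_1,\dots,\theta_s$; put $\lambda_i(\vec y)=\theta_i(\alpha_1)y_1+\dots+\theta_i(\alpha_s)y_s$ for $\vec y=(y_1,\dots,y_s)$. Let $q_1,\dots,q_s$ be definite quadratic forms on $\mathbb{R}^2$, let $n=2s$, and write $\vec x=(\vec x_1,\vec x_2)$ with $\vec x_1=(x_1,\dots,x_s)$, $\vec x_2=(x_{s+1},\dots,x_n)$. A quasi-norm form is a form $\mathbb{Q}$-equivalent to $q_1(\lambda_1(\vec x_1),\lambda_1(\vec x_2))\cdots q_s(\lambda_s(\vec x_1),\lambda_s(\vec x_2))$ for some such data. *)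

(* Defs.v *)
From HB Require Import structures.
From mathcomp Require Import all_boot all_order all_algebra.
From mathcomp Require Import fieldext.
From mathcomp Require Import all_classical all_reals all_analysis.
From mathcomp Require Import complex.
(* mpoly's notations clash with those of mathcomp-analysis. *)
From mathcomp Require Import -(notations) mpoly.

Set Implicit Arguments.
Unset Strict Implicit.
Unset Printing Implicit Defensive.

Import Order.TTheory GRing.Theory Num.Theory numFieldNormedType.Exports.

Local Open Scope classical_set_scope.
Local Open Scope quotient_scope.
Local Open Scope ring_scope.
Local Open Scope complex_scope.

Definition mvar (S : nzRingType) (n : nat) (j : 'I_n) : mpoly n S :=
  mpolyX S (mnm1 j).

Definition linform (S : comNzRingType) (n : nat) (a : 'rV[S]_n) : mpoly n S :=
  \sum_(j < n) a 0 j *: mvar S j.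

(* (g p)(x) = p (g^-1 x), with x a column vector *)
Definition mact (S : comUnitRingType) (n : nat) (g : 'M[S]_n) (p : mpoly n S) :
    mpoly n S :=
  comp_mpoly [tuple linform (row k (invmx g)) | k < n] p.

Definition mpolyRC (R : realType) (n : nat) (p : mpoly n R) : mpoly n R[i] :=
  map_mpoly (real_complex R) p.

Definition is_form (R : realType) (n : nat) (f : mpoly n R) : Prop :=
  f \is ishomog1 n mdeg /\
  exists2 L : 'M[R[i]]_n, row_free L &
    mpolyRC f = \prod_(i < n) linform (row i L).

(* Up to a nonzero scalar, the linear factors of f are s conjugate pairs (the
   rows of A and their conjugates) and t real forms (the rows of B). Linear
   independence forces the rows of A not to be proportional to real ones. The
   scalar c cannot be absorbed in general: its sign matters when t = 0. *)
Definition has_conj_pairs (R : realType) (n : nat) (f : mpoly n R) (s t : nat) :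
    Prop :=
  exists (c : R) (A : 'M[R[i]]_(s, n)) (B : 'M[R]_(t, n)),
    [/\ c != 0,
        row_free (col_mx A (col_mx (map_mx conjc A)
                                   (map_mx (real_complex R) B))) &
        mpolyRC f =
          c%:C *: (\prod_(i < s)
                      (linform (row i A) * linform (row i (map_mx conjc A))) *
                   \prod_(i < t)
                      linform (row i (map_mx (real_complex R) B)))].

Definition represents_zero (R : realType) (n : nat) (f : mpoly n R) : Prop :=
  exists2 v : 'cV[rat]_n, v != 0 & meval (fun j => ratr (v j 0)) f = 0.

Definition values_on (R : realType) (n : nat) (f : mpoly n R)
    (Z : set 'cV[int]_n) : set R :=
  [set meval (fun j => (v j 0)%:~R) f | v in Z].

Definition discrete_at_0 (R : realType) (V : set R) : Prop :=
  exists2 eps : R, 0 < eps & V `&` `]- eps, eps[ `<=` [set 0].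

Definition Q_equivalent (R : realType) (n : nat) (f f' : mpoly n R) : Prop :=
  exists2 g : 'M[rat]_n, \det g = 1 & f' = mact (map_mx ratr g) f.

(* theta enumerates, without repetition, all the embeddings of K into S *)
Definition enum_embeddings (K : fieldType) (S : nzRingType) (n : nat)
    (theta : 'I_n -> {rmorphism K -> S}) : Prop :=
  (forall i j, theta i =1 theta j -> i = j) /\
  (forall phi : {rmorphism K -> S}, exists i, phi =1 theta i).

Definition embedded_linform (K : fieldType) (S : comNzRingType) (n : nat)
    (alpha : n.-tuple K) (theta : {rmorphism K -> S}) : mpoly n S :=
  linform (\row_j theta (tnth alpha j)).

(* The norm polynomial is defined with complex coefficients; p is that
   polynomial seen in R[x]. *)
Definition is_norm_form (R : realType) (n : nat) (f : mpoly n R) : Prop :=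
  exists (K : fieldExtType rat) (alpha : n.-tuple K)
      (theta : 'I_n -> {rmorphism K -> R[i]}) (c : R) (p : mpoly n R),
    [/\ basis_of fullv alpha, enum_embeddings theta, c != 0,
        mpolyRC p = \prod_(i < n) embedded_linform alpha (theta i) &
        Q_equivalent (c *: p) f].

Definition totally_real (R : realType) (F : fieldType) : Prop :=
  forall (phi : {rmorphism F -> R[i]}) (x : F), exists r : R, phi x = r%:C.

Definition definite_binary (R : realType) (q : mpoly 2 R) : Prop :=
  q \is ishomog1 2 mdeg /\
  ((forall v : 'rV[R]_2, v != 0 -> 0 < meval (v 0) q) \/
   (forall v : 'rV[R]_2, v != 0 -> meval (v 0) q < 0)).

(* substitution of the variables x_{u 0}, ..., x_{u (s-1)} for y_1, ..., y_s *)
Definition msubvar (S : comNzRingType) (s n : nat) (u : 'I_s -> 'I_n)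
    (p : mpoly s S) : mpoly n S :=
  comp_mpoly [tuple mvar S (u k) | k < s] p.

Definition is_quasi_norm_form (R : realType) (n : nat) (f : mpoly n R) : Prop :=
  exists (s : nat) (ens : (s + s)%N = n) (F : fieldExtType rat)
      (alpha : s.-tuple F) (theta : 'I_s -> {rmorphism F -> R})
      (q : 'I_s -> mpoly 2 R),
    [/\ (0 < s)%N /\ basis_of fullv alpha,
        totally_real R F, enum_embeddings theta,
        forall i, definite_binary (q i) &
        let x1 k := cast_ord ens (lshift s k) in
        let x2 k := cast_ord ens (rshift s k) in
        let lambda i := embedded_linform alpha (theta i) in
        Q_equivalent
          (\prod_(i < s)
             comp_mpoly [tuple msubvar x1 (lambda i); msubvar x2 (lambda i)]
                        (q i))
          f].

Definition SLset (S : comNzRingType) (n : nat) : set 'M[S]_n :=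
  [set g | \det g = 1].

(* SL_n(R) with the topology induced by that of 'M[R]_n *)
Notation SL R n := (set_type (@SLset R n)).

Section Quotient.
Context (R : realType) (n : nat).

Definition same_coset (x y : SL R n) : bool :=
  `[< exists2 c : 'M[int]_n, SLset c & val y = val x *m map_mx intr c >].

Lemma same_coset_refl : reflexive same_coset.
Proof.
move=> x; apply/asboolP; exists 1%:M; first by rewrite /SLset /= det1.
by rewrite map_mx1 mulmx1.
Qed.

Lemma same_coset_sym : ssrbool.symmetric same_coset.
Proof.
suff H x y : same_coset x y -> same_coset y x.
  by move=> x y; apply/idP/idP => /H.
move=> /asboolP[c /= c1 e]; apply/asboolP; exists (\adj c) => /=.
  have := congr1 determinant (mul_mx_adj c).
  by rewrite det_mulmx c1 mul1r det1.
by rewrite e -mulmxA -map_mxM mul_mx_adj c1 map_mx1 mulmx1.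
Qed.

Lemma same_coset_trans : transitive same_coset.
Proof.
move=> y x z /asboolP[c /= c1 e] /asboolP[d /= d1 e']; apply/asboolP.
exists (c *m d) => /=; first by rewrite /SLset /= det_mulmx c1 d1 mulr1.
by rewrite e' e map_mxM mulmxA.
Qed.

Canonical same_coset_equiv :=
  EquivRel same_coset same_coset_refl same_coset_sym same_coset_trans.

(* SL_n(R) / SL_n(Z) with the quotient topology *)
Local Notation SLquot := (quotient_topology {eq_quot same_coset_equiv}).

Definition SLproj (g : SL R n) : SLquot := \pi_SLquot g.

Definition SLorbit (H : set 'M[R]_n) (g : SL R n) : set SLquot :=
  [set SLproj x | x in [set x : SL R n | exists2 h, H h & val x = h *m val g]].

End Quotient.

Notation SLquot R n := (quotient_topology {eq_quot (@same_coset_equiv R n)}).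

Definition zariski_closed (R : realType) (n : nat) (A : set 'M[R]_n) : Prop :=
  exists I : set (mpoly (n * n) R),
    A = [set g | forall p, I p -> meval (mxvec g 0) p = 0].

Definition zariski_connected (R : realType) (n : nat) (H : set 'M[R]_n) : Prop :=
  forall A B, zariski_closed A -> zariski_closed B ->
    H `<=` A `|` B -> H `&` A `&` B = set0 -> H `<=` A \/ H `<=` B.

Definition subgroup_of_SL (R : realType) (n : nat) (H : set 'M[R]_n) : Prop :=
  [/\ H `<=` @SLset R n, H 1%:M,
      forall g h, H g -> H h -> H (g *m h) &
      forall g, H g -> H (invmx g)].

Definition diagonalizable_over (R : realType) (F : fieldType)
    (iota : {rmorphism R -> F}) (n : nat) (H : set 'M[R]_n) : Prop :=
  exists2 P : 'M[F]_n, P \in unitmx &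
    forall h, H h -> is_diag_mx (P *m map_mx iota h *m invmx P).

Definition torus (R : realType) (n : nat) (H : set 'M[R]_n) : Prop :=
  [/\ subgroup_of_SL H, zariski_closed H, zariski_connected H &
      diagonalizable_over (real_complex R) H].

Definition maximal_torus (R : realType) (n : nat) (H : set 'M[R]_n) : Prop :=
  torus H /\ forall H', torus H' -> H `<=` H' -> H' = H.

(* Main.v *)
(* Both parts rest on one construction. An irreducible monic integral polynomial
   with real roots a_i gives real linear forms W_i (the rows of its Vandermonde
   matrix) whose product is, up to sign, at least 1 on nonzero integral vectors.
   Merging W_i and W'_i into W_i + i tau W'_i with tau > 0 transcendental keeps
   the product bounded below and makes the line spanned by the new form
   non-algebraic; when there are no real forms, a unipotent shear involving tau
   makes even the plane spanned by a form and its conjugate non-algebraic.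

   The resulting form is not a (quasi-)norm form: the zero set of such a form is
   a finite union of subspaces defined over the algebraic numbers, and a subspace
   contained in a finite union of subspaces is contained in one of them.

   A maximal torus H that is not split over R is the common stabiliser, in SL_n,
   of the lines spanned by s > 0 conjugate pairs and t real forms, since this
   stabiliser is itself a torus. Choose g carrying these forms to the generic
   ones. The lower bound for the product is constant along H, so the orbit is
   precompact by Mahler's criterion. If it were compact, H pi(g) would be locally
   closed and carry the topology of H (Baire), so elements of H expanding all the
   forms but one (or one conjugate pair when t = 0) would return near g, that is,
   some c in SL_n(Z) would act diagonally on the generic forms with all but one
   (resp. two) eigenvalues in the open unit disc. Integrality of the characteristic
   polynomial then isolates an eigenspace of c equal to the non-algebraic line or
   plane, although the eigenspaces of c are algebraic. *)
Require Import Defs.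
From HB Require Import structures.
From mathcomp Require Import all_boot all_order all_algebra.
From mathcomp Require Import falgebra fieldext.
From mathcomp Require Import all_classical all_reals all_analysis.
From mathcomp Require Import complex polyrcf.
From mathcomp Require Import ring lra zify.
From mathcomp Require Import -(notations) mpoly.

Set Implicit Arguments.
Unset Strict Implicit.
Unset Printing Implicit Defensive.

Import Order.TTheory GRing.Theory Num.Theory numFieldNormedType.Exports.
Local Open Scope classical_set_scope.
Local Open Scope ring_scope.

(** * Reduction of positive definite forms *)

(** Two algebraicity obstructions have to be defeated by the same forms. When a real form is
    present, spoiling the line of one complex form is enough: the real zeros of a quasi-norm form
    lie in finitely many subspaces of codimension two, so they cannot contain the hyperplane of a
    real form; and a single real form can absorb all the compensation for expanding the others, so
    that only one eigenvalue of the returning integral matrix is unconstrained, its spectrum is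
    simple and its eigenspaces are lines. Without real forms both arguments degrade. The form itself
    now has real zeros of codimension two only, and the compensation falls on a conjugate pair,
    whose two eigenvalues may coincide, so that only the plane of the pair is an eigenspace. This is
    why the plane has to be non-algebraic exactly when [t = 0]. For [s = 1] and [t = 0] this is
    impossible, the plane being the whole space; indeed every definite binary form is a quasi-norm
    form. Here [n >= 3] is essential: it gives [s > 1], hence a second column in which to place the
    shear. *)

Section Reduction.
Variable R : realType.

Definition intmx m n (A : 'M[int]_(m, n)) : 'M[R]_(m, n) := map_mx intr A.

Definition qform n (S : 'M[R]_n) (x : 'cV[R]_n) : R := (x^T *m S *m x) 0 0.

(** The positivity the reduction works with: it passes to the Schur complement with an explicit
    constant. *)
Definition int_bounded_below n (S : 'M[R]_n) (m : R) : Prop :=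
  forall v : 'cV[int]_n, v != 0 -> m <= qform S (intmx v).

Lemma qformM n (S A : 'M[R]_n) x : qform (A^T *m S *m A) x = qform S (A *m x).
Proof. by rewrite /qform trmx_mul !mulmxA. Qed.

Lemma qform_intZ n (S : 'M[R]_n) (d : int) (v : 'cV[int]_n) :
  qform S (intmx (d *: v)) = d%:~R ^+ 2 * qform S (intmx v).
Proof.
rewrite /qform /intmx map_mxZ /=.
have -> (a : R) (x : 'cV[R]_n) : (a *: x)^T = a *: x^T by rewrite linearZ.
rewrite -!scalemxAl -scalemxAr scalerA.
by rewrite mxE expr2.
Qed.

Lemma intmxM m n p (A : 'M[int]_(m, n)) (B : 'M[int]_(n, p)) :
  intmx (A *m B) = intmx A *m intmx B.
Proof. exact: map_mxM. Qed.

Lemma det_intmx n (A : 'M[int]_n) : \det (intmx A) = (\det A)%:~R.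
Proof. exact: det_map_mx. Qed.

Lemma unit_int_sqr (d : int) : d \is a GRing.unit -> (d%:~R : R) ^+ 2 = 1.
Proof. by case/orP => /eqP ->; rewrite ?rmorphN ?sqrrN expr1n. Qed.

Definition unipotent n (u : 'rV[R]_n) : 'M[R]_(1 + n) := block_mx 1%:M u 0 1%:M.

Lemma qform_block n (r : R) (u : 'rV[R]_n) (S : 'M[R]_n) (x : 'cV[R]_1) w :
  qform ((unipotent u)^T *m block_mx r%:M 0 0 S *m unipotent u) (col_mx x w) =
    r * (x 0 0 + (u *m w) 0 0) ^+ 2 + qform S w.
Proof.
rewrite qformM /unipotent mul_block_col mul1mx mul0mx add0r mul1mx.
rewrite /qform tr_col_mx mul_row_block !mulmx0 add0r addr0 mul_row_col mxE.
congr (_ + _); rewrite mul_mx_scalar -scalemxAl !mxE big_ord1 !mxE.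
by rewrite expr2.
Qed.

(** Being within a factor [4 / 3] of the infimum avoids proving that it is attained. The constant is
    used twice in [peel]: [d ^+ 2 * (3 / 4) <= 1] forces a divisor [d] of the vector to be a unit,
    and [3 / 4 - 1 / 4] leaves the bound [r / 2] for the complement. *)
Lemma near_min n (S : 'M[R]_n.+1) m : 0 < m -> int_bounded_below S m ->
  exists2 v : 'cV[int]_n.+1, v != 0 &
    forall w, w != 0 -> qform S (intmx v) * (3 / 4) <= qform S (intmx w).
Proof.
move=> m0 hS.
pose E := [set qform S (intmx v) | v in [set v : 'cV[int]_n.+1 | v != 0]].
have E0 : E !=set0.
  exists (qform S (intmx (const_mx 1))), (const_mx 1) => //=.
  by apply/eqP => /matrixP /(_ 0 0) /eqP; rewrite !mxE oner_eq0.
have Em : lbound E m by move=> _ [v v0 <-]; exact: hS.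
have mE : m <= inf E by exact: lb_le_inf.
have e0 : 0 < inf E / 3 by apply: divr_gt0 => //; exact: lt_le_trans mE.
have [_ [v v0 <-] hv] := inf_adherent e0 (conj E0 (ex_intro _ m Em)).
exists v => // w w0; have : inf E <= qform S (intmx w).
  by apply: ge_inf; [exists m | exists w].
by lra.
Qed.

(** The Smith normal form of a column is a multiple of the first basis vector; primitivity makes
    that multiple a unit, which is absorbed into the first column of the unimodular factor. *)
Lemma primitive_completion n (v : 'cV[int]_n.+1) :
  (forall d w, v = d *: w -> d \is a GRing.unit) ->
  exists2 g : 'M[int]_n.+1, g \in unitmx & col 0 g = v.
Proof.
move=> vP; have [L Lu [r ru [d _ vE]]] := int_Smith_normal_form v.
pose e : 'cV[int]_n.+1 := \col_i (i == 0)%:R.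
have XE : (\matrix_(i, j) (d`_i *+ (i == j :> nat))) = d`_0 *: e :> 'cV_n.+1.
  apply/matrixP => i j; rewrite !mxE ord1; case: (i =P 0) => [->|/eqP i0].
    by rewrite mulr1n mulr1.
  by rewrite (_ : (i == 0 :> nat) = false) ?mulr0n ?mulr0 //; apply/negbTE.
have {}vE : v = (d`_0 * r 0 0) *: (L *m e).
  rewrite {1}vE XE [r]mx11_scalar mul_mx_scalar -scalemxAr scalerA mulrC.
  by rewrite mxE eqxx mulr1n.
have cu := vP _ _ vE; set c := d`_0 * _ in vE cu.
exists (L *m diag_mx (\row_i if i == 0 then c else 1)).
  rewrite unitmx_mul Lu /= unitmxE det_diag; apply: rpred_prod => i _.
  by rewrite mxE; case: ifP.
rewrite vE colE -mulmxA scalemxAr; congr (_ *m _).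
rewrite -colE; apply/colP => i; rewrite !mxE.
by case: ifP => _; rewrite ?mulr0n ?mulr0 // mulr1n mulr1.
Qed.

(** Completing the square along a nearly shortest vector, moved to the first basis vector. An
    integral [w] is lifted with the first coordinate that makes the completed linear term at most
    1/2 in absolute value; near-minimality then reads [r * (3 / 4) <= r / 4 + qform S' w]. *)
Lemma peel n (S : 'M[R]_(1 + n)) m :
    0 < m -> S^T = S -> int_bounded_below S m ->
  exists g : 'M[int]_(1 + n), exists (r : R) (u : 'rV[R]_n) (S' : 'M[R]_n),
    [/\ g \in unitmx, m <= r, S'^T = S', int_bounded_below S' (r / 2) &
      (intmx g)^T *m S *m intmx g =
        (unipotent u)^T *m block_mx r%:M 0 0 S' *m unipotent u].
Proof.
move=> m0 symS hS; have [v v0 vmin] := near_min m0 hS.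
have qv : 0 < qform S (intmx v) by apply: lt_le_trans m0 (hS _ v0).
have [d w vE|g gu gv] := @primitive_completion n v.
  have w0 : w != 0 by apply: contraNneq v0 => w0; rewrite vE w0 scaler0.
  have := vmin _ w0; rewrite {1}vE qform_intZ => h.
  have qw : 0 < qform S (intmx w) by apply: lt_le_trans m0 (hS _ w0).
  have {}h : (d%:~R : R) ^+ 2 * (3 / 4) <= 1.
    by rewrite -(ler_pM2r qw) mul1r -mulrA [3 / 4 * _]mulrC mulrA.
  have d0 : d != 0 by apply: contraNneq v0 => d0; rewrite vE d0 scale0r.
  have {}h : d ^+ 2 < 2 by rewrite -(ltr_int R) rmorphXn /=; lra.
  by rewrite unfold_in /=; nia.
pose S1 : 'M[R]_(1 + n) := (intmx g)^T *m S *m intmx g; pose r := qform S (intmx v).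
have S1E (x : 'cV[R]_(1 + n)) : qform S1 x = qform S (intmx g *m x).
  exact: qformM.
have symS1 : S1^T = S1 by rewrite /S1 !trmx_mul trmxK symS mulmxA.
have e0E : col_mx 1%:M 0 = delta_mx 0 0 :> 'cV[R]_(1 + n).
  apply/colP => i; rewrite !mxE andbT.
  have -> : (i == 0) = (i == 0%N :> nat) by [].
  by case: splitP => j ->; rewrite !mxE // ord1.
have r1 : ulsubmx S1 = r%:M.
  rewrite [LHS]mx11_scalar; congr _%:M; rewrite /r -gv.
  have -> : intmx (col 0 g) = intmx g *m delta_mx 0 0.
    by rewrite -colE; apply/colP => i; rewrite !mxE.
  rewrite -S1E -e0E /qform tr_col_mx trmx1 trmx0 -[S1]submxK.
  rewrite mul_row_block !mul1mx !mul0mx !addr0 mul_row_col mulmx1 mulmx0 addr0.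
  by rewrite submxK.
have r0 : r != 0 by rewrite gt_eqF.
pose u := r^-1 *: ursubmx S1.
pose S' := drsubmx S1 - r *: (u^T *m u).
have dl : dlsubmx S1 = (ursubmx S1)^T by rewrite trmx_ursub symS1.
have dr : (drsubmx S1)^T = drsubmx S1 by rewrite trmx_drsub symS1.
have symS' : S'^T = S'.
  rewrite /S' linearB /= dr; congr (_ - _).
  by rewrite linearZ /= trmx_mul trmxK.
have SE : S1 = (unipotent u)^T *m block_mx r%:M 0 0 S' *m unipotent u.
  rewrite /unipotent tr_block_mx !trmx1 trmx0 mulmx_block.
  rewrite !(mul1mx, mulmx1, mul0mx, mulmx0, addr0, add0r) mulmx_block.
  rewrite !(mul1mx, mulmx1, mul0mx, mulmx0, addr0, add0r).
  rewrite -[LHS]submxK r1; congr block_mx.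
  - by rewrite mul_scalar_mx /u scalerA mulfV ?scale1r.
  - by rewrite mul_mx_scalar /u linearZ /= scalerA mulfV ?scale1r.
  - rewrite /S' mul_mx_scalar -scalemxAl addrC subrK //.
exists g, r, u, S'; split=> //; first exact: hS.
move=> w w0; pose p := (u *m intmx w) 0 0.
pose k := - Num.floor (p + 1 / 2).
have hk : (k%:~R + p) ^+ 2 <= 1 / 4.
  have := floor_itv (p + 1 / 2); rewrite /k mulrNz intrD; nra.
have vk0 : col_mx (k%:M : 'cV[int]_1) w != 0.
  by apply: contraNneq w0 => /eqP; rewrite col_mx_eq0 => /andP[_].
have gk0 : g *m col_mx k%:M w != 0.
  apply: contraNneq vk0 => h; rewrite -[col_mx _ _]mul1mx -(mulVmx gu) -mulmxA h.
  by rewrite mulmx0.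
have := vmin _ gk0; rewrite intmxM -S1E SE.
have -> : intmx (col_mx k%:M w) = col_mx (k%:~R%:M) (intmx w).
  by rewrite /intmx map_col_mx map_scalar_mx.
rewrite qform_block mxE eqxx mulr1n -/p -/r => h.
have : r * (k%:~R + p) ^+ 2 <= r * (1 / 4) by rewrite ler_pM2l.
lra.
Qed.

Lemma det_peel n (S : 'M[R]_(1 + n)) (g : 'M[int]_(1 + n)) r u (S' : 'M[R]_n) :
  g \in unitmx ->
  (intmx g)^T *m S *m intmx g =
    (unipotent u)^T *m block_mx r%:M 0 0 S' *m unipotent u ->
  \det S = r * \det S'.
Proof.
rewrite unitmxE => gu /(congr1 determinant).
rewrite !det_mulmx !det_tr /unipotent !det_ublock !det1 !mul1r !mulr1 det_intmx.
by rewrite det_scalar expr1 mulrAC -expr2 unit_int_sqr // mul1r.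
Qed.

(** A crude Hermite inequality: the pivot is at least [m] and the complement is bounded below by
    half the pivot, so each dimension costs a power of two. Its purpose is to bound pivots from
    above by the determinant. *)
Lemma det_lower_bound n : exists2 c : R, 0 < c &
  forall (S : 'M[R]_n) m, 0 < m -> S^T = S -> int_bounded_below S m ->
    c * m ^+ n <= \det S.
Proof.
elim: n => [|n [c c0 IH]].
  by exists 1 => // S m _ _ _; rewrite det_mx00 expr0 mulr1.
exists (c / 2 ^+ n); first by rewrite divr_gt0 ?exprn_gt0.
move=> S m m0 symS hS.
have [g [r [u [S' [gu mr symS' hS' E]]]]] := @peel n S m m0 symS hS.
rewrite (@det_peel n S g r u S' gu E).
have r0 : 0 < r by exact: lt_le_trans mr.
have /IH := hS'; rewrite divr_gt0 // => /(_ isT symS') h.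
apply: le_trans (_ : r * (c * (r / 2) ^+ n) <= _); last by rewrite ler_pM2l.
rewrite exprMn exprVn exprS.
have -> : c / 2 ^+ n * (m * m ^+ n) = c / 2 ^+ n * m ^+ n * m by ring.
have -> : r * (c * (r ^+ n / 2 ^+ n)) = c / 2 ^+ n * r ^+ n * r by ring.
have k0 : 0 <= c / 2 ^+ n by rewrite divr_ge0 ?exprn_ge0 // ltW.
apply: ler_pM => //; rewrite ?mulr_ge0 ?exprn_ge0 ?(ltW m0) ?(ltW c0) //.
by apply: ler_wpM2l => //; apply: lerXn2r; rewrite // nnegrE ltW.
Qed.

(* Hermite's reduction: induction on the dimension, splitting off a nearly
   shortest vector and passing to the Schur complement. *)
Lemma gram_reduction n : forall m D : R, 0 < m -> exists C : R,
  forall S : 'M[R]_n, S^T = S -> int_bounded_below S m -> \det S <= D ->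
  exists2 g : 'M[int]_n, g \in unitmx & forall j, qform S (intmx (col j g)) <= C.
Proof.
elim: n => [|n IH] m D m0.
  by exists 0 => S _ _ _; exists 1%:M; [rewrite unitmx1 | case].
have [c c0 detc] := det_lower_bound n.
have m20 : 0 < m / 2 by rewrite divr_gt0.
have [C hC] := IH (m / 2) (Num.max D 0 / m) m20.
(* [B] bounds the pivot: if [r >= 1], then [r * (c / 2 ^+ n) <= \det S <= D]. The summand [B / 4]
   below is the cost of rounding the first coordinate of the remaining basis vectors. *)
pose B := Num.max 1 (D * 2 ^+ n / c).
exists (Num.max B (C + B / 4)) => S symS hS dS.
have [g [r [u [S' [gu mr symS' hS' E]]]]] := @peel n S m m0 symS hS.
have r0 : 0 < r by exact: lt_le_trans mr.
have dSE : \det S = r * \det S'.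
  exact: det_peel gu E.
have r20 : 0 < r / 2 by rewrite divr_gt0.
have dS' := detc _ _ r20 symS' hS'.
have rB : r <= B.
  rewrite /B le_max; case: leP => //= r1.
  rewrite ler_pdivlMr // -(@ler_pM2r _ (2 ^- n)) ?invr_gt0 ?exprn_gt0 //.
  rewrite mulfK ?expf_neq0 ?pnatr_eq0 //; apply: le_trans dS; rewrite dSE.
  rewrite -mulrA ler_pM2l //; apply: le_trans dS'.
  rewrite ler_pM2l // exprMn exprVn ler_peMl ?invr_ge0 ?exprn_ge0 //.
  exact/exprn_ege1/ltW.
have hmS' : int_bounded_below S' (m / 2).
  by move=> v v0; apply: le_trans (hS' v v0); rewrite ler_pM2r // invr_gt0.
have dS'D : \det S' <= Num.max D 0 / m.
  rewrite ler_pdivlMr // le_max; apply/orP; left; apply: le_trans dS.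
  rewrite dSE mulrC ler_pM2r //; apply: lt_le_trans dS'.
  by rewrite mulr_gt0 ?exprn_gt0.
have [g' g'u hg'] := hC S' symS' hmS' dS'D.
pose k : 'rV[int]_n := \row_j - Num.floor ((u *m intmx (col j g')) 0 0 + 1 / 2).
pose M : 'M[int]_(1 + n) := block_mx 1%:M k 0 g'.
have Mu : M \in unitmx by rewrite unitmxE det_ublock det1 mul1r -unitmxE.
exists (g *m M) => [|j]; first by rewrite unitmx_mul gu.
rewrite colE -mulmxA -colE intmxM -qformM E /M [block_mx 1%:M k 0 g']block_mxEh le_max.
rewrite -[n.+1]/(1 + n)%N in j *.
rewrite -[j]splitK; case: (fintype.split j) => {}j /=.
  rewrite colKl; apply/orP; left; apply: le_trans rB.
  have -> : intmx (col j (col_mx 1%:M 0)) = col_mx 1%:M 0 :> 'cV_(1 + n).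
    apply/colP => i; rewrite ord1 !mxE; case: (fintype.split i) => i' /=; rewrite !mxE //.
    by rewrite ord1.
  rewrite qform_block mulmx0 !mxE eqxx addr0 expr1n mulr1.
  by rewrite /qform mulmx0 mxE addr0.
rewrite colKr col_col_mx.
have -> : intmx (col_mx (col j k) (col j g')) =
    col_mx (intmx (col j k)) (intmx (col j g')) by rewrite /intmx map_col_mx.
rewrite qform_block !mxE; apply/orP; right.
rewrite addrC; apply: lerD (hg' j) _.
set p := ((\sum_(_ < _) _)).
have h : ((- Num.floor (p + 1 / 2))%:~R + p) ^+ 2 <= 1 / 4.
  have := floor_itv (p + 1 / 2); rewrite mulrNz intrD; nra.
have : r * ((- Num.floor (p + 1 / 2))%:~R + p) ^+ 2 <= r * (1 / 4) by rewrite ler_pM2l.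
by move: rB; lra.
Qed.

Lemma qform_gram n (g : 'M[R]_n) x :
  qform (g^T *m g) x = \sum_i (g *m x) i 0 ^+ 2.
Proof.
have -> : g^T *m g = g^T *m 1%:M *m g by rewrite mulmx1.
rewrite qformM /qform mulmx1 mxE; apply: eq_bigr => i _.
by rewrite mxE expr2.
Qed.

Lemma lattice_reduction n (m : R) : 0 < m -> exists C : R,
  forall g : 'M[R]_n, \det g = 1 ->
    (forall v : 'cV[int]_n, v != 0 -> m <= \sum_i (g *m intmx v) i 0 ^+ 2) ->
  exists2 c : 'M[int]_n, \det c = 1 & forall i j, `|(g *m intmx c) i j| <= C.
Proof.
move=> m0; have [C hC] := @gram_reduction n m 1 m0.
exists (Num.max C 1) => g dg hg.
have [|||c cu hc] := hC (g^T *m g).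
- by rewrite trmx_mul trmxK.
- by move=> v v0; rewrite qform_gram; exact: hg.
- by rewrite det_mulmx det_tr dg mulr1.
have {}hc i j : `|(g *m intmx c) i j| <= Num.max C 1.
  have h : (g *m intmx c) i j ^+ 2 <= C.
    apply: le_trans (hc j); rewrite qform_gram (bigD1 i) //=.
    have -> : (g *m intmx (col j c)) i 0 = (g *m intmx c) i j.
      by rewrite !mxE; apply: eq_bigr => k _; rewrite !mxE.
    by rewrite lerDl sumr_ge0 // => k _; exact: sqr_ge0.
  rewrite -real_normK ?num_real // in h; rewrite le_max.
  by case: (leP `|(g *m intmx c) i j| 1) => [|h1]; rewrite ?orbT // orbF; nra.
move: cu; rewrite unitmxE => /orP[/eqP c1|/eqP cN1]; first by exists c.
(* A basis of determinant -1 is corrected by changing the sign of its first vector; in dimension 0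
   the determinant is 1. *)
case: n => [|n] in g dg hg c hc cN1 hC *; first by move: cN1; rewrite det_mx00.
exists (c *m diag_mx (\row_i if i == 0 then -1 else 1)).
  rewrite det_mulmx cN1 det_diag (bigD1 0) //= mxE eqxx big1 ?mulr1 //.
  by move=> i i0; rewrite mxE (negPf i0).
move=> i j; rewrite intmxM mulmxA.
have -> : intmx (diag_mx (\row_i if i == 0 then -1 else 1)) =
    diag_mx (\row_i if i == 0 then -1 else 1) :> 'M[R]_n.+1.
  by rewrite /intmx map_diag_mx; congr diag_mx; apply/rowP => k; rewrite !mxE; case: ifP.
rewrite mul_mx_diag !mxE.
by case: ifP => _; rewrite ?mulr1 ?mulrN1 ?normrN; have := hc i j; rewrite mxE.
Qed.

End Reduction.

(** * Algebraic and transcendental numbers *)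

Section AlgebraicNumbers.
Variable R : realType.
Local Open Scope complex_scope.
Local Notation C := R[i].

Definition algebraic (x : C) : Prop := algebraicOver (ratr : rat -> C) x.

Definition algnum : {pred C} := fun x => `[< algebraic x >].

Lemma algnumP x : reflect (algebraic x) (x \in algnum).
Proof. exact: asboolP. Qed.

Lemma algnum_divring_closed : divring_closed algnum.
Proof.
split=> [|x y /algnumP ax /algnumP ay|x y /algnumP ax /algnumP ay]; apply/algnumP.
- exact: algebraic1.
- exact: algebraic_sub.
- exact: algebraic_div.
Qed.

HB.instance Definition _ := GRing.isDivringClosed.Build C algnum algnum_divring_closed.

(** The algebraic numbers as a field of their own, so that Gaussian elimination carried out over
    them is transported to the complex numbers by the inclusion. *)
Record algsub := AlgSub { algval : C; algvalP : algval \in algnum }.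
HB.instance Definition _ := [isSub for algval].
HB.instance Definition _ := [Choice of algsub by <:].
HB.instance Definition _ := [SubChoice_isSubComUnitRing of algsub by <:].
HB.instance Definition _ := [SubComUnitRing_isSubIntegralDomain of algsub by <:].
HB.instance Definition _ := [SubIntegralDomain_isSubField of algsub by <:].

Definition algebraic_mx m n (A : 'M[C]_(m, n)) := forall i j, algebraic (A i j).

Lemma algebraic_mxP m n (A : 'M[C]_(m, n)) :
  algebraic_mx A <-> exists B : 'M[algsub]_(m, n), A = map_mx (val : algsub -> C) B.
Proof.
split=> [hA|[B ->] i j]; last by rewrite mxE; apply/algnumP/algvalP.
have hA' i j : A i j \in algnum by apply/algnumP.
by exists (\matrix_(i, j) AlgSub (hA' i j)); apply/matrixP => i j; rewrite !mxE.
Qed.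

Lemma algebraic_kermx m n (A : 'M[C]_(m, n)) :
  algebraic_mx A -> algebraic_mx (kermx A).
Proof.
move=> /algebraic_mxP[B ->]; apply/algebraic_mxP; exists (kermx B).
by rewrite map_kermx.
Qed.

Lemma algebraic_mulmx m n p (A : 'M[C]_(m, n)) (B : 'M[C]_(n, p)) :
  algebraic_mx A -> algebraic_mx B -> algebraic_mx (A *m B).
Proof.
move=> /algebraic_mxP[A' ->] /algebraic_mxP[B' ->]; apply/algebraic_mxP.
by exists (A' *m B'); rewrite map_mxM.
Qed.

Lemma algebraic_rat (q : rat) : algebraic (ratr q).
Proof. exact: algebraic_id. Qed.

Lemma algebraic_int (k : int) : algebraic k%:~R.
Proof. by rewrite -ratr_int; exact: algebraic_rat. Qed.

Lemma algebraic_intr_root (p : {poly int}) (x : C) :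
  p != 0 -> root (map_poly intr p) x -> algebraic x.
Proof.
move=> p0 px; exists (map_poly intr p).
  by rewrite map_poly_eq0_id0 // intr_eq0 lead_coef_eq0.
by rewrite -map_poly_comp /= (eq_map_poly (@ratr_int _)).
Qed.

Lemma algebraic_conj (x : C) : algebraic x -> algebraic (conjc x).
Proof.
case=> p p0 px; exists p => //.
have -> : map_poly ratr p = map_poly conjc (map_poly (ratr : rat -> C) p).
  by rewrite -map_poly_comp; apply: eq_map_poly => q /=; rewrite fmorph_rat.
by rewrite fmorph_root.
Qed.

Lemma algebraic_morph (K : fieldExtType rat) (phi : {rmorphism K -> C}) (x : K) :
  algebraic (phi x).
Proof.
have [/polyOver1P[p Dp]] := (minPolyOver 1%AS x, monic_minPoly 1%AS x).
rewrite Dp => p1; exists p.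
  by apply: contraTneq p1 => ->; rewrite map_poly0 monicE lead_coef0 eq_sym oner_eq0.
have -> : map_poly ratr p = map_poly phi (map_poly (in_alg K) p).
  by rewrite -map_poly_comp; apply: eq_map_poly => q; rewrite -(fmorph_eq_rat (phi \o in_alg K)).
by rewrite -Dp fmorph_root root_minPoly.
Qed.

(** There are countably many algebraic reals, whereas the unit interval has positive Lebesgue
    measure. *)
Lemma exists_transcendental : exists2 tau : R, 0 < tau & ~ algebraic tau%:C.
Proof.
pose A := [set x : R | algebraic x%:C].
have cA : countable A.
  have -> : A = \bigcup_(p in [set p : {poly rat} | p != 0])
                  [set x : R | root (map_poly ratr p) (x%:C : C)].
    by apply/seteqP; split=> x [p p0 px]; exists p.
  apply: bigcup_countable => [|p /= p0]; first exact: countableP.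
  have [s Ps] := closed_field_poly_normal (map_poly (ratr : rat -> C) p).
  apply/finite_set_countable/(@sub_finite_set _ _ [set complex.Re z | z in [set` s]]).
    move=> x /=; rewrite Ps rootZ ?lead_coef_eq0 ?map_poly_eq0 // root_prod_XsubC.
    by move=> xs; exists x%:C.
  by apply: finite_image; exact: finite_seq.
have [tau tau0 /= tA] : exists2 x : R, 0 < x & ~ A x.
  apply: contrapT => h.
  have sub : `]0, 1[%classic `<=` A.
    move=> x /=; rewrite in_itv /= => /andP[x0 _]; apply: contrapT => nA.
    by apply: h; exists x.
  have := countable_lebesgue_measure0 (sub_countable (subset_card_le sub) cA).
  rewrite lebesgue_measure_itv /= lte_fin ltr01 oppr0 adde0 => /eqP.
  by rewrite eqe oner_eq0.
by exists tau.
Qed.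

End AlgebraicNumbers.

(** * Forms with a product bounded below *)

Section TotallyReal.
Variable R : realType.

(* Irreducible by Eisenstein's criterion at 2, and with a real root between 4j - 2
   and 4j + 2 for every j < d. *)
Definition node_poly (d : nat) : {poly int} :=
  \prod_(i < d) ('X - (4 * i%:Z)%:P) + 2%:P.

Lemma node_prod_mod2 d : exists r : {poly int},
  \prod_(i < d) ('X - (4 * i%:Z)%:P) = 'X^d + 2 *: r.
Proof.
elim: d => [|d [r IH]]; first by exists 0; rewrite big_ord0 expr0 scaler0 addr0.
exists (r * 'X - (2 * d%:Z) *: ('X^d + 2 *: r)).
rewrite big_ord_recr /= IH exprSr mulrBr mulrDl mulrC [_ * (_)%:P]mulrC mul_polyC.
rewrite scalerBr !scalerDr !scalerA scalerAl mulrC -addrA; congr (_ + _).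
by congr (_ - (_ *: _ + _ *: _)); ring.
Qed.

Lemma size_node_prod d : size (\prod_(i < d) ('X - (4 * i%:Z)%:P)) = d.+1.
Proof. by rewrite size_prod_XsubC [index_enum _]unlock -enumT size_enum_ord. Qed.

Lemma node_poly_monic d : (0 < d)%N -> node_poly d \is monic.
Proof.
move=> d0; rewrite monicE lead_coefDl -?monicE ?monic_prod_XsubC //.
by rewrite size_node_prod size_polyC.
Qed.

Lemma size_node_poly d : (0 < d)%N -> size (node_poly d) = d.+1.
Proof.
by move=> d0; rewrite size_polyDl ?size_node_prod // size_polyC.
Qed.

Lemma node_poly_irreducible d : (0 < d)%N ->
  irreducible_poly (map_poly intr (node_poly d) : {poly rat}).
Proof.
move=> d0; apply/irreducible_rat_int/(@eisenstein_crit 2) => //.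
- by rewrite size_node_poly //; case: d d0.
- by rewrite (monicP (node_poly_monic d0)).
(* The factor with node 0 kills the constant term of the product, leaving 2, which 4 does not
   divide. *)
- rewrite -horner_coef0 hornerD hornerC horner_prod.
  by case: d d0 => // d _; rewrite big_ord_recl hornerXsubC mulr0 subrr mul0r add0r.
- move=> i; rewrite size_node_poly //= => id; have [r E] := node_prod_mod2 d.
  rewrite /node_poly E coefD coefC coefD coefXn coefZ ltn_eqF // add0r.
  by apply: rpredD; [exact: dvdz_mulr | case: ifP].
Qed.

(** Between these two points only the factor of index [j] changes sign. All factors have absolute
    value at least 2 there and [1 < d], so both products have absolute value at least 4 and adding 2
    does not alter their signs. *)
Lemma node_prod_sign (d j : nat) : (1 < d)%N -> (j < d)%N ->
  (node_poly d).[4 * j%:Z - 2] * (node_poly d).[4 * j%:Z + 2] < 0.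
Proof.
move=> d1 jd; rewrite /node_poly !hornerD !hornerC !horner_prod.
set S := \prod_(i < d) _; set T := \prod_(i < d) _.
have big (F : 'I_d -> int) : (forall i, 2 <= `|F i|) -> 4 <= `|\prod_i F i|.
  move=> hF; rewrite normr_prod; apply: (@le_trans _ _ (\prod_(i < d) 2)).
    by rewrite prodr_const card_ord (_ : 4 = 2 ^+ 2) ?ler_weXn2l // expr2; lia.
  by apply: ler_prod => i _; rewrite hF.
have hS : 4 <= `|S|.
  by apply: big => i; rewrite hornerXsubC; lia.
have hT : 4 <= `|T|.
  by apply: big => i; rewrite hornerXsubC; lia.
have hST : S * T < 0.
  rewrite -big_split (bigD1 (Ordinal jd)) //= !hornerXsubC nmulr_rlt0; last by nia.
  apply: prodr_gt0 => i ij; rewrite !hornerXsubC.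
  have : (i : nat) <> j by move=> E; case/eqP: ij; apply: val_inj.
  by move=> ?; nia.
nia.
Qed.

Lemma node_poly_roots d : (1 < d)%N -> exists2 a : 'I_d -> R, injective a &
  forall i, root (map_poly intr (node_poly d)) (a i).
Proof.
move=> d1; pose P : {poly R} := map_poly intr (node_poly d).
have rt (j : 'I_d) : {x : R | x \in `]4 * j%:R - 2, 4 * j%:R + 2[ & root P x}.
  apply: poly_ivtoo; first by lra.
  have E (k : int) : P.[k%:~R] = ((node_poly d).[k])%:~R by rewrite horner_map.
  have -> : 4 * j%:R - 2 = (4 * j%:Z - 2)%:~R :> R by rewrite rmorphB rmorphM.
  have -> : 4 * j%:R + 2 = (4 * j%:Z + 2)%:~R :> R by rewrite rmorphD rmorphM.
  by rewrite !E -intrM ltrz0; exact: node_prod_sign.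
exists (fun j => s2val (rt j)) => [i j|i]; last exact: (s2valP' (rt i)).
have := s2valP (rt i); have := s2valP (rt j).
case: (rt i) (rt j) => x /= _ _ [y /= _ _]; rewrite !in_itv /= => hy hx xy.
apply: val_inj => /=; subst y.
have h1 : (i%:R : R) < j.+1%:R by rewrite -natr1; lra.
have h2 : (j%:R : R) < i.+1%:R by rewrite -natr1; lra.
by move: h1 h2; rewrite !ltr_nat; lia.
Qed.

End TotallyReal.

(** * Norms in a totally real order *)

Section NormBound.
Variable R : realType.

Definition vander d (a : 'I_d -> R) : 'M[R]_d := \matrix_(i, j) a i ^+ j.

Lemma vander_unit d (a : 'I_d -> R) : injective a -> vander a \in unitmx.
Proof.
move=> ainj; rewrite -unitmx_tr unitmxE.
have -> : (vander a)^T = Vandermonde d (\row_i a i).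
  by apply/matrixP => i j; rewrite !mxE.
rewrite det_Vandermonde unitfE; apply/prodf_neq0 => i _; apply/prodf_neq0 => j ij.
rewrite !mxE subr_eq0; apply: contraTneq ij => /ainj ->.
by rewrite ltnn.
Qed.

Variables (d : nat) (p : {poly int}) (a : 'I_d -> R).
Hypotheses (pm : p \is monic) (sp : size p = d.+1)
  (pirr : irreducible_poly (map_poly intr p : {poly rat}))
  (ainj : injective a) (proot : forall i, root (map_poly intr p) (a i)).

(* Row i of the Vandermonde matrix is a common left eigenvector of the
   matrices of multiplication in Z[X]/(p), with value the evaluation at a_i. *)
Lemma vander_eigen (q : {poly int}) : exists N : 'M[int]_d,
  vander a *m intmx R N = diag_mx (\row_i (map_poly intr q).[a i]) *m vander a.
Proof.
pose r (j : 'I_d) := Pdiv.Ring.rmodp ('X^j * q) p.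
have sr j : (size (r j) <= d)%N.
  by rewrite -ltnS -sp Pdiv.Ring.ltn_rmodpN0 // monic_neq0.
exists (\matrix_(i, j) (r j)`_i); apply/matrixP => i j.
rewrite mul_diag_mx !mxE.
transitivity (map_poly intr (r j)).[a i].
  rewrite (@horner_coef_wide _ d); last first.
    exact: leq_trans (size_poly _ _) (sr j).
  by apply: eq_bigr => k _; rewrite !mxE coef_map /= mulrC.
have 
  := congr1 (fun f : {poly int} => (map_poly intr f).[a i]) (Pdiv.RingMonic.rdivp_eq pm ('X^j * q)).
rewrite -/(r j) !rmorphD !rmorphM /= !hornerE (rootP (proot i)) mulr0 add0r => <-.
by rewrite map_polyXn hornerXn mulrC.
Qed.

(** The product is the determinant of multiplication by the polynomial [q] with coefficients [v],
    hence an integer. It is nonzero because [q] has degree less than [d], so it is coprime to the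
    irreducible [p] and shares no root with it. *)
Lemma vander_norm_ge1 (v : 'cV[int]_d) : v != 0 ->
  1 <= `|\prod_i (vander a *m intmx R v) i 0|.
Proof.
move=> v0; pose q := rVpoly v^T.
have qE i : (vander a *m intmx R v) i 0 = (map_poly intr q).[a i].
  rewrite (@horner_coef_wide _ d); last first.
    exact: leq_trans (size_poly _ _) (size_poly _ _).
  rewrite mxE; apply: eq_bigr => j _; rewrite !mxE coef_map /=.
  by rewrite coef_rVpoly_ord mxE mulrC.
have [N hN] := vander_eigen q.
have dN : \prod_i (vander a *m intmx R v) i 0 = (\det N)%:~R.
  have /(congr1 determinant) := hN; rewrite !det_mulmx det_diag [LHS]mulrC det_intmx.
  have W0 : \det (vander a) != 0 by rewrite -unitfE -unitmxE vander_unit.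
  by move/(mulIf W0) => ->; apply: eq_bigr => i _; rewrite qE mxE.
suff : \det N != 0 by rewrite dN -intr_norm ler1z => ?; lia.
rewrite -(@intr_eq0 R) -dN; apply/prodf_neq0 => i _; rewrite qE.
have q0 : q != 0.
  apply: contraNneq v0 => q0; apply/eqP/trmx_inj; rewrite trmx0.
  by apply: (can_inj rVpolyK); rewrite -/q q0 linear0.
have : coprimep (map_poly intr p : {poly rat}) (map_poly intr q).
  rewrite irreducible_poly_coprime //; apply/negP => /dvdp_leq.
  rewrite map_poly_eq0_id0 ?intr_eq0 ?lead_coef_eq0 // => /(_ q0).
  rewrite size_map_poly_id0 ?intr_eq0 ?lead_coef_eq0 ?monic_neq0 // sp.
  move=> /leq_trans /(_ (size_poly _ _)) /leq_trans.
  by move=> /(_ _ (size_poly _ _)); rewrite ltnn.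
rewrite -(@coprimep_map _ R ratr) -!map_poly_comp /=.
rewrite !(eq_map_poly (@ratr_int _)) => /coprimep_root /(_ (proot i)).
by [].
Qed.

End NormBound.

(** * Generic conjugate pairs of linear forms *)

Section ConjugatePairs.
Variable R : realType.
Local Open Scope complex_scope.
Local Notation C := R[i].
Local Notation RC := (real_complex R).

Definition cplx m n (X Y : 'M[R]_(m, n)) : 'M[C]_(m, n) :=
  \matrix_(i, j) (X i j +i* Y i j).

Lemma cplxE m n (X Y : 'M[R]_(m, n)) :
  cplx X Y = map_mx RC X + 'i%C *: map_mx RC Y.
Proof.
by apply/matrixP => i j; rewrite !mxE; apply/eqP; rewrite eq_complex /= 
  !(mul0r, mul1r, add0r, addr0, subr0) !eqxx.
Qed.

Lemma cplx_ReIm m n (A : 'M[C]_(m, n)) :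
  A = cplx (map_mx (@complex.Re R) A) (map_mx (@complex.Im R) A).
Proof. by apply/matrixP => i j; rewrite !mxE; case: (A i j). Qed.

Lemma conj_cplx m n (X Y : 'M[R]_(m, n)) :
  map_mx conjc (cplx X Y) = cplx X (- Y).
Proof. by apply/matrixP => i j; rewrite !mxE. Qed.

Lemma conj_RC m n (X : 'M[R]_(m, n)) :
  map_mx conjc (map_mx RC X) = map_mx RC X.
Proof. by apply/matrixP => i j; rewrite !mxE conjc_real. Qed.

Lemma conj_fixed_real m n (A : 'M[C]_(m, n)) :
  map_mx conjc A = A -> A = map_mx RC (map_mx (@complex.Re R) A).
Proof.
move=> /matrixP h; apply/matrixP => i j; have := h i j; rewrite !mxE.
case: (A i j) => x y [] /eqP; rewrite -subr_eq0 -opprD oppr_eq0 => /eqP y0.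
by have -> : y = 0 by lra.
Qed.

Lemma conj_mulmx m n p (A : 'M[C]_(m, n)) (B : 'M[C]_(n, p)) :
  map_mx conjc (A *m B) = map_mx conjc A *m map_mx conjc B.
Proof. exact: map_mxM. Qed.

Lemma cplx_mul m n p (X Y : 'M[R]_(m, n)) (Z : 'M[R]_(n, p)) :
  cplx X Y *m map_mx RC Z = cplx (X *m Z) (Y *m Z).
Proof. by rewrite !cplxE mulmxDl -scalemxAl -!map_mxM. Qed.

Lemma mulcplx m n p (X Y : 'M[R]_(m, n)) (x : 'M[C]_(n, p)) :
  cplx X Y *m x = 0 -> map_mx conjc (cplx X Y) *m x = 0 ->
  map_mx RC X *m x = 0 /\ map_mx RC Y *m x = 0.
Proof.
rewrite conj_cplx (cplxE X Y) (cplxE X (- Y)) !mulmxDl map_mxN /=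
  scalerN mulNmx -!scalemxAl => h1 h2.
have i0 : ('i%C : C) != 0 by rewrite eq_complex /= eqxx oner_eq0.
have n2 : (2%:R : C) != 0 by rewrite pnatr_eq0.
split.
  apply: (scalerI n2); rewrite scaler0 scaler_nat mulr2n -[RHS]addr0 -{1}h1 -h2.
  by rewrite addrACA subrr addr0.
apply: (scalerI i0); apply: (scalerI n2).
rewrite !scaler0 scaler_nat mulr2n -[RHS]subr0 -{1}h1 -h2 opprB addrAC.
by rewrite [_ + (_ - _)]addrC subrK.
Qed.

Definition conj_stack s t n (A : 'M[C]_(s, n)) (B : 'M[R]_(t, n)) :
    'M[C]_(s + (s + t), n) :=
  col_mx A (col_mx (map_mx conjc A) (map_mx RC B)).

Lemma row_full_inj m n (M : 'M[C]_(m, n)) :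
  (forall x : 'cV_n, M *m x = 0 -> x = 0) -> row_full M.
Proof.
move=> h; rewrite -sub1mx submxE mul1mx.
apply/eqP/matrixP => i j; have : col j (cokermx M) = 0.
  by apply: h; rewrite colE mulmxA mulmx_coker mul0mx.
by move/colP => /(_ i); rewrite !mxE.
Qed.

Lemma conj_stack_full s t n (X Y : 'M[R]_(s, n)) (B : 'M[R]_(t, n)) :
  (forall x : 'cV[C]_n, map_mx RC X *m x = 0 -> map_mx RC Y *m x = 0 ->
     map_mx RC B *m x = 0 -> x = 0) ->
  row_full (conj_stack (cplx X Y) B).
Proof.
move=> h; apply: row_full_inj => x; rewrite /conj_stack !mul_col_mx => /eqP.
rewrite !col_mx_eq0 => /and3P[/eqP h1 /eqP h2 /eqP h3].
by have [] := mulcplx h1 h2; move=> *; exact: h.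
Qed.

(** A conjugate pair contributes the squared modulus of its value, which keeps the product over the
    reals. *)
Definition form_value s t n (X Y : 'M[R]_(s, n)) (B : 'M[R]_(t, n))
    (v : 'cV[R]_n) : R :=
  \prod_i ((X *m v) i 0 ^+ 2 + (Y *m v) i 0 ^+ 2) * \prod_j (B *m v) j 0.

Definition conj_plane n (x : 'rV[C]_n) : 'M[C]_(1 + 1, n) :=
  col_mx x (map_mx conjc x).

(* The rows of conj_stack (cplx X Y) B play the role of linear forms whose product
   form_value is bounded away from 0 on the nonzero integral vectors, although
   the line of the form i0 is not defined over the algebraic numbers (and, when
   there are no real forms, nor is the plane it spans with its conjugate). *)
Record generic_stack s t n (i0 : 'I_s) (X Y : 'M[R]_(s, n)) (B : 'M[R]_(t, n)) :
    Prop := GenericStack {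
  generic_full : row_full (conj_stack (cplx X Y) B);
  generic_bound : exists2 e : R, 0 < e &
    forall v : 'cV[int]_n, v != 0 -> e <= `|form_value X Y B (intmx R v)|;
  generic_line : forall m (N : 'M[C]_(m, n)), algebraic_mx N ->
    ~~ (N == row i0 (cplx X Y))%MS;
  generic_plane : t = 0%N -> forall m (N : 'M[C]_(m, n)), algebraic_mx N ->
    ~~ (N == conj_plane (row i0 (cplx X Y)))%MS
}.

Lemma conjmx_sub m1 m2 n (A : 'M[C]_(m1, n)) (B : 'M[C]_(m2, n)) :
  (A <= B)%MS -> (map_mx conjc A <= map_mx conjc B)%MS.
Proof. by rewrite map_submx. Qed.

(** A matrix spanning the line, stacked on its conjugate, spans the plane, and conjugation preserves
    algebraicity. *)
Lemma plane_of_line n (x : 'rV[C]_n) :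
  (forall m (N : 'M[C]_(m, n)), algebraic_mx N -> ~~ (N == conj_plane x)%MS) ->
  forall m (N : 'M[C]_(m, n)), algebraic_mx N -> ~~ (N == x)%MS.
Proof.
move=> h m N aN; apply/negP => /andP[Nx xN].
have aN' : algebraic_mx (col_mx N (map_mx conjc N)).
  move=> i j; rewrite mxE; case: fintype.split => k //.
  by rewrite mxE; exact: algebraic_conj.
apply: (negP (h _ _ aN')); apply/andP; split.
  rewrite col_mx_sub (submx_trans Nx) ?(submx_trans (conjmx_sub Nx)) //.
    by rewrite /conj_plane -addsmxE addsmxSr.
  by rewrite /conj_plane -addsmxE addsmxSl.
rewrite /conj_plane col_mx_sub (submx_trans xN) ?(submx_trans (conjmx_sub xN)) //.
  by rewrite -addsmxE addsmxSr.
by rewrite -addsmxE addsmxSl.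
Qed.

End ConjugatePairs.

(** * Existence of generic stacks *)

Section Existence.
Variable R : realType.
Local Open Scope complex_scope.
Local Notation C := R[i].
Local Notation RC := (real_complex R).

Lemma algebraic_node_root d i (a : 'I_d -> R) : (0 < d)%N ->
  (forall i, root (map_poly intr (node_poly d)) (a i)) -> algebraic (a i)%:C.
Proof.
move=> d0 /(_ i) ra; apply: (@algebraic_intr_root _ (node_poly d)).
  by rewrite monic_neq0 ?node_poly_monic.
have -> : map_poly intr (node_poly d) = map_poly RC (map_poly intr (node_poly d)).
  by rewrite -map_poly_comp; apply: eq_map_poly => k /=; rewrite rmorph_int.
by rewrite fmorph_root.
Qed.

Lemma algebraic_i : algebraic ('i%C : C).
Proof.
exists ('X^2 + 1).
  by rewrite monic_neq0 // monicE lead_coefDl ?lead_coefXn // size_polyXn size_poly1.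
rewrite rmorphD /= map_polyXn rmorph1 rootE !hornerE /=.
by apply/eqP; rewrite sqr_i addNr.
Qed.

(** Here [x] is the unknown scale of a spanning vector whose first two coordinates are given.
    Eliminating [tau] between them leaves [x * (b - a)], so [x] is algebraic, and then so is
    [tau]. *)
Lemma line_obstruction (x : C) (a b tau : R) :
  algebraic a%:C -> algebraic b%:C -> ~ algebraic tau%:C -> a != b -> x != 0 ->
  algebraic (x * (1 + 'i%C * tau%:C)) ->
  algebraic (x * (a%:C + 'i%C * (tau * b)%:C)) -> False.
Proof.
move=> aa ab nt ab' x0 h0 h1; apply: nt.
have t1 : 1 + 'i%C * tau%:C != 0 :> C.
  by rewrite eq_complex /= !(mul0r, mul1r, add0r, addr0, subr0, oner_eq0).
set y := 1 + 'i%C * tau%:C in t1 h0.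
set z := a%:C + _ in h1.
have yz : y * b%:C - z = (b - a)%:C.
  by rewrite /y /z rmorphM rmorphB /=; ring.
have ba : (b - a)%:C != 0 :> C by rewrite eq_complex /= eqxx andbT subr_eq0 eq_sym.
have ax : algebraic x.
  have -> : x = (x * y * b%:C - x * z) / (b - a)%:C.
    by rewrite -mulrA -mulrBr yz mulfK.
  by apply: algebraic_div; [apply: algebraic_sub => //; exact: algebraic_mul |
    rewrite rmorphB; exact: algebraic_sub].
have -> : tau%:C = (x * y / x - 1) / 'i%C.
  rewrite mulrAC mulfV // mul1r /y addrC addKr mulrC mulKf //.
  by rewrite eq_complex /= eqxx oner_eq0.
apply: algebraic_div; last exact: algebraic_i.
by apply: algebraic_sub; [exact: algebraic_div | exact: algebraic1].
Qed.

(* Two real forms p, q of a product bounded below are merged into p + i tau q,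
   with tau transcendental: |p + i tau q|^2 >= 2 tau |p q|. *)
Lemma generic_stack_mixed s t (i0 : 'I_s) : (0 < t)%N ->
  exists X Y : 'M[R]_(s, s + (s + t)), exists B : 'M[R]_(t, s + (s + t)),
    generic_stack i0 X Y B.
Proof.
move=> t0; have s0 : (0 < s)%N by case: s i0 => // -[].
have d1 : (1 < s + (s + t))%N by lia.
have d0 := ltnW d1.
have [a ainj aroot] := node_poly_roots R d1.
have [tau tau0 ntau] := exists_transcendental R.
have W_unit := vander_unit ainj; set W := vander a in W_unit.
have Wbound := vander_norm_ge1 (node_poly_monic d0) (size_node_poly d0)
  (node_poly_irreducible d0) ainj aroot.
exists (usubmx W), (tau *: usubmx (dsubmx W)), (dsubmx (dsubmx W)).
split=> //.
- apply: conj_stack_full => x hX hY hB.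
  have {}hY : map_mx RC (usubmx (dsubmx W)) *m x = 0.
    have t0' : tau%:C != 0 :> C by rewrite eq_complex /= eqxx andbT gt_eqF.
    by apply: (scalerI t0'); rewrite scaler0 scalemxAl -map_mxZ.
  have Wx : map_mx RC W *m x = 0.
    rewrite -[W]vsubmxK map_col_mx mul_col_mx hX -[dsubmx W]vsubmxK map_col_mx.
    by rewrite mul_col_mx hY hB !col_mx0.
  by rewrite -(mulKmx (_ : map_mx RC W \in unitmx) x) ?Wx ?mulmx0 // map_unitmx.
- exists ((2 * tau) ^+ s); first by rewrite exprn_gt0 // mulr_gt0.
  move=> v v0; have := Wbound v v0; rewrite big_split_ord big_split_ord /= => h.
  apply: le_trans (_ : (2 * tau) ^+ s * `|\prod_i (W *m intmx R v) i 0| <= _).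
    by rewrite ler_peMr ?Wbound // exprn_ge0 // mulr_ge0 // ltW.
  rewrite big_split_ord big_split_ord /= /form_value mulrA !normrM mulrA.
  apply: ler_pM => //; first by rewrite mulr_ge0 // exprn_ge0 // mulr_ge0 // ltW.
    rewrite !normr_prod -[s in _ ^+ s]card_ord -prodr_const -!big_split /=.
    apply: ler_prod => i _; apply/andP; split.
      by rewrite !mulr_ge0 // ltW.
    set p := (W *m _) _ _; set q := (W *m _) _ _.
    have -> : (usubmx W *m intmx R v) i 0 = p.
      by rewrite /p !mxE; apply: eq_bigr => j _; rewrite !mxE.
    have -> : (tau *: usubmx (dsubmx W) *m intmx R v) i 0 = tau * q.
      rewrite -scalemxAl mxE; congr (_ * _).
      by rewrite /q !mxE; apply: eq_bigr => j _; rewrite !mxE.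
    rewrite [leRHS]ger0_norm ?addr_ge0 ?sqr_ge0 // -[p ^+ 2]real_normK ?num_real //.
    rewrite exprMn -[q ^+ 2]real_normK ?num_real //.
    have := sqr_ge0 (`|p| - tau * `|q|); nra.
  rewrite !normr_prod; apply: ler_prod => i _; rewrite normr_ge0 /=.
  have -> : (dsubmx (dsubmx W) *m intmx R v) i 0 = (W *m intmx R v) (rshift s (rshift s i)) 0.
    by rewrite !mxE; apply: eq_bigr => j _; rewrite !mxE.
  by [].
- move=> m N aN; apply/negP => /andP[/submxP[c Nc] AN].
  have Nrow k j : N k j = c k 0 * row i0 (cplx (usubmx W) (tau *: usubmx (dsubmx W))) 0 j.
    by rewrite Nc mxE big_ord1.
  have rowE j : row i0 (cplx (usubmx W) (tau *: usubmx (dsubmx W))) 0 j =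
     (a (lshift _ i0) ^+ j)%:C + 'i%C * (tau * a (rshift _ (lshift _ i0)) ^+ j)%:C.
    by rewrite !mxE; apply/eqP; rewrite eq_complex /= !(mul0r, mul1r, add0r, addr0, subr0) !eqxx.
  have [k ck] : exists k, c k 0 != 0.
    apply/existsP; rewrite -negb_forall; apply/negP => /forallP c0.
    have N0 : N = 0.
      by apply/matrixP => k j; rewrite Nrow (eqP (c0 k)) mul0r mxE.
    have [u /rowP /(_ (Ordinal d0))] := submxP AN.
    rewrite rowE N0 mulmx0 !expr0 mulr1 mxE => /eqP.
    by rewrite eq_complex /= !(mul0r, mul1r, add0r, addr0, subr0) oner_eq0.
  have := aN k (Ordinal d0); have := aN k (Ordinal d1).
  rewrite !Nrow !rowE !expr0 !expr1 mulr1 => h1 h0.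
  apply: (line_obstruction _ _ ntau _ ck h0 h1).
  + exact: (algebraic_node_root _ d0 aroot).
  + exact: (algebraic_node_root _ d0 aroot).
  + by apply/eqP => /ainj/eqP; rewrite -val_eqE /= => /eqP; have := ltn_ord i0; lia.
- by move=> t00; move: (t0); rewrite {1}t00.
Qed.

Lemma conj_combination (p q : C) (x y : R) :
  p * (x +i* y) + q * conjc (x +i* y) =
    (p + q) * x%:C + ((p - q) * 'i%C) * y%:C.
Proof.
case: p q => [p1 p2] [q1 q2].
by apply/eqP; rewrite eq_complex /=; apply/andP; split; apply/eqP; ring.
Qed.

(* For t = 0 the planes of the first construction would be algebraic; they are
   made transcendental by a unipotent shear between two copies of one totally
   real lattice of rank s, which preserves the lower bound. *)
Lemma generic_stack_complex s (i0 : 'I_s) (B : 'M[R]_(0, s + s)) : (1 < s)%N ->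
  exists X Y : 'M[R]_(s, s + s), generic_stack i0 X Y B.
Proof.
move=> s1; have s0 := ltnW s1.
have [a ainj aroot] := node_poly_roots R s1.
have [tau tau0 ntau] := exists_transcendental R.
have W_unit := vander_unit ainj; set W := vander a in W_unit.
have Wbound := vander_norm_ge1 (node_poly_monic s0) (size_node_poly s0)
  (node_poly_irreducible s0) ainj aroot.
(* Only column 1 is sheared. Column 0 of each half shows that the coefficients [u] and [w] of an
   algebraic spanning row are algebraic; column 1 then makes [w * tau] algebraic, so [w = 0]. Thus
   the right halves of all spanning rows vanish, unlike that of the form [i0]. *)
pose E : 'M[R]_s := \matrix_(i, j) (tau *+ (j == 1%N :> nat)).
pose X := row_mx W 0 : 'M[R]_(s, s + s); pose Y := row_mx E W : 'M[R]_(s, s + s).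
exists X, Y.
have plane m (N : 'M[C]_(m, s + s)) : algebraic_mx N ->
    ~~ (N == conj_plane (row i0 (cplx X Y)))%MS.
  move=> aN; apply/negP => /andP[/submxP[c Nc] AN].
  have rE (j : 'I_s) :
      row i0 (cplx X Y) 0 (lshift s j) = (a i0 ^+ j) +i* (tau *+ (j == 1%N :> nat)).
    by rewrite mxE mxE /X /Y !row_mxEl !mxE.
  have rE' (j : 'I_s) : row i0 (cplx X Y) 0 (rshift s j) = 0 +i* (a i0 ^+ j).
    by rewrite mxE mxE /X /Y !row_mxEr !mxE.
  pose u k := c k (lshift 1 0) + c k (rshift 1 0).
  pose w k := (c k (lshift 1 0) - c k (rshift 1 0)) * 'i%C.
  have NE k j : N k j = c k (lshift 1 0) * row i0 (cplx X Y) 0 j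
      + c k (rshift 1 0) * conjc (row i0 (cplx X Y) 0 j).
    by rewrite Nc mxE big_split_ord /= !big_ord1 /conj_plane col_mxEu col_mxEd !mxE.
  have Nl k (j : 'I_s) : N k (lshift s j) =
      u k * (a i0 ^+ j)%:C + w k * (tau *+ (j == 1%N :> nat))%:C.
    by rewrite NE rE conj_combination.
  have Nr k (j : 'I_s) : N k (rshift s j) = w k * (a i0 ^+ j)%:C.
    by rewrite NE rE' conj_combination mulr0 add0r.
  have w0 k : w k = 0.
    apply/eqP/negPn/negP => wk; apply: ntau.
    have au : algebraic (u k).
      by have := aN k (lshift s (Ordinal s0)); rewrite Nl mulr0n mulr0 addr0 mulr1.
    have aw : algebraic (w k).
      by have := aN k (rshift s (Ordinal s0)); rewrite Nr mulr1.
    have := aN k (lshift s (Ordinal s1)); rewrite Nl mulr1n /= expr1 => h.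
    have -> : tau%:C = (u k * (a i0)%:C + w k * tau%:C - u k * (a i0)%:C) / w k.
      by rewrite addrC addKr mulrC mulKf.
    apply: algebraic_div => //; apply: algebraic_sub => //; apply: algebraic_mul => //.
    exact: (algebraic_node_root _ s0 aroot).
  have AP : (row i0 (cplx X Y) <= conj_plane (row i0 (cplx X Y)))%MS.
    by rewrite /conj_plane -addsmxE addsmxSl.
  have /submxP[d] := submx_trans AP AN.
  move=> /rowP /(_ (rshift s (Ordinal s0))); rewrite rE' expr0 mxE big1.
    by move/eqP; rewrite eq_complex /= oner_eq0 andbF.
  by move=> k _; rewrite Nr w0 mul0r mulr0.
split.
- apply: conj_stack_full => x; rewrite -[x]vsubmxK.
  rewrite !map_row_mx !mul_row_col map_mx0 mul0mx addr0 => h1.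
  have WC : map_mx RC W \in unitmx by rewrite map_unitmx.
  have {}h1 : usubmx x = 0 by rewrite -(mulKmx WC (usubmx x)) h1 mulmx0.
  rewrite h1 mulmx0 add0r => h2 _.
  by rewrite -(mulKmx WC (dsubmx x)) h2 mulmx0 col_mx0.
- exists 1 => // v v0; rewrite /form_value big_ord0 mulr1 normr_prod.
  rewrite -[v]vsubmxK /intmx map_col_mx -!/(intmx _ _) !mul_row_col mul0mx addr0.
  have sq (x y : R) : `|x| ^+ 2 <= `|x ^+ 2 + y ^+ 2|.
    rewrite real_normK ?num_real // ger0_norm ?addr_ge0 ?sqr_ge0 //.
    by rewrite lerDl sqr_ge0.
  (* If the upper half of [v] is nonzero, the real parts alone bound the product; otherwise the
     shear acts trivially and the imaginary parts do. *)
  have [u0|u0] := eqVneq (usubmx v) 0; last first.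
    have := Wbound _ u0; rewrite -/W -(@expr_ge1 _ 2) // normr_prod -prodrXl.
    move=> /le_trans; apply; apply: ler_prod => i _.
    by rewrite exprn_ge0 //= sq.
  have d0 : dsubmx v != 0.
    by apply: contraNneq v0 => d0; rewrite -[v]vsubmxK u0 d0 col_mx0.
  have := Wbound _ d0; rewrite -/W -(@expr_ge1 _ 2) // normr_prod -prodrXl.
  move=> /le_trans; apply; apply: ler_prod => i _.
  rewrite exprn_ge0 //= u0 /intmx map_mx0 !mulmx0 add0r addrC.
  exact: sq.
- exact: plane_of_line.
- by move=> _; exact: plane.
Qed.

Lemma exists_generic_stack s t n (i0 : 'I_s) : (2 < n)%N -> n = (s + (s + t))%N ->
  exists X Y : 'M[R]_(s, n), exists B : 'M[R]_(t, n), generic_stack i0 X Y B.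
Proof.
move=> n2 nE; case: (posnP t) => [t0|t0]; last first.
  by subst n; exact: generic_stack_mixed.
subst t; rewrite addn0 in nE; subst n.
have [|X [Y h]] := @generic_stack_complex s i0 0; first lia.
by exists X, Y, 0.
Qed.

End Existence.

(** * Forms that are neither norm forms nor quasi-norm forms *)

Section Evaluation.

Lemma meval_linform (S : comNzRingType) n (a : 'rV[S]_n) (v : 'cV[S]_n) :
  meval (fun j => v j 0) (linform a) = (a *m v) 0 0.
Proof.
rewrite /linform rmorph_sum mxE; apply: eq_bigr => j _.
by rewrite /= mevalZ mevalXU.
Qed.

Lemma meval_mact (S : comUnitRingType) n (g : 'M[S]_n) p (v : 'cV[S]_n) :
  meval (fun j => v j 0) (mact g p) = meval (fun k => (invmx g *m v) k 0) p.
Proof.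
rewrite comp_mpoly_meval; apply: meval_eq => k.
by rewrite tnth_mktuple meval_linform -row_mul mxE.
Qed.

Lemma meval_map_comp_mpoly (S T : comNzRingType) (f : {rmorphism S -> T}) n k
    (lq : n.-tuple (mpoly k S)) (p : mpoly n S) (v : 'I_k -> T) :
  meval v (map_mpoly f (comp_mpoly lq p)) =
    meval (fun i => meval v (map_mpoly f (tnth lq i))) (map_mpoly f p).
Proof.
have -> : comp_mpoly lq p = \sum_(m <- msupp p) mpolyC k (mcoeff m p) * mmap1 (tnth lq) m by [].
have -> : map_mpoly f p =
    \sum_(m <- msupp p)
       mpolyC n (f (mcoeff m p)) * mmap1 (fun i => mpolyX T (mnm1 i)) m by [].
pose mf : {rmorphism mpoly k S -> mpoly k T} := map_mpoly f.
pose ev u : {rmorphism mpoly n T -> T} := meval u.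
pose ev' : {rmorphism mpoly k T -> T} := meval v.
rewrite (rmorph_sum mf) (rmorph_sum ev') (rmorph_sum (ev _)) /=.
apply: eq_bigr => m _.
rewrite !rmorphM /= map_mpolyC !mevalC; congr (_ * _).
rewrite /mmap1 !rmorph_prod; apply: eq_bigr => i _.
by rewrite !rmorphXn /= mevalXU.
Qed.

Lemma map_linform (S T : comNzRingType) (f : {rmorphism S -> T}) n (a : 'rV[S]_n) :
  map_mpoly f (linform a) = linform (map_mx f a).
Proof.
rewrite /linform rmorph_sum; apply: eq_bigr => j _.
by rewrite /= map_mpolyZ map_mpolyX mxE.
Qed.

Lemma linform_homog (S : comNzRingType) n (a : 'rV[S]_n) :
  linform a \is ishomog1 1 mdeg.
Proof.
by apply: rpred_sum => j _; apply: dhomogZ; rewrite dhomogX; apply/eqP; exact: mdeg1.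
Qed.

Lemma linformD (S : comNzRingType) n (a b : 'rV[S]_n) :
  linform (a + b) = linform a + linform b.
Proof.
by rewrite /linform -big_split; apply: eq_bigr => j _; rewrite mxE scalerDl.
Qed.

Lemma linformZ (S : comNzRingType) n c (a : 'rV[S]_n) :
  linform (c *: a) = c *: linform a.
Proof.
by rewrite /linform scaler_sumr; apply: eq_bigr => j _; rewrite mxE scalerA.
Qed.

Lemma nat_nonroot (F : numFieldType) (P : {poly F}) : P != 0 ->
  exists k : nat, P.[k%:R] != 0.
Proof.
move=> P0; apply: contrapT => h.
have rP k : root P k%:R.
  by apply/rootP/eqP/negPn/negP => hk; apply: h; exists k.
have := @max_poly_roots _ P [seq k%:R | k <- iota 0 (size P)] P0.
rewrite size_map size_iota ltnn => /(_ _ _)/wrap[] //.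
  by apply/allP => _ /mapP[k _ ->].
by rewrite map_inj_uniq ?iota_uniq // => i j /eqP; rewrite eqr_nat => /eqP.
Qed.

(* A vector space over an infinite field is not a finite union of proper
   subspaces: restrict to the moment curve. *)
Lemma subspace_union (F : numFieldType) (I : finType) k n m
    (L : I -> 'M[F]_(k, n)) (K : 'M[F]_(n, m)) :
  (forall u : 'cV_m, exists i, L i *m (K *m u) = 0) -> exists i, L i *m K = 0.
Proof.
move=> h; apply: contrapT => nh.
have hr i : exists r, row r (L i *m K) != 0.
  apply/existsP; rewrite -negb_forall; apply/negP => /forallP r0; apply: nh.
  by exists i; apply/row_matrixP => r; rewrite (eqP (r0 r)) row0.
pose r i := xchoose (hr i).
pose P i : {poly F} := rVpoly (row (r i) (L i *m K)).
have P0 i : P i != 0.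
  rewrite /P; apply: contra_neq (xchooseP (hr i)) => e.
  by apply: (can_inj rVpolyK); rewrite e linear0.
have PP0 : \prod_i P i != 0 by apply/prodf_neq0 => i _; exact: P0.
have [x] := nat_nonroot PP0.
rewrite horner_prod => /prodf_neq0 hx.
have [i /eqP] := h (\col_j x%:R ^+ j).
rewrite mulmxA => /eqP/colP/(_ (r i)) /eqP; apply/negP; have := hx i isT.
rewrite (@horner_coef_wide _ m) ?size_poly //.
rewrite !mxE; congr (_ != _); apply: eq_bigr => j _.
by rewrite coef_rVpoly_ord !mxE.
Qed.

End Evaluation.

(** * Zero sets of norm forms and quasi-norm forms *)

Section SpecialForms.
Variable R : realType.
Local Open Scope complex_scope.
Local Notation C := R[i].
Local Notation RC := (real_complex R).

Lemma unit_ratmx (S : numFieldType) n (g : 'M[rat]_n) : \det g = 1 ->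
  map_mx (ratr : rat -> S) g \in unitmx.
Proof. by move=> g1; rewrite map_unitmx unitmxE g1 unitr1. Qed.

Lemma algebraic_ratmx m n (g : 'M[rat]_(m, n)) :
  algebraic_mx (map_mx (ratr : rat -> C) g).
Proof. by move=> i j; rewrite mxE; exact: algebraic_rat. Qed.

Lemma mpolyRC_mact n (g : 'M[R]_n) (p : mpoly n R) (v : 'cV[C]_n) :
  meval (fun j => v j 0) (mpolyRC (mact g p)) =
    meval (fun k => (invmx (map_mx RC g) *m v) k 0) (mpolyRC p).
Proof.
rewrite /mpolyRC /mact meval_map_comp_mpoly; apply: meval_eq => k.
by rewrite tnth_mktuple map_linform meval_linform map_row map_invmx -row_mul mxE.
Qed.

Lemma norm_form_factors n (f : mpoly n R) : (0 < n)%N -> is_norm_form f ->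
  exists (w : 'I_n -> 'rV[C]_n) (c : C),
    [/\ c != 0, forall i, algebraic_mx (w i), forall i, w i != 0 &
      forall v : 'cV[C]_n,
        meval (fun j => v j 0) (mpolyRC f) = c * \prod_i (w i *m v) 0 0].
Proof.
move=> n0 [K [alpha [theta [c [p [balpha _ c0 pE [g g1 ->]]]]]]].
pose gC := map_mx (ratr : rat -> C) g.
have gCE : map_mx RC (map_mx ratr g) = gC.
  by apply/matrixP => i j; rewrite !mxE /= fmorph_rat.
have gu : gC \in unitmx by exact: unit_ratmx.
exists (fun i => (\row_j theta i (tnth alpha j)) *m invmx gC), c%:C; split.
- by rewrite fmorph_eq0.
- move=> i; apply: algebraic_mulmx.
    by move=> k j; rewrite mxE; exact: algebraic_morph.
  by rewrite -map_invmx; exact: algebraic_ratmx.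
- move=> i; apply/negP => /eqP /(congr1 (mulmx^~ gC)).
  rewrite mulmxKV // mul0mx => /rowP /(_ (Ordinal n0)) /eqP; rewrite !mxE.
  rewrite fmorph_eq0 => /eqP a0; have := basis_free balpha.
  by move=> /free_not0; move/(_ _ (mem_tnth (Ordinal n0) alpha)); rewrite a0 eqxx.
- move=> v; rewrite mpolyRC_mact gCE /mpolyRC map_mpolyZ mevalZ -/(mpolyRC p) pE.
  congr (_ * _); rewrite rmorph_prod; apply: eq_bigr => i _ /=.
  by rewrite meval_linform mulmxA.
Qed.

Lemma msubvar_linform (S : comNzRingType) s n (u : 'I_s -> 'I_n) (a : 'rV[S]_s) v :
  meval v (msubvar u (linform a)) = \sum_k a 0 k * v (u k).
Proof.
rewrite comp_mpoly_meval /linform rmorph_sum; apply: eq_bigr => k _ /=.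
by rewrite mevalZ mevalXU tnth_mktuple mevalXU.
Qed.

Lemma definite_zero (q : mpoly 2 R) (x : 2.-tuple R) : definite_binary q ->
  meval (tnth x) q = 0 -> forall i, tnth x i = 0.
Proof.
move=> [_ hq] q0; pose v : 'rV[R]_2 := \row_i tnth x i.
have vE : meval (v 0) q = 0 by rewrite -q0; apply: meval_eq => i; rewrite mxE.
have v0 : v = 0.
  by apply/eqP/negPn/negP => v0; case: hq => /(_ v v0); rewrite vE ltxx.
by move=> i; have /rowP/(_ i) := v0; rewrite !mxE.
Qed.

(** Only real zeros are described: the [q i] have arbitrary real coefficients, so their complex
    linear factors need not be algebraic, whereas at a real zero definiteness forces both values of
    the algebraic form to vanish. *)
Lemma quasi_norm_form_zeros n (f : mpoly n R) : is_quasi_norm_form f ->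
  exists s (L : 'I_s -> 'M[R]_(1 + 1, n)),
    [/\ forall i, algebraic_mx (map_mx RC (L i)), forall i, \rank (L i) = 2%N &
      forall v : 'cV[R]_n, meval (fun j => v j 0) f = 0 ->
        exists i, L i *m v = 0].
Proof.
move=> [s [ens [F [alpha [theta [q [[s0 balpha] _ _ qdef [g g1 ->]]]]]]]].
subst n.
pose gR := map_mx (ratr : rat -> R) g.
have gu : gR \in unitmx by exact: unit_ratmx.
pose a i : 'rV[R]_s := \row_j theta i (tnth alpha j).
exists s, (fun i => block_mx (a i) 0 0 (a i) *m invmx gR); split.
- move=> i; rewrite map_mxM; apply: algebraic_mulmx; last first.
    have -> : map_mx RC (invmx gR) = map_mx (ratr : rat -> C) (invmx g).
      by rewrite -map_invmx; apply/matrixP => j k; rewrite !mxE /= fmorph_rat.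
    exact: algebraic_ratmx.
  have aa k j : algebraic (map_mx RC (a i) k j).
    by rewrite !mxE; exact: (@algebraic_morph _ _ (RC \o theta i)).
  move=> k j; rewrite map_block_mx map_mx0 /block_mx mxE.
  by case: fintype.split => k'; rewrite mxE; case: fintype.split => j';
    rewrite ?aa // mxE; exact: algebraic0.
- move=> i; rewrite mxrankMfree ?row_free_unit ?unitmx_inv // rank_diag_block_mx.
  rewrite !rank_rV; suff -> : a i != 0 by [].
  apply/negP => /eqP /rowP /(_ (Ordinal s0)) /eqP; rewrite !mxE fmorph_eq0 => /eqP a0.
  have := basis_free balpha.
  by move=> /free_not0; move/(_ _ (mem_tnth (Ordinal s0) alpha)); rewrite a0 eqxx.
- move=> v /eqP; rewrite meval_mact rmorph_prod prodf_seq_eq0 => /hasP[i _ /=].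
  rewrite comp_mpoly_meval => /eqP h; exists i; rewrite -mulmxA.
  set w := invmx gR *m v in h *.
  pose x := [tuple (a i *m usubmx w) 0 0; (a i *m dsubmx w) 0 0].
  have {h} h : meval (tnth x) (q i) = 0.
    rewrite -{}h; apply: meval_eq => j; rewrite !(tnth_nth 0).
    case: j => -[|[|//]] ? /=; rewrite msubvar_linform mxE; apply: eq_bigr => k _.
      by rewrite [usubmx _ _ _]mxE cast_ord_id.
    by rewrite [dsubmx _ _ _]mxE cast_ord_id.
  have {}h := definite_zero (qdef i) h.
  rewrite -[w]vsubmxK mul_block_col !mul0mx addr0 add0r.
  have h0 := h 0; have h1 := h 1; rewrite !(tnth_nth 0) /= in h0 h1.
  rewrite [a i *m usubmx w]mx11_scalar [a i *m dsubmx w]mx11_scalar h0 h1.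
  by rewrite !raddf0 col_mx0.
Qed.

End SpecialForms.

(** * The form attached to a generic stack *)

Section GenericForm.
Variable R : realType.
Local Open Scope complex_scope.
Local Notation C := R[i].
Local Notation RC := (real_complex R).

Definition generic_form s t n (X Y : 'M[R]_(s, n)) (B : 'M[R]_(t, n)) : mpoly n R :=
  \prod_i (linform (row i X) ^+ 2 + linform (row i Y) ^+ 2)
    * \prod_j linform (row j B).

Lemma generic_form_value s t n (X Y : 'M[R]_(s, n)) (B : 'M[R]_(t, n))
    (v : 'cV[R]_n) :
  meval (fun j => v j 0) (generic_form X Y B) = form_value X Y B v.
Proof.
rewrite rmorphM !rmorph_prod; congr (_ * _); apply: eq_bigr => i _.
  rewrite rmorphD !rmorphXn /= !meval_linform -!row_mul.
  by congr (_ ^+ _ + _ ^+ _); rewrite mxE.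
by rewrite /= meval_linform -row_mul mxE.
Qed.

Lemma linform_cplx n (X Y : 'rV[R]_n) :
  linform (cplx X Y) = linform (map_mx RC X) + 'i%C *: linform (map_mx RC Y).
Proof. by rewrite cplxE linformD linformZ. Qed.

Lemma linform_cplx_norm n (X Y : 'rV[R]_n) :
  linform (cplx X Y) * linform (map_mx conjc (cplx X Y)) =
    mpolyRC (linform X ^+ 2 + linform Y ^+ 2).
Proof.
rewrite conj_cplx !linform_cplx /mpolyRC rmorphD !rmorphXn /= !map_linform.
rewrite map_mxN /= -scaleN1r linformZ scalerA mulrN1 scaleNr [LHS]mulrC -subr_sqr exprZn.
by rewrite sqr_i scaleN1r opprK.
Qed.

Lemma generic_form_factors s t n (X Y : 'M[R]_(s, n)) (B : 'M[R]_(t, n)) :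
  mpolyRC (generic_form X Y B) =
    \prod_(i < s) (linform (row i (cplx X Y)) *
                   linform (row i (map_mx conjc (cplx X Y)))) *
    \prod_(i < t) linform (row i (map_mx RC B)).
Proof.
rewrite /mpolyRC rmorphM !rmorph_prod /=; congr (_ * _); apply: eq_bigr => i _.
  have -> : row i (cplx X Y) = cplx (row i X) (row i Y).
    by apply/rowP => j; rewrite !mxE.
  rewrite -map_row (_ : row i (cplx X Y) = cplx (row i X) (row i Y)); last first.
    by apply/rowP => j; rewrite !mxE.
  by rewrite linform_cplx_norm.
by rewrite map_linform map_row.
Qed.

Lemma prod_homog (n d : nat) (I : finType) (F : I -> mpoly n R) :
  (forall i, F i \is ishomog1 d mdeg) ->
  \prod_i F i \is ishomog1 (d * #|I|) mdeg.
Proof.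
move=> hF; rewrite -sum1_card big_distrr /=.
elim/big_ind2: _ => [|x p y q hx hy|i _]; first exact: dhomog1.
  exact: dhomogM.
by rewrite muln1.
Qed.

Lemma generic_form_homog s t n (X Y : 'M[R]_(s, n)) (B : 'M[R]_(t, n)) :
  generic_form X Y B \is ishomog1 (s + (s + t)) mdeg.
Proof.
have -> : (s + (s + t) = 2 * #|'I_s| + 1 * #|'I_t|)%N by rewrite !card_ord; lia.
apply: dhomogM; apply: prod_homog => i; last exact: linform_homog.
by apply: rpredD; rewrite -[2%N]mul1n; apply/dhomogMn/linform_homog.
Qed.

Section Stack.
Variables (s t : nat) (i0 : 'I_s).
Local Notation n := (s + (s + t))%N.
Variables (X Y : 'M[R]_(s, n)) (B : 'M[R]_(t, n)).
Hypothesis gen : generic_stack i0 X Y B.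

Lemma generic_plane_rank : \rank (conj_plane (row i0 (cplx X Y))) = 2%N.
Proof.
have sf : row_free (conj_stack (cplx X Y) B).
  by rewrite row_free_unit -row_full_unit; exact: generic_full gen.
pose j1 : 'I_n := lshift _ i0; pose j2 : 'I_n := rshift _ (lshift _ i0).
pose D : 'M[C]_(1 + 1, n) := col_mx (delta_mx 0 j1) (delta_mx 0 j2).
have -> : conj_plane (row i0 (cplx X Y)) = D *m conj_stack (cplx X Y) B.
  rewrite mul_col_mx -!rowE /conj_stack rowKu rowKd rowKu /conj_plane.
  by rewrite -map_row.
rewrite mxrankMfree //; apply/eqP; rewrite -[_ == _]/(row_free D); apply/row_freeP.
have j12 : j1 != j2.
  by apply/eqP => /(congr1 val) /=; have := ltn_ord i0; lia.
exists D^T; rewrite /D {D}; move: j1 j2 j12 => j1 j2 j12.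
rewrite tr_col_mx mul_col_row !trmx_delta !mul_delta_mx_cond.
rewrite (negPf j12) (eq_sym j2) (negPf j12) !eqxx !mulr1n !mulr0n [RHS]scalar_mx_block.
by congr block_mx; apply/matrixP => x y; rewrite !ord1 !mxE.
Qed.

Lemma generic_form_is_form : is_form (generic_form X Y B).
Proof.
split; first exact: generic_form_homog.
exists (conj_stack (cplx X Y) B).
  by rewrite row_free_unit -row_full_unit; exact: generic_full gen.
have e1 i : linform (row (lshift (s + t) i) (conj_stack (cplx X Y) B)) =
    linform (row i (cplx X Y)) by rewrite /conj_stack rowKu.
have e2 i : linform (row (rshift s (lshift t i)) (conj_stack (cplx X Y) B)) =
    linform (row i (map_mx conjc (cplx X Y))) by rewrite /conj_stack rowKd rowKu.
have e3 i : linform (row (rshift s (rshift s i)) (conj_stack (cplx X Y) B)) =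
    linform (row i (map_mx RC B)) by rewrite /conj_stack rowKd rowKd.
rewrite generic_form_factors big_split_ord big_split_ord big_split -mulrA.
by rewrite (eq_bigr _ (fun i _ => e1 i)) (eq_bigr _ (fun i _ => e2 i))
  (eq_bigr _ (fun i _ => e3 i)).
Qed.

Lemma generic_form_conj_pairs : has_conj_pairs (generic_form X Y B) s t.
Proof.
exists 1, (cplx X Y), B; split; first exact: oner_neq0.
  by rewrite row_free_unit -row_full_unit; exact: generic_full gen.
by rewrite rmorph1 scale1r generic_form_factors.
Qed.

Lemma generic_form_zero (v : 'cV[C]_n) :
  row i0 (cplx X Y) *m v = 0 ->
  meval (fun j => v j 0) (mpolyRC (generic_form X Y B)) = 0.
Proof.
by move=> h; rewrite generic_form_factors (bigD1 i0) // !mevalM meval_linform h mxE !mul0r.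
Qed.

(* On the hyperplane where the form i0 vanishes, some algebraic linear factor of
   the norm form would vanish identically. *)
Lemma generic_form_not_norm_form : ~ is_norm_form (generic_form X Y B).
Proof.
have n0 : (0 < n)%N by have := ltn_ord i0; lia.
move=> /(norm_form_factors n0)[w [c [c0 aw w0 fE]]].
have [i wi] : exists i, w i *m cokermx (row i0 (cplx X Y)) = 0.
  apply: subspace_union => u.
  have := fE (cokermx (row i0 (cplx X Y)) *m u).
  rewrite generic_form_zero; last by rewrite mulmxA mulmx_coker mul0mx.
  move=> /esym/eqP.
  rewrite mulf_eq0 (negPf c0) prodf_seq_eq0 /= => /hasP[i _ /= /eqP h].
  by exists i; rewrite [LHS]mx11_scalar h raddf0.
have wl : (w i <= row i0 (cplx X Y))%MS by rewrite submxE wi.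
apply: (negP (generic_line gen (aw i))); rewrite wl /=.
rewrite -(geq_leqif (mxrank_leqif_sup wl)) (leq_trans (rank_leq_row _)) //.
by rewrite rank_rV w0.
Qed.

Lemma row_mul_eq0 m p (M : 'M[R]_(m, p)) (v : 'cV[R]_p) i :
  row i M *m v = 0 -> (M *m v) i 0 = 0.
Proof. by rewrite -row_mul => /rowP/(_ 0); rewrite !mxE. Qed.

(** By [subspace_union], a subspace of real zeros lies in the kernel of a single [L i], of
    codimension two. For [t > 0] the hyperplane of a real form is too large for that. For [t = 0]
    the common kernel of the real and imaginary parts of the form [i0] also has codimension two, so
    the algebraic [L i] would span the plane of the pair. *)
Lemma generic_form_not_quasi_norm_form : ~ is_quasi_norm_form (generic_form X Y B).
Proof.
move=> /quasi_norm_form_zeros[k [L [aL rL fE]]].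
have key p (M : 'M[R]_(p, n)) :
    (forall v : 'cV[R]_n, M *m v = 0 -> form_value X Y B v = 0) ->
    exists i, (L i <= M)%MS.
  move=> hM; have [|i Li] := @subspace_union _ _ _ _ _ L (cokermx M).
    by move=> u; apply: fE; rewrite generic_form_value hM // mulmxA mulmx_coker mul0mx.
  by exists i; rewrite submxE Li.
case: (posnP t) => [t0|t0]; last first.
  have [|i Li] := key _ (row (Ordinal t0) B).
    move=> v hv; rewrite /form_value (bigD1 (Ordinal t0) (F := fun j => (B *m v) j 0)) //=.
    have -> : (B *m v) (Ordinal t0) 0 = 0.
      exact: row_mul_eq0.
    by rewrite mul0r mulr0.
  by have := mxrankS Li; rewrite rL => /leq_trans/(_ (rank_leq_row _)).
have [|i Li] := key _ (col_mx (row i0 X) (row i0 Y)).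
  move=> v; rewrite mul_col_mx => /eqP; rewrite col_mx_eq0 => /andP[/eqP hX /eqP hY].
  rewrite /form_value (bigD1 i0) //=.
  have -> : (X *m v) i0 0 = 0.
    exact: row_mul_eq0.
  have -> : (Y *m v) i0 0 = 0.
    exact: row_mul_eq0.
  by rewrite expr0n /= addr0 !mul0r.
apply: (negP (generic_plane gen t0 (aL i))).
set P := conj_plane _; set Q := col_mx (row i0 X) (row i0 Y) in Li.
have PQ : (P <= map_mx RC Q)%MS.
  have rowE : row i0 (cplx X Y) = map_mx RC (row i0 X) + 'i%C *: map_mx RC (row i0 Y).
    by rewrite -cplxE; apply/rowP => j; rewrite !mxE.
  have XQ : (map_mx RC (row i0 X) <= map_mx RC Q)%MS.
    by rewrite map_submx /Q -addsmxE addsmxSl.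
  have YQ : (map_mx RC (row i0 Y) <= map_mx RC Q)%MS.
    by rewrite map_submx /Q -addsmxE addsmxSr.
  rewrite /P /conj_plane col_mx_sub rowE map_mxD map_mxZ /= !conj_RC.
  by rewrite !addmx_sub // scalemx_sub.
have LQ : (map_mx RC (L i) == map_mx RC Q)%MS.
  rewrite map_submx Li -(geq_leqif (mxrank_leqif_sup _)) ?map_submx //.
  by rewrite !mxrank_map rL rank_leq_row.
have PL : (P <= map_mx RC (L i))%MS.
  by apply: submx_trans PQ _; case/andP: LQ.
rewrite PL andbT -(geq_leqif (mxrank_leqif_sup PL)) mxrank_map rL.
by rewrite generic_plane_rank.
Qed.

End Stack.
End GenericForm.

(** * Values at rational and integral vectors *)

Section FormValues.
Variable R : realType.

Lemma form_valueZ s t n (X Y : 'M[R]_(s, n)) (B : 'M[R]_(t, n)) c v :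
  form_value X Y B (c *: v) = c ^+ (2 * s + t) * form_value X Y B v.
Proof.
rewrite /form_value exprD mulrACA; congr (_ * _).
  rewrite exprM -[s in _ ^+ s]card_ord -prodr_const -big_split.
  by apply: eq_bigr => i _; rewrite /= -!scalemxAr !mxE !exprMn mulrDr.
rewrite -[t in _ ^+ t]card_ord -prodr_const -big_split.
by apply: eq_bigr => i _; rewrite /= -!scalemxAr !mxE.
Qed.

Lemma common_denominator n (v : 'cV[rat]_n) : exists2 d : int, d != 0 &
  exists w : 'cV[int]_n, map_mx intr w = d%:~R *: v.
Proof.
exists (\prod_j denq (v j 0)); first by apply/prodf_neq0 => j _; exact: denq_neq0.
exists (\col_j (numq (v j 0) * \prod_(k | k != j) denq (v k 0))).
apply/colP => j; rewrite !mxE [in RHS](bigD1 j) //= !intrM numqE.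
by ring.
Qed.

Lemma form_with_conj_pairs s t (n := (s + (s + t))%N) (Z : set 'cV[int]_n) :
  (2 < n)%N -> (0 < s)%N -> (forall v, Z v -> v != 0) ->
  exists f : mpoly n R,
       [/\ is_form f /\ has_conj_pairs f s t,
           ~ is_norm_form f, ~ is_quasi_norm_form f,
           ~ represents_zero f &
           discrete_at_0 (values_on f Z)].
Proof.
move=> n2 s0 Z0; pose i0 := Ordinal s0.
have [X [Y [B gen]]] := exists_generic_stack R i0 n2 erefl.
exists (generic_form X Y B); split.
- by split; [exact: generic_form_is_form gen | exact: generic_form_conj_pairs gen].
- exact: generic_form_not_norm_form gen.
- exact: generic_form_not_quasi_norm_form gen.
- have [e e0 he] := generic_bound gen.
  move=> [v v0 fv]; have [d d0 [w wE]] := common_denominator v.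
  have w0 : w != 0.
    apply: contraNneq v0 => w0; move: wE; rewrite w0 map_mx0 => /esym/eqP.
    by rewrite scaler_eq0 intr_eq0 (negPf d0).
  have := he w w0.
  have -> : intmx R w = d%:~R *: map_mx ratr v.
    apply/colP => j; have /colP/(_ j) := wE; rewrite !mxE => h.
    by rewrite -[LHS]ratr_int (_ : _%:~R = d%:~R * v j 0 :> rat) // rmorphM /= ratr_int.
  rewrite form_valueZ -generic_form_value.
  rewrite (meval_eq (v2 := fun j => ratr (v j 0))); last by move=> j; rewrite mxE.
  by rewrite fv mulr0 normr0 leNgt e0.
- have [e e0 he] := generic_bound gen; exists e => // _ [[v Zv <-]] /=.
  have := he v (Z0 v Zv); rewrite -generic_form_value.
  rewrite (meval_eq (v2 := fun j => (v j 0)%:~R)); last by move=> j; rewrite mxE.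
  by rewrite in_itv /= -ltr_norml ltNge => ->.
Qed.

End FormValues.

(** * Maximal tori *)

Section ToriEigenbasis.
Variable R : realType.
Local Open Scope complex_scope.
Local Notation C := R[i].
Local Notation RC := (real_complex R).

(** As [h] is real, the conjugates of the rows of [A] are then eigenvectors too, with conjugate
    eigenvalues. *)
Definition stack_torus s t n (A : 'M[C]_(s, n)) (B : 'M[R]_(t, n)) : set 'M[R]_n :=
  [set h | \det h = 1 /\
     ((exists z, A *m map_mx RC h = diag_mx z *m A) /\
      (exists u, B *m h = diag_mx u *m B))].

Lemma col_mx_subl (F : fieldType) m1 m2 n (A : 'M[F]_(m1, n)) (B : 'M[F]_(m2, n)) :
  (A <= col_mx A B)%MS.
Proof. by rewrite -addsmxE addsmxSl. Qed.

Lemma col_mx_subr (F : fieldType) m1 m2 n (A : 'M[F]_(m1, n)) (B : 'M[F]_(m2, n)) :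
  (B <= col_mx A B)%MS.
Proof. by rewrite -addsmxE addsmxSr. Qed.

Lemma conj_stack_subs s t n (A : 'M[C]_(s, n)) (B : 'M[R]_(t, n)) :
  [/\ (A <= conj_stack A B)%MS, (map_mx conjc A <= conj_stack A B)%MS &
      (map_mx RC B <= conj_stack A B)%MS].
Proof.
split; first exact: col_mx_subl.
  exact: submx_trans (col_mx_subl _ _) (col_mx_subr _ _).
exact: submx_trans (col_mx_subr _ _) (col_mx_subr _ _).
Qed.

Lemma conj_mxK m n (A : 'M[C]_(m, n)) : map_mx conjc (map_mx conjc A) = A.
Proof. by apply/matrixP => i j; rewrite !mxE conjcK. Qed.

Lemma conj_stack_conj s t n (A : 'M[C]_(s, n)) (B : 'M[R]_(t, n)) :
  (map_mx conjc (conj_stack A B) <= conj_stack A B)%MS.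
Proof.
have [sA sA' sB] := conj_stack_subs A B.
by rewrite {1}/conj_stack !map_col_mx conj_RC conj_mxK !col_mx_sub sA sA' sB.
Qed.

Lemma conj_stack_sub s t n m (A : 'M[C]_(s, n)) (B : 'M[R]_(t, n)) (M : 'M[C]_(m, n)) :
  (conj_stack A B <= M)%MS = [&& (A <= M)%MS, (map_mx conjc A <= M)%MS & (map_mx RC B <= M)%MS].
Proof. by rewrite /conj_stack !col_mx_sub. Qed.

Lemma conj_stack_stable s t n (A : 'M[C]_(s, n)) (B : 'M[R]_(t, n)) h z u :
  A *m map_mx RC h = diag_mx z *m A -> B *m h = diag_mx u *m B ->
  (conj_stack A B *m map_mx RC h <= conj_stack A B)%MS.
Proof.
move=> hA hB; have [sA sA' sB] := conj_stack_subs A B.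
have hA' : map_mx conjc A *m map_mx RC h = map_mx conjc (diag_mx z) *m map_mx conjc A.
  by rewrite -[map_mx RC h]conj_RC -conj_mulmx hA conj_mulmx.
rewrite {1}/conj_stack !mul_col_mx !col_mx_sub hA hA'.
rewrite (submx_trans (submxMl _ _) sA) /=.
rewrite (submx_trans (submxMl _ _) sA') -map_mxM hB map_mxM.
by rewrite (submx_trans (submxMl _ _) sB).
Qed.

Section Greedy.
Variables (n : nat) (H : set 'M[R]_n) (P : 'M[C]_n).
Hypotheses (Pu : P \in unitmx)
  (Pdiag : forall h, H h -> is_diag_mx (P *m map_mx RC h *m invmx P)).

Lemma diagonalizer_row i h : H h ->
  exists c, row i P *m map_mx RC h = c *: row i P.
Proof.
move=> /Pdiag /is_diag_mxP; set D := P *m _ *m _ => hD; exists (D i i).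
have PhE : P *m map_mx RC h = D *m P by rewrite mulmxKV.
clearbody D; rewrite -row_mul PhE row_mul; apply/rowP => j; rewrite !mxE (bigD1 i) //= !mxE.
by rewrite big1 ?addr0 // => k ki; rewrite !mxE hD ?mul0r // eq_sym.
Qed.

Definition stack_eigen s t (A : 'M[C]_(s, n)) (B : 'M[R]_(t, n)) : Prop :=
  forall h, H h -> (exists z, A *m map_mx RC h = diag_mx z *m A) /\
                   (exists u, B *m h = diag_mx u *m B).

Lemma diag_col_mx (F : comNzRingType) p (c : F) s (z : 'rV[F]_s)
    (w : 'rV[F]_p) (A : 'M[F]_(s, p)) :
  diag_mx (row_mx c%:M z) *m col_mx w A = col_mx (c *: w) (diag_mx z *m A).
Proof.
rewrite diag_mx_row mul_block_col !mul0mx addr0 add0r; congr col_mx.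
have -> : diag_mx (c%:M : 'M[F]_1) = c%:M :> 'M[F]_1.
  by apply/matrixP => i j; rewrite !ord1 !mxE eqxx !mulr1n.
by rewrite mul_scalar_mx.
Qed.

(* A common eigenvector outside the span is added together with its conjugate if
   some element of H has a non-real eigenvalue on it; otherwise its real or its
   imaginary part is added. *)
Lemma greedy_step s t (A : 'M[C]_(s, n)) (B : 'M[R]_(t, n)) :
  row_free (conj_stack A B) -> stack_eigen A B -> (s + (s + t) < n)%N ->
  exists s' t' (A' : 'M[C]_(s', n)) (B' : 'M[R]_(t', n)),
    [/\ row_free (conj_stack A' B'), stack_eigen A' B' &
        (s + (s + t) < s' + (s' + t'))%N].
Proof.
move=> free eig small; set S := conj_stack A B in free.
have [sA sA' sB] := conj_stack_subs A B; rewrite -/S in sA sA' sB.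
have [i nwS] : exists i, ~~ (row i P <= S)%MS.
  apply/existsP; rewrite -negb_forall; apply/negP => /forallP PS.
  have /mxrankS : (P <= S)%MS by apply/row_subP.
  by rewrite mxrank_unit // (eqP free) leqNgt small.
set w := row i P in nwS.
have weig h : H h -> exists c, w *m map_mx RC h = c *: w by exact: diagonalizer_row.
have up m (v : 'rV[C]_n) (M : 'M[C]_(m, n)) :
    ~~ (v <= M)%MS -> (\rank M < \rank (v + M)%MS)%N.
  move=> vM; apply: rank_ltmx; rewrite ltmxE addsmxSr /=.
  by apply: contra vM; apply: submx_trans; exact: addsmxSl.
have wE := cplx_ReIm w; set x := map_mx _ w in wE; set y := map_mx _ w in wE.
have [[h0 [Hh0 [c [whc cc]]]]|real] :=
    pselect (exists h0, H h0 /\ exists c, w *m map_mx RC h0 = c *: w /\ c != conjc c).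
  exists (1 + s)%N, t, (col_mx w A), B; split=> //=; last by rewrite !addnA; lia.
    (* If the conjugate of [w] were [k *: w + e] with [e] in the span [S], applying [h0] and
       subtracting the conjugate eigenvalue times the relation would put [k * (conjc c - c) *: w] in
       [S]. So [k = 0], and [w] is the conjugate of [e], which lies in the conjugation-stable
       [S]. *)
    have nw' : ~~ (map_mx conjc w <= w + S)%MS.
      apply/negP => /sub_addsmxP[[D E] /= dE].
      have ES : (E *m S <= S)%MS by exact: submxMl.
      set e := E *m S in dE ES; set T := map_mx RC h0 in whc.
      have eT : (e *m T <= S)%MS.
        have [[z Az] [u Bu]] := eig _ Hh0.
        by apply: submx_trans (submxMr _ ES) (conj_stack_stable Az Bu).
      rewrite [D]mx11_scalar mul_scalar_mx in dE; set k := D 0 0 in dE.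
      have wh' : map_mx conjc w *m T = conjc c *: map_mx conjc w.
        by rewrite -[T]conj_RC -conj_mulmx whc map_mxZ.
      have key : (k * (conjc c - c)) *: w = e *m T - conjc c *: e.
        have -> : e = map_mx conjc w - k *: w by rewrite dE addrC addKr.
        rewrite mulmxBl wh' -scalemxAl whc !scalerBr !scalerA mulrBr scalerBl opprB.
        by rewrite [RHS]addrC addrA subrK [conjc c * k]mulrC.
      have kw : (k * (conjc c - c) *: w <= S)%MS.
        by rewrite key addmx_sub // eqmx_opp scalemx_sub.
      have [k0|k0] := eqVneq k 0.
        move: dE; rewrite k0 scale0r add0r => dE; apply: (negP nwS).
        rewrite -[w]conj_mxK dE.
        by apply: submx_trans (conj_stack_conj A B); rewrite map_submx.
      apply: (negP nwS); rewrite -(eqmx_scale _ (_ : k * (conjc c - c) != 0)) //.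
      by rewrite mulf_neq0 // subr_eq0 eq_sym.
    have := leq_ltn_trans (up _ _ _ nwS) (up _ _ _ nw').
    rewrite (eqP free) => rk; rewrite /row_free eqn_leq rank_leq_row /=.
    apply: (@leq_trans (s + (s + t)).+2); first by lia.
    apply: leq_trans rk (mxrankS _).
    have [sA2 sA2' sB2] := conj_stack_subs (col_mx w A) B.
    move: sA2 sA2'; rewrite map_col_mx !col_mx_sub => /andP[k1 k2] /andP[k3 k4].
    by rewrite !addsmx_sub /S conj_stack_sub k1 k2 k3 k4.
  move=> h Hh; have [[z Az] [u Bu]] := eig _ Hh; have [d wd] := weig _ Hh.
  split; last by exists u.
  by exists (row_mx d%:M z); rewrite diag_col_mx mul_col_mx wd Az.
have real' h : H h -> exists c : R, x *m h = c *: x /\ y *m h = c *: y.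
  move=> Hh; have [c wc] := weig _ Hh; exists (complex.Re c).
  have cc : c = conjc c.
    by apply/eqP/negPn/negP => cc; apply: real; exists h; split=> //; exists c.
  move: wc; rewrite wE cplx_mul => /matrixP wc.
  have ci : complex.Im c = 0.
    by move: cc; case: (c) => a b [] /= ?; lra.
  by split; apply/rowP => j; have := wc 0 j; rewrite !mxE; move: ci; case: (c) => a b /= ->;
    case=> h1 h2; rewrite ?h1 ?h2 !mul0r ?subr0 ?addr0.
have [b beig nb] : exists2 b : 'rV[R]_n,
    (forall h, H h -> exists c : R, b *m h = c *: b) & ~~ (map_mx RC b <= S)%MS.
  have [xS|nx] := boolP (map_mx RC x <= S)%MS; last first.
    by exists x => // h /real'[c []]; exists c.
  exists y => [h /real'[c []]|]; first by exists c.
  apply: contra nwS => yS; rewrite wE cplxE addmx_sub // scalemx_sub //.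
exists s, (1 + t)%N, A, (col_mx b B); split.
- have := up _ _ _ nb; rewrite (eqP free) => rk.
  rewrite /row_free eqn_leq rank_leq_row /=.
  apply: (@leq_trans (s + (s + t)).+1); first by lia.
  apply: leq_trans rk (mxrankS _).
  have [sA2 sA2' sB2] := conj_stack_subs A (col_mx b B).
  move: sB2; rewrite map_col_mx !col_mx_sub => /andP[k1 k2].
  by rewrite addsmx_sub /S conj_stack_sub sA2 sA2' k1 k2.
- move=> h Hh; have [[z Az] [u Bu]] := eig _ Hh; have [d bd] := beig _ Hh.
  split; first by exists z.
  by exists (row_mx d%:M u); rewrite diag_col_mx mul_col_mx bd Bu.
- by lia.
Qed.

Lemma conj_eigenbasis : exists s t (A : 'M[C]_(s, n)) (B : 'M[R]_(t, n)),
  [/\ n = (s + (s + t))%N, row_free (conj_stack A B) & stack_eigen A B].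
Proof.
suff main k : (k <= n)%N -> exists s t (A : 'M[C]_(s, n)) (B : 'M[R]_(t, n)),
    [/\ (k <= s + (s + t))%N, row_free (conj_stack A B) & stack_eigen A B].
  have [s [t [A [B [h1 h2 h3]]]]] := main n (leqnn n).
  exists s, t, A, B; split=> //; apply/eqP; rewrite eqn_leq h1 /=.
  by rewrite -(eqP h2) rank_leq_col.
elim: k => [_|k IH kn].
  exists 0%N, 0%N, 0, 0; split=> //; first by rewrite /row_free mxrank_eq0 flatmx0 eqxx.
  by move=> h _; split; exists 0; rewrite !flatmx0.
have [s [t [A [B [h1 h2 h3]]]]] := IH (ltnW kn).
have [h4|h4] := ltnP k (s + (s + t)); first by exists s, t, A, B.
have [s' [t' [A' [B' [k1 k2 k3]]]]] := greedy_step h2 h3 (leq_ltn_trans h4 kn).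
by exists s', t', A', B'; split=> //; apply: leq_ltn_trans h1 k3.
Qed.

End Greedy.
End ToriEigenbasis.

(** * Zariski connectedness by means of rational curves *)

Section RationalCurves.
Variable R : realType.
Local Open Scope complex_scope.
Local Notation C := R[i].
Local Notation RC := (real_complex R).
Variable D : {poly C}.

(* Restrictions to the natural numbers of rational functions whose poles are
   among the zeros of D. *)
Definition ratfun (f : nat -> C) : Prop := exists e N,
  forall k : nat, D.[k%:R] != 0 -> f k = N.[k%:R] / D.[k%:R] ^+ e.

Lemma ratfun_ext f g : f =1 g -> ratfun f -> ratfun g.
Proof. by move=> fg [e [N hN]]; exists e, N => k hk; rewrite -fg hN. Qed.

Lemma ratfun_poly (P : {poly C}) : ratfun (fun k => P.[k%:R]).
Proof. by exists 0%N, P => k _; rewrite expr0 divr1. Qed.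

Lemma ratfun_inv (P : {poly C}) : P %| D -> ratfun (fun k => P.[k%:R]^-1).
Proof.
move=> /dvdpP[Q DE]; exists 1%N, Q => k; rewrite DE hornerM => h.
by rewrite expr1 invfM mulrA mulfV ?mul1r //; apply: contraNneq h => ->; rewrite mul0r.
Qed.

Lemma ratfun_cst c : ratfun (fun=> c).
Proof. by apply: ratfun_ext (ratfun_poly c%:P) => k; rewrite hornerC. Qed.

Lemma ratfunM f g : ratfun f -> ratfun g -> ratfun (fun k => f k * g k).
Proof.
move=> [e [N hN]] [e' [N' hN']]; exists (e + e')%N, (N * N') => k hk.
by rewrite hN // hN' // hornerM exprD invfM mulrACA.
Qed.

Lemma ratfunD f g : ratfun f -> ratfun g -> ratfun (fun k => f k + g k).
Proof.
move=> [e [N hN]] [e' [N' hN']]; exists (e + e')%N, (N * D ^+ e' + N' * D ^+ e) => k hk.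
rewrite hN // hN' // hornerD !hornerM !horner_exp exprD.
by rewrite addf_div ?expf_neq0.
Qed.

Lemma ratfun_sum (I : Type) (r : seq I) (P : pred I) (F : I -> nat -> C) :
  (forall i, ratfun (F i)) -> ratfun (fun k => \sum_(i <- r | P i) F i k).
Proof.
move=> hF; elim: r => [|i r IH].
  by apply: ratfun_ext (ratfun_cst 0) => k; rewrite big_nil.
case Pi: (P i).
  by apply: ratfun_ext (ratfunD (hF i) IH) => k; rewrite big_cons Pi.
by apply: ratfun_ext IH => k; rewrite big_cons Pi.
Qed.

Lemma ratfun_prod (I : Type) (r : seq I) (P : pred I) (F : I -> nat -> C) :
  (forall i, P i -> ratfun (F i)) -> ratfun (fun k => \prod_(i <- r | P i) F i k).
Proof.
move=> hF; elim: r => [|i r IH].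
  by apply: ratfun_ext (ratfun_cst 1) => k; rewrite big_nil.
case Pi: (P i).
  by apply: ratfun_ext (ratfunM (hF i Pi) IH) => k; rewrite big_cons Pi.
by apply: ratfun_ext IH => k; rewrite big_cons Pi.
Qed.

Lemma ratfunX f e : ratfun f -> ratfun (fun k => f k ^+ e).
Proof.
move=> hf; elim: e => [|e IH]; first by apply: ratfun_ext (ratfun_cst 1) => k; rewrite expr0.
by apply: ratfun_ext (ratfunM hf IH) => k; rewrite exprS.
Qed.

Lemma ratfun_mpoly m (p : mpoly m R) (f : nat -> 'I_m -> R) :
  (forall i, ratfun (fun k => (f k i)%:C)) -> ratfun (fun k => (meval (f k) p)%:C).
Proof.
move=> hf.
apply: (ratfun_ext (f := fun k => \sum_(d <- msupp p) (mcoeff d p)%:C * \prod_i (f k i)%:C ^+ d i)).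
  move=> k; rewrite mevalE rmorph_sum; apply: eq_bigr => d _.
  by rewrite rmorphM rmorph_prod; congr (_ * _); apply: eq_bigr => i _; rewrite rmorphXn.
apply: ratfun_sum => d; apply: ratfunM; first exact: ratfun_cst.
by apply: ratfun_prod => i _; apply: ratfunX.
Qed.

End RationalCurves.

Section ZariskiConnected.
Variable R : realType.
Local Open Scope complex_scope.
Local Notation C := R[i].

(** The argument is one of irreducibility. If the closed sets miss [h0] and [h1] respectively, some
    defining polynomial of each is nonzero there; along the curve both become rational functions
    with nonzero numerators, and some natural parameter avoids the zeros of both and of [D]. That
    point of [H] lies in neither closed set. *)
Lemma zariski_connected_curves n (H : set 'M[R]_n) :
  (forall h0 h1, H h0 -> H h1 -> exists (D : {poly C}) (c : nat -> 'M[R]_n),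
     [/\ forall i j, ratfun D (fun k => (c k i j)%:C),
         forall k, D.[k%:R] != 0 -> H (c k),
         D.[0] != 0 /\ c 0%N = h0 & D.[1] != 0 /\ c 1%N = h1]) ->
  zariski_connected H.
Proof.
move=> hH A B [I ->] [J ->] cover _; apply: contrapT => /not_orP[nA nB].
have [h0 [Hh0 nA0]] : exists h, H h /\ ~ forall p, I p -> meval (mxvec h 0) p = 0.
  by apply: contrapT => nh; apply: nA => h Hh; apply: contrapT => hh; apply: nh; exists h.
have [h1 [Hh1 nB1]] : exists h, H h /\ ~ forall p, J p -> meval (mxvec h 0) p = 0.
  by apply: contrapT => nh; apply: nB => h Hh; apply: contrapT => hh; apply: nh; exists h.
have [D [c [rc cH [D0 c0] [D1 c1]]]] := hH _ _ Hh0 Hh1.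
have [p [Ip p0]] : exists p, I p /\ meval (mxvec h0 0) p != 0.
  apply: contrapT => np; apply: nA0 => p Ip; apply/eqP/negPn/negP => hp.
  by apply: np; exists p.
have [q [Jq q1]] : exists q, J q /\ meval (mxvec h1 0) q != 0.
  apply: contrapT => nq; apply: nB1 => q Jq; apply/eqP/negPn/negP => hq.
  by apply: nq; exists q.
have rcv i : ratfun D (fun k => (mxvec (c k) 0 i)%:C).
  by case/mxvec_indexP: i => i j; apply: ratfun_ext (rc i j) => k; rewrite mxvecE.
have [e [N hN]] := ratfun_mpoly p rcv.
have [e' [N' hN']] := ratfun_mpoly q rcv.
have N0 : N != 0.
  have := hN 0%N; rewrite c0 => /(_ D0) E; apply: contraNneq p0 => N0.
  by move: E; rewrite N0 horner0 mul0r => /eqP; rewrite fmorph_eq0.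
have N'0 : N' != 0.
  have := hN' 1%N; rewrite c1 => /(_ D1) E; apply: contraNneq q1 => N'0.
  by move: E; rewrite N'0 horner0 mul0r => /eqP; rewrite fmorph_eq0.
have Dn0 : D != 0 by apply: contraNneq D0 => ->; rewrite horner0.
have [k] := nat_nonroot (mulf_neq0 Dn0 (mulf_neq0 N0 N'0)).
rewrite !hornerM !mulf_eq0 !negb_or => /and3P[Dk Nk N'k].
case: (cover _ (cH _ Dk)) => [/(_ _ Ip)|/(_ _ Jq)] E.
  have := hN _ Dk; rewrite E => /esym/eqP.
  by rewrite mulf_eq0 invr_eq0 expf_eq0 (negPf Nk) (negPf Dk) andbF.
have := hN' _ Dk; rewrite E => /esym/eqP.
by rewrite mulf_eq0 invr_eq0 expf_eq0 (negPf N'k) (negPf Dk) andbF.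
Qed.

End ZariskiConnected.

(** * The torus with prescribed conjugate pairs of eigenforms *)

Section StackTorus.
Variable R : realType.
Local Open Scope complex_scope.
Local Notation C := R[i].
Local Notation RC := (real_complex R).
Variables (s t : nat).
Local Notation n := (s + (s + t))%N.

Definition eigen_row (z : 'rV[C]_s) (u : 'rV[R]_t) : 'rV[C]_n :=
  row_mx z (row_mx (map_mx conjc z) (map_mx RC u)).

Lemma diag_conj_stack m z u (A : 'M[C]_(s, m)) (B : 'M[R]_(t, m)) :
  diag_mx (eigen_row z u) *m conj_stack A B = conj_stack (diag_mx z *m A) (diag_mx u *m B).
Proof.
rewrite /eigen_row /conj_stack !diag_mx_row !mul_block_col !mul0mx !addr0 !add0r.
by rewrite conj_mulmx (map_mxM RC) !map_diag_mx.
Qed.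

Lemma conj_stack_mul m p (A : 'M[C]_(s, m)) (B : 'M[R]_(t, m)) (h : 'M[R]_(m, p)) :
  conj_stack A B *m map_mx RC h = conj_stack (A *m map_mx RC h) (B *m h).
Proof. by rewrite /conj_stack !mul_col_mx conj_mulmx conj_RC map_mxM. Qed.

Lemma conj_stack_inj m (A A' : 'M[C]_(s, m)) (B B' : 'M[R]_(t, m)) :
  conj_stack A B = conj_stack A' B' -> A = A' /\ B = B'.
Proof. by move=> /eq_col_mx[-> /eq_col_mx[_ /map_mx_inj ->]]. Qed.

Variables (A : 'M[C]_(s, n)) (B : 'M[R]_(t, n)).
Hypothesis free : row_free (conj_stack A B).
Local Notation M := (conj_stack A B).

Lemma stack_unit : M \in unitmx.
Proof. by rewrite -row_free_unit. Qed.

(** Conjugation permutes the rows of both stacks in the same way, so the solution of the linear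
    system is fixed by it. This is what justifies taking real parts in [diag_elt]. *)
Lemma stack_solve p (A' : 'M[C]_(s, p)) (B' : 'M[R]_(t, p)) :
  map_mx RC (map_mx (@complex.Re R) (invmx M *m conj_stack A' B')) =
    invmx M *m conj_stack A' B'.
Proof.
apply/esym/conj_fixed_real; apply: (can_inj (mulKmx stack_unit)).
set h := invmx M *m _; have Mh : M *m h = conj_stack A' B' by rewrite mulKVmx ?stack_unit.
rewrite Mh; move: Mh; rewrite /conj_stack !mul_col_mx => /eq_col_mx[hA /eq_col_mx[hA' hB]].
have e1 : A *m map_mx conjc h = A'.
  by rewrite -[A]conj_mxK -conj_mulmx hA' conj_mxK.
have e2 : map_mx conjc A *m map_mx conjc h = map_mx conjc A'.
  by rewrite -conj_mulmx hA.
have e3 : map_mx RC B *m map_mx conjc h = map_mx RC B'.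
  by rewrite -[map_mx RC B]conj_RC -conj_mulmx hB conj_RC.
by rewrite e1 e2 e3.
Qed.

Definition diag_elt (z : 'rV[C]_s) (u : 'rV[R]_t) : 'M[R]_n :=
  map_mx (@complex.Re R) (invmx M *m conj_stack (diag_mx z *m A) (diag_mx u *m B)).

Lemma diag_eltE z u : map_mx RC (diag_elt z u) = invmx M *m (diag_mx (eigen_row z u) *m M).
Proof. by rewrite stack_solve diag_conj_stack. Qed.

Lemma diag_elt_mul z u : M *m map_mx RC (diag_elt z u) = diag_mx (eigen_row z u) *m M.
Proof. by rewrite diag_eltE mulKVmx ?stack_unit. Qed.

Lemma det_diag_elt h z u : M *m map_mx RC h = diag_mx (eigen_row z u) *m M ->
  (\det h)%:C = \prod_i (z 0 i * conjc (z 0 i)) * \prod_j (u 0 j)%:C.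
Proof.
move=> /(congr1 determinant); rewrite !det_mulmx [RHS]mulrC => /mulfI.
have M0 : \det M != 0 by rewrite -unitfE -unitmxE stack_unit.
move=> /(_ M0); rewrite det_map_mx det_diag => ->.
rewrite big_split_ord big_split_ord /= big_split -mulrA /eigen_row.
congr (_ * (_ * _)); apply: eq_bigr => i _.
- by rewrite row_mxEl.
- by rewrite row_mxEr row_mxEl mxE.
- by rewrite row_mxEr row_mxEr mxE.
Qed.

Lemma stack_torusP h : stack_torus A B h <->
  \det h = 1 /\ exists z u, M *m map_mx RC h = diag_mx (eigen_row z u) *m M.
Proof.
split=> [[h1 [[z hz] [u hu]]]|[h1 [z [u hzu]]]]; split=> //.
  by exists z, u; rewrite conj_stack_mul hz hu diag_conj_stack.
move: hzu; rewrite conj_stack_mul diag_conj_stack => /conj_stack_inj[hz hu].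
by split; [exists z | exists u].
Qed.

Lemma diag_eltK h z u : M *m map_mx RC h = diag_mx (eigen_row z u) *m M ->
  h = diag_elt z u.
Proof.
move=> hM; apply: (@map_mx_inj _ _ RC).
by rewrite diag_eltE -hM mulKmx ?stack_unit.
Qed.

Lemma stack_torus_diag_elt (z : 'rV[C]_s) (u : 'rV[R]_t) :
  \prod_i (z 0 i * conjc (z 0 i)) * \prod_j (u 0 j)%:C = 1 ->
  stack_torus A B (diag_elt z u).
Proof.
move=> zu1; apply/stack_torusP; split; last by exists z, u; rewrite diag_elt_mul.
have := det_diag_elt (diag_elt_mul z u); rewrite zu1 => /eqP.
by rewrite eq_complex /= => /andP[/eqP].
Qed.

Lemma row_diag_mul (F : comNzRingType) p q (d : 'rV[F]_p) (X : 'M[F]_(p, q)) i :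
  row i (diag_mx d *m X) = d 0 i *: row i X.
Proof. by rewrite row_mul row_diag_mx -scalemxAl -rowE. Qed.

Lemma stack_torus_subgroup : subgroup_of_SL (stack_torus A B).
Proof.
split=> [h []//||g h [g1 [[z Az] [u Bu]]] [h1 [[z' Az'] [u' Bu']]]|h [h1 [[z Az] [u Bu]]]].
- split; first exact: det1.
  split; first by exists (const_mx 1); rewrite map_mx1 mulmx1 diag_const_mx mul1mx.
  by exists (const_mx 1); rewrite mulmx1 diag_const_mx mul1mx.
- split; first by rewrite det_mulmx g1 h1 mulr1.
  rewrite map_mxM; split.
    by exists (\row_i (z 0 i * z' 0 i)); rewrite mulmxA Az -mulmxA Az' mulmxA mulmx_diag.
  by exists (\row_i (u 0 i * u' 0 i)); rewrite mulmxA Bu -mulmxA Bu' mulmxA mulmx_diag.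
- have hu : h \in unitmx by rewrite unitmxE h1 unitr1.
  (* A zero row of [X] may come with any eigenvalue, including 0, for which the convention
     [0^-1 = 0] still gives the equality. *)
  have inv (F : fieldType) p (X : 'M[F]_(p, n)) (k : 'M[F]_n) d : k \in unitmx ->
      X *m k = diag_mx d *m X -> X *m invmx k = diag_mx (map_mx (@GRing.inv F) d) *m X.
    move=> ku Xk; have {}Xk : X = diag_mx d *m (X *m invmx k) by rewrite mulmxA -Xk mulmxK.
    apply/row_matrixP => i; rewrite row_diag_mul mxE.
    have := congr1 (row i) Xk; rewrite row_diag_mul => E.
    have [d0|d0] := eqVneq (d 0 i) 0.
      by move: E; rewrite d0 scale0r row_mul => ->; rewrite mul0mx invr0 scale0r.
    by rewrite E scalerA mulVf // scale1r.
  split; first by rewrite det_inv h1 invr1.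
  split; last by exists (map_mx (@GRing.inv R) u); exact: inv.
  by exists (map_mx (@GRing.inv C) z); rewrite map_invmx; apply: inv => //; rewrite map_unitmx.
Qed.

Lemma stack_torus_diagonalizable : diagonalizable_over (real_complex R) (stack_torus A B).
Proof.
exists M; first exact: stack_unit.
move=> h /stack_torusP[_ [z [u ->]]].
by rewrite mulmxK ?stack_unit // diag_mx_is_diag.
Qed.

Definition frob_linform (c : 'M[R]_n) : mpoly (n * n) R := linform (mxvec c).

Lemma frob_linformE c g :
  meval (mxvec g 0) (frob_linform c) = \sum_i \sum_j c i j * g i j.
Proof.
rewrite (meval_eq (v2 := fun j => (mxvec g)^T j 0)); last by move=> j; rewrite mxE.
rewrite meval_linform mxE (reindex (uncurry (@mxvec_index n n))) /=; last exact: curry_mxvec_bij.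
rewrite pair_bigA /=; apply: eq_bigr => -[i j] _ /=.
by rewrite [(mxvec g)^T _ _]mxE !mxvecE.
Qed.

Lemma Re_mulr_real (x : C) (y : R) : complex.Re (x * y%:C) = complex.Re x * y.
Proof. by case: x => a b; rewrite /= mulr0 subr0. Qed.

Lemma Im_mulr_real (x : C) (y : R) : complex.Im (x * y%:C) = complex.Im x * y.
Proof. by case: x => a b; rewrite /= mulr0 add0r. Qed.

(** With all polynomials vanishing on the torus as equations, it remains to find enough of them: the
    determinant minus 1, and the real and imaginary parts of the off-diagonal entries of [M g M^-1],
    which are real linear forms in [g]. *)
Lemma stack_torus_closed : zariski_closed (stack_torus A B).
Proof.
exists [set p | forall h, stack_torus A B h -> meval (mxvec h 0) p = 0].
apply/seteqP; split=> [h Hh p|g hg]; first exact.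
pose X : 'M[mpoly (n * n) R]_n := \matrix_(i, j) mvar R (mxvec_index i j).
have Xeval h : meval (mxvec h 0) (\det X) = \det h.
  rewrite -det_map_mx; congr (\det _); apply/matrixP => i j.
  by rewrite !mxE /= mevalXU mxvecE.
have g1 : \det g = 1.
  apply/eqP; rewrite -subr_eq0 -Xeval -[1](meval1 (mxvec g 0)) -mevalB; apply/eqP.
  by apply: hg => h [h1 _]; rewrite mevalB Xeval meval1 h1 subrr.
pose N (h : 'M[R]_n) := M *m map_mx RC h *m invmx M.
have NE h i j : N h i j = \sum_k \sum_l (M i k * invmx M l j) * (h k l)%:C.
  rewrite /N mxE exchange_big /=; apply: eq_bigr => l _; rewrite mxE mulr_suml.
  by apply: eq_bigr => k _; rewrite !mxE mulrAC.
have Noff i j : i != j -> N g i j = 0.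
  move=> ij; have Nh h : stack_torus A B h -> N h i j = 0.
    move=> /stack_torusP[_ [z [u hzu]]]; rewrite /N hzu mulmxK ?stack_unit // mxE.
    by rewrite (negPf ij).
  have ReN h : complex.Re (N h i j) =
      meval (mxvec h 0) (frob_linform (\matrix_(k, l) complex.Re (M i k * invmx M l j))).
    rewrite frob_linformE NE raddf_sum; apply: eq_bigr => k _; rewrite raddf_sum.
    by apply: eq_bigr => l _; rewrite [X in _ = X * _]mxE; exact: Re_mulr_real.
  have ImN h : complex.Im (N h i j) =
      meval (mxvec h 0) (frob_linform (\matrix_(k, l) complex.Im (M i k * invmx M l j))).
    rewrite frob_linformE NE raddf_sum; apply: eq_bigr => k _; rewrite raddf_sum.
    by apply: eq_bigr => l _; rewrite [X in _ = X * _]mxE; exact: Im_mulr_real.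
  apply/eqP; rewrite eq_complex ReN ImN /=; apply/andP; split; apply/eqP.
    by apply: hg => h Hh; rewrite -ReN Nh.
  by apply: hg => h Hh; rewrite -ImN Nh.
split=> //; have NM : M *m map_mx RC g = N g *m M by rewrite /N mulmxKV ?stack_unit.
have ND : N g = diag_mx (\row_i N g i i).
  apply/matrixP => i j; rewrite [RHS]mxE [X in _ = X *+ _]mxE.
  by case: (i =P j) => [->|/eqP ij]; rewrite ?mulr1n // Noff.
have Mrow i : row i M *m map_mx RC g = N g i i *: row i M.
  by rewrite -row_mul NM ND row_diag_mul mxE -ND.
split.
  exists (\row_i N g (lshift _ i) (lshift _ i)).
  apply/row_matrixP => i; rewrite row_diag_mul mxE row_mul.
  by have := Mrow (lshift _ i); rewrite /conj_stack rowKu.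
exists (\row_j complex.Re (N g (rshift s (rshift s j)) (rshift s (rshift s j)))).
apply/row_matrixP => j; rewrite row_diag_mul mxE row_mul.
have := Mrow (rshift s (rshift s j)); rewrite /conj_stack !rowKd.
set c := N _ _ _ => /rowP hc; apply/rowP => k; have := hc k.
rewrite -map_row -map_mxM [X in X = _ -> _]mxE [X in _ = X -> _]mxE.
rewrite [X in _ = _ * X -> _]mxE => /(congr1 (@complex.Re R)).
by rewrite Re_mulr_real /= => ->; rewrite [RHS]mxE.
Qed.

Lemma stack_torus_curve (D : {poly C}) (z : nat -> 'rV[C]_s) (u : nat -> 'rV[R]_t) :
  (forall i, ratfun D (fun k => z k 0 i)) ->
  (forall i, ratfun D (fun k => conjc (z k 0 i))) ->
  (forall j, ratfun D (fun k => (u k 0 j)%:C)) ->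
  forall i j, ratfun D (fun k => (diag_elt (z k) (u k) i j)%:C).
Proof.
move=> hz hz' hu i j.
apply: (ratfun_ext (f := fun k => \sum_l invmx M i l * (eigen_row (z k) (u k) 0 l * M l j))).
  move=> k; have /matrixP/(_ i j) := diag_eltE (z k) (u k).
  rewrite [X in X = _ -> _]mxE [X in _ = X -> _]mxE => ->; apply: eq_bigr => l _.
  by rewrite mul_diag_mx [in RHS]mxE.
apply: ratfun_sum => l; apply: ratfunM; first exact: ratfun_cst.
apply: ratfunM; last exact: ratfun_cst.
rewrite -[l]splitK /eigen_row; case: (fintype.split l) => [i'|l'] /=.
  by apply: ratfun_ext (hz i') => k; rewrite row_mxEl.
rewrite -[l']splitK; case: (fintype.split l') => [i'|j'] /=.
  by apply: ratfun_ext (hz' i') => k; rewrite row_mxEr row_mxEl mxE.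
by apply: ratfun_ext (hu j') => k; rewrite row_mxEr row_mxEr mxE.
Qed.

Definition segment_poly (a b : C) : {poly C} := a%:P + (b - a) *: 'X.

Lemma segment_polyE a b k : (segment_poly a b).[k] = a + (b - a) * k.
Proof. by rewrite /segment_poly !hornerE. Qed.

(** Conjugation is not polynomial in a complex parameter, but at natural parameters it is; hence
    curves are sampled at natural numbers. *)
Lemma segment_poly_conj a b (k : nat) :
  conjc (segment_poly a b).[k%:R] = (segment_poly (conjc a) (conjc b)).[k%:R].
Proof. by rewrite !segment_polyE rmorphD rmorphM rmorphB /= conjc_nat. Qed.

Lemma mulr_conjc (x : C) : x * conjc x = (complex.Re x ^+ 2 + complex.Im x ^+ 2)%:C.
Proof. by case: x => a b; apply/eqP; rewrite eq_complex /=; apply/andP; split; apply/eqP; ring. Qed.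

(** All eigenvalues move on segments except the real one at [j0], which is the inverse of the
    product of the others. That product is [D], so the only poles are its zeros. *)
Lemma stack_torus_connected_real (j0 : 'I_t) : zariski_connected (stack_torus A B).
Proof.
apply: zariski_connected_curves => h0 h1 H0 H1.
have [d0 [z0 [u0 E0]]] := (stack_torusP h0).1 H0.
have [d1 [z1 [u1 E1]]] := (stack_torusP h1).1 H1.
pose z (k : nat) : 'rV[C]_s := \row_i (segment_poly (z0 0 i) (z1 0 i)).[k%:R].
pose v (k : nat) j : R := u0 0 j + (u1 0 j - u0 0 j) * k%:R.
pose w k := \prod_i (complex.Re (z k 0 i) ^+ 2 + complex.Im (z k 0 i) ^+ 2)
              * \prod_(j | j != j0) v k j.
pose u k : 'rV[R]_t := \row_j if j == j0 then (w k)^-1 else v k j.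
pose Pz i := segment_poly (z0 0 i) (z1 0 i).
pose Pz' i := segment_poly (conjc (z0 0 i)) (conjc (z1 0 i)).
pose Pu j := segment_poly (u0 0 j)%:C (u1 0 j)%:C.
pose D := \prod_i (Pz i * Pz' i) * \prod_(j | j != j0) Pu j.
have PuE j (k : nat) : (Pu j).[k%:R] = (v k j)%:C.
  by rewrite segment_polyE /v rmorphD rmorphM rmorphB /= rmorph_nat.
have DE (k : nat) : D.[k%:R] = (w k)%:C.
  rewrite hornerM !horner_prod rmorphM !rmorph_prod; congr (_ * _).
    by apply: eq_bigr => i _; rewrite hornerM /= -mulr_conjc mxE segment_poly_conj.
  by apply: eq_bigr => j _; rewrite PuE.
have prodE k : \prod_i (z k 0 i * conjc (z k 0 i)) * \prod_j (u k 0 j)%:C =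
    (w k * u k 0 j0)%:C.
  rewrite (bigD1 j0 (F := fun j => (u k 0 j)%:C)) //= [RHS]rmorphM mulrCA [RHS]mulrC.
  congr (_ * _); rewrite rmorphM !rmorph_prod; congr (_ * _).
    by apply: eq_bigr => i _; rewrite mulr_conjc.
  by apply: eq_bigr => j jj; rewrite mxE (negPf jj).
have ends h zz uu k : stack_torus A B h -> M *m map_mx RC h = diag_mx (eigen_row zz uu) *m M ->
    z k = zz -> (forall j, v k j = uu 0 j) -> D.[k%:R] != 0 /\ diag_elt (z k) (u k) = h.
  move=> [dh _] E zk vk; have := det_diag_elt E; rewrite dh -zk.
  have -> : \prod_j (uu 0 j)%:C = (uu 0 j0)%:C * \prod_(j | j != j0) (v k j)%:C.
    by rewrite (bigD1 j0) //=; congr (_ * _); apply: eq_bigr => j _; rewrite vk.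
  have -> : \prod_i (z k 0 i * conjc (z k 0 i)) * ((uu 0 j0)%:C * \prod_(j | j != j0) (v k j)%:C)
     = (w k * uu 0 j0)%:C.
    rewrite mulrCA [RHS]rmorphM [RHS]mulrC; congr (_ * _).
    rewrite rmorphM !rmorph_prod; congr (_ * _).
    by apply: eq_bigr => i _; rewrite mulr_conjc.
  move=> /eqP; rewrite eq_complex /= eqxx andbT eq_sym => /eqP w1.
  have w0 : w k != 0.
    by apply/eqP => w0; move: w1; rewrite w0 mul0r => /eqP; rewrite eq_sym oner_eq0.
  split; first by rewrite DE eq_complex /= eqxx andbT.
  rewrite (diag_eltK E) zk; suff -> : u k = uu by [].
  apply/rowP => j; rewrite mxE.
  case: (j =P j0) => [->|_]; last by rewrite vk.
  by rewrite -[RHS](mulKf w0) w1 mulr1.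
exists D, (fun k => diag_elt (z k) (u k)); split.
- apply: stack_torus_curve => [i|i|j].
  + by apply: ratfun_ext (ratfun_poly D (Pz i)) => k; rewrite mxE.
  + by apply: ratfun_ext (ratfun_poly D (Pz' i)) => k; rewrite mxE segment_poly_conj.
  + case: (j =P j0) => [->|/eqP jj].
      by apply: ratfun_ext (ratfun_inv (dvdpp D)) => k; rewrite DE mxE eqxx fmorphV.
    by apply: ratfun_ext (ratfun_poly D (Pu j)) => k; rewrite mxE (negPf jj) PuE.
- move=> k; rewrite DE => wk; apply: stack_torus_diag_elt.
  by rewrite prodE mxE eqxx mulfV ?rmorph1 //; apply: contraNneq wk => ->.
- apply: (ends h0 z0 u0 0%N) => //; first by apply/rowP => i; rewrite mxE segment_polyE mulr0 addr0.
  by move=> j; rewrite /v mulr0 addr0.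
- apply: (ends h1 z1 u1 1%N) => //; 
  first by apply/rowP => i; rewrite mxE segment_polyE mulr1 addrC subrK.
  by move=> j; rewrite /v mulr1 addrC subrK.
Qed.

(** Such a [y] satisfies [y / conjc y = w], and this quotient keeps modulus one when [y] leaves the
    unit circle along a segment. *)
Lemma sqrt_unit_norm (w : C) : w * conjc w = 1 ->
  exists y : C, [/\ y != 0, y * conjc y = 1 & y ^+ 2 = w].
Proof.
move=> w1; exists (sqrtC w); set y := sqrtC w.
have y2 : y ^+ 2 = w by rewrite sqrtCK.
have : (y * conjc y) ^+ 2 = 1 by rewrite exprMn -rmorphXn /= y2.
rewrite mulr_conjc expr2; set r := _ + _ => /(congr1 (@complex.Re R)) /=.
rewrite mul0r subr0 => r1.
have r0 : 0 <= r by rewrite addr_ge0 ?sqr_ge0.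
have {r1} r1 : r = 1 by nra.
split=> //; last by rewrite r1.
apply/eqP => y0; move: y2; rewrite y0 expr0n /= => w0.
by move: w1; rewrite -w0 mul0r => /eqP; rewrite eq_sym oner_eq0.
Qed.

(* The remaining constraint is |\prod_i z_i| = 1; it is parametrised by writing
   \prod_i z_i = y / conjc y and letting y and the z_i, i != i0, move on segments. *)
Lemma stack_torus_connected_complex (i0 : 'I_s) : t = 0%N ->
  zariski_connected (stack_torus A B).
Proof.
move=> t0; apply: zariski_connected_curves => h0 h1 H0 H1.
have noprod (u : 'I_t -> C) : \prod_j u j = 1.
  by rewrite big1 // => j _; move: (ltn_ord j); rewrite {2}t0.
have sq h : stack_torus A B h -> exists z u y,
    [/\ M *m map_mx RC h = diag_mx (eigen_row z u) *m M,
        (forall i, z 0 i != 0), y != 0,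
        y * conjc y = 1 & y ^+ 2 = \prod_i z 0 i].
  move=> Hh; have [dh [z [u E]]] := (stack_torusP h).1 Hh.
  have := det_diag_elt E; rewrite dh noprod mulr1 big_split /= -rmorph_prod.
  move=> /esym w1; have [y [y0 y1 y2]] := sqrt_unit_norm w1.
  exists z, u, y; split=> // i; apply/eqP => zi.
  by move: w1; rewrite (bigD1 i) //= zi !mul0r => /eqP; rewrite eq_sym oner_eq0.
have [z0 [u0 [y0 [E0 z0n y0n y0c y02]]]] := sq _ H0.
have [z1 [u1 [y1 [E1 z1n y1n y1c y12]]]] := sq _ H1.
pose Pz i := segment_poly (z0 0 i) (z1 0 i).
pose Pz' i := segment_poly (conjc (z0 0 i)) (conjc (z1 0 i)).
pose Y := segment_poly y0 y1; pose Y' := segment_poly (conjc y0) (conjc y1).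
pose D := Y * Y' * \prod_(i | i != i0) (Pz i * Pz' i).
pose q (k : nat) := \prod_(i | i != i0) (Pz i).[k%:R].
pose q' (k : nat) := \prod_(i | i != i0) (Pz' i).[k%:R].
pose z (k : nat) : 'rV[C]_s :=
  \row_i if i == i0 then Y.[k%:R] / Y'.[k%:R] / q k else (Pz i).[k%:R].
have conjY (k : nat) : conjc Y.[k%:R] = Y'.[k%:R] by exact: segment_poly_conj.
have conjY' (k : nat) : conjc Y'.[k%:R] = Y.[k%:R] by rewrite -conjY conjcK.
have conjq k : conjc (q k) = q' k.
  by rewrite /q rmorph_prod; apply: eq_bigr => i _; exact: segment_poly_conj.
have DE (k : nat) : D.[k%:R] = Y.[k%:R] * Y'.[k%:R] * (q k * q' k).
  rewrite !hornerM horner_prod -big_split; congr (_ * _).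
  by apply: eq_bigr => i _; rewrite hornerM.
pose Q := \prod_(i | i != i0) Pz i; pose Q' := \prod_(i | i != i0) Pz' i.
have QE (k : nat) : Q.[k%:R] = q k by rewrite horner_prod.
have QE' (k : nat) : Q'.[k%:R] = q' k by rewrite horner_prod.
have DQ : D = Y * Y' * (Q * Q') by rewrite /D big_split.
have ends h zz uu y k : M *m map_mx RC h = diag_mx (eigen_row zz uu) *m M ->
    (forall i, zz 0 i != 0) -> y != 0 -> y * conjc y = 1 ->
    y ^+ 2 = \prod_i zz 0 i -> Y.[k%:R] = y -> (forall i, (Pz i).[k%:R] = zz 0 i) ->
    D.[k%:R] != 0 /\ diag_elt (z k) 0 = h.
  move=> E zn yn yc y2 Yk Pk.
  have q0 : q k != 0 by apply/prodf_neq0 => i _; rewrite Pk.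
  split.
    rewrite DE -conjY Yk -conjq !mulf_neq0 // ?q0 ?fmorph_eq0 //.
  have uu0 : uu = 0 by apply/rowP => j; move: (ltn_ord j); rewrite {2}t0.
  rewrite (diag_eltK E) uu0; suff -> : z k = zz by [].
  apply/rowP => i; rewrite mxE; case: eqP => [->|_]; last exact: Pk.
  have -> : Y.[k%:R] / Y'.[k%:R] = y ^+ 2.
    have yc0 : conjc y != 0 by rewrite fmorph_eq0.
    by rewrite -conjY Yk; apply: (mulIf yc0); rewrite mulfVK // expr2 -mulrA yc mulr1.
  rewrite y2 (bigD1 i0) //= /q (eq_bigr _ (fun i _ => Pk i)) mulfK //.
  by rewrite -(eq_bigr _ (fun i _ => Pk i)).
exists D, (fun k => diag_elt (z k) 0); split.
- apply: stack_torus_curve => [i|i|j].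
  + case: (eqVneq i i0) => [->|ii].
      apply: (ratfun_ext (f := fun k => Y.[k%:R] * Y'.[k%:R]^-1 * Q.[k%:R]^-1)).
        by move=> k; rewrite mxE eqxx QE.
      apply: ratfunM; first apply: ratfunM; first exact: ratfun_poly.
        by apply: ratfun_inv; rewrite DQ -mulrA dvdp_mull // dvdp_mulr.
      by apply: ratfun_inv; rewrite DQ dvdp_mull // dvdp_mulr.
    by apply: ratfun_ext (ratfun_poly D (Pz i)) => k; rewrite mxE (negPf ii).
  + case: (eqVneq i i0) => [->|ii].
      apply: (ratfun_ext (f := fun k => Y'.[k%:R] * Y.[k%:R]^-1 * Q'.[k%:R]^-1)).
        by move=> k; rewrite mxE eqxx QE' !rmorphM !fmorphV /= conjY conjY' conjq.
      apply: ratfunM; first apply: ratfunM; first exact: ratfun_poly.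
        by apply: ratfun_inv; rewrite DQ -mulrA dvdp_mulr.
      by apply: ratfun_inv; rewrite DQ mulrA dvdp_mull.
    apply: ratfun_ext (ratfun_poly D (Pz' i)) => k; rewrite mxE (negPf ii).
    exact/esym/segment_poly_conj.
  + by move: (ltn_ord j); rewrite {2}t0.
- move=> k; rewrite DE !mulf_eq0 !negb_or => /andP[/andP[Yk Yk'] /andP[qk qk']].
  apply: stack_torus_diag_elt; rewrite noprod mulr1 (bigD1 i0) //= !mxE eqxx.
  have -> : \prod_(i | i != i0) (z k 0 i * conjc (z k 0 i)) = q k * q' k.
    rewrite big_split; congr (_ * _); apply: eq_bigr => i ii; rewrite mxE (negPf ii) //.
    exact: segment_poly_conj.
  rewrite !rmorphM !fmorphV /= conjY conjY' conjq.
  by field; rewrite Yk Yk' qk qk'.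
- apply: (ends h0 z0 u0 y0 0%N) => //; first by rewrite segment_polyE mulr0 addr0.
  by move=> i; rewrite segment_polyE mulr0 addr0.
- apply: (ends h1 z1 u1 y1 1%N) => //; first by rewrite segment_polyE mulr1 addrC subrK.
  by move=> i; rewrite segment_polyE mulr1 addrC subrK.
Qed.

Lemma stack_torus_torus : (0 < s)%N -> torus (stack_torus A B).
Proof.
move=> s0; split.
- exact: stack_torus_subgroup.
- exact: stack_torus_closed.
- case: (posnP t) => t0; last exact: stack_torus_connected_real (Ordinal t0).
  exact: stack_torus_connected_complex (Ordinal s0) t0.
- exact: stack_torus_diagonalizable.
Qed.

End StackTorus.

Section MaximalTori.
Variable R : realType.
Local Open Scope complex_scope.

Lemma maximal_torus_stack n (H : set 'M[R]_n) :
  maximal_torus H -> ~ diagonalizable_over idfun H ->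
  exists s t (A : 'M[R[i]]_(s, n)) (B : 'M[R]_(t, n)),
    [/\ n = (s + (s + t))%N, (0 < s)%N, row_free (conj_stack A B) &
        H = stack_torus A B].
Proof.
move=> [[[H1 H2 H3 H4] Hcl Hcon [P Pu Pd]] Hmax] nd.
have [s [t [A [B [nE free eig]]]]] := conj_eigenbasis Pu Pd.
have s0 : (0 < s)%N.
  rewrite lt0n; apply/eqP => s0; apply: nd; subst s; rewrite !add0n in nE; subst t.
  have Bu : B \in unitmx.
    rewrite -row_free_unit -(row_free_map (real_complex R)) -row_leq_rank.
    apply: leq_trans (mxrankS (_ : conj_stack A B <= _)%MS); first by rewrite (eqP free).
    by rewrite conj_stack_sub submx_refl andbT !flatmx0 !sub0mx.
  exists B => // h Hh; have [_ [u hu]] := eig h Hh.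
  by rewrite map_mx_id // hu mulmxK // diag_mx_is_diag.
exists s, t, A, B; split=> //; apply/esym.
subst n; apply: Hmax; first exact: stack_torus_torus.
by move=> h Hh; split; [exact: H1 | exact: eig].
Qed.

End MaximalTori.

(** * Compactness in the space of lattices *)

Section MatrixContinuity.
Variable R : realType.

Lemma continuous_sum (X : topologicalType) I (r : seq I) (P : pred I) (F : I -> X -> R) :
  (forall i, P i -> continuous (F i)) ->
  continuous (fun x => \sum_(i <- r | P i) F i x).
Proof. by move=> hF; apply: continuous_big => //; exact: add_continuous. Qed.

Lemma continuous_prod (X : topologicalType) I (r : seq I) (P : pred I) (F : I -> X -> R) :
  (forall i, P i -> continuous (F i)) ->
  continuous (fun x => \prod_(i <- r | P i) F i x).
Proof. by move=> hF; apply: continuous_big => //; exact: mul_continuous. Qed.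

Lemma continuous_mul (X : topologicalType) (f g : X -> R) :
  continuous f -> continuous g -> continuous (fun x => f x * g x).
Proof. by move=> hf hg x; apply: cvgM; [exact: hf | exact: hg]. Qed.

Lemma continuous_cst (X : topologicalType) (c : R) : continuous (fun _ : X => c).
Proof. by move=> x; exact: cvg_cst. Qed.

Lemma continuous_mx (X : topologicalType) m n (f : X -> 'M[R]_(m, n)) :
  (forall i j, continuous (fun x => f x i j)) -> continuous f.
Proof.
move=> hf x U [P hP sPU]; apply: filterS (_ : nbhs x [set y | forall i j, P i j (f y i j)]).
  by move=> y hy; exact: sPU.
apply: (@filter_forall _ _ _ (nbhs x)) => i.
apply: (@filter_forall _ _ _ (nbhs x)) => j.
exact: hf (hP i j).
Qed.

Lemma continuous_coord (X : topologicalType) m n (f : X -> 'M[R]_(m, n)) i j :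
  continuous f -> continuous (fun x => f x i j).
Proof.
move=> hf x; apply: (@continuous_comp _ _ _ f (fun M : 'M[R]_(m, n) => M i j)).
  exact: hf.
exact: coord_continuous.
Qed.

Lemma continuous_mulmx (X : topologicalType) m n p (f : X -> 'M[R]_(m, n))
    (g : X -> 'M[R]_(n, p)) :
  continuous f -> continuous g -> continuous (fun x => f x *m g x).
Proof.
move=> hf hg; apply: continuous_mx => i j.
under [X in continuous X]funext do rewrite mxE.
by apply: continuous_sum => k _; apply: continuous_mul; exact: continuous_coord.
Qed.

Lemma continuous_det (X : topologicalType) n (f : X -> 'M[R]_n) :
  continuous f -> continuous (fun x => \det (f x)).
Proof.
move=> hf; apply: continuous_sum => p _; apply: continuous_mul.
  exact: continuous_cst.
by apply: continuous_prod => i _; exact: continuous_coord.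
Qed.

Lemma continuous_adj (X : topologicalType) n (f : X -> 'M[R]_n) :
  continuous f -> continuous (fun x => \adj (f x)).
Proof.
move=> hf; apply: continuous_mx => i j.
under [X in continuous X]funext do rewrite mxE.
apply: continuous_mul; first exact: continuous_cst.
apply: continuous_det; apply: continuous_mx => k l.
under [X in continuous X]funext do rewrite !mxE.
exact: continuous_coord.
Qed.

Lemma continuous_meval (X : topologicalType) m (p : mpoly m R) (f : X -> 'I_m -> R) :
  (forall i, continuous (fun x => f x i)) -> continuous (fun x => meval (f x) p).
Proof.
move=> hf; apply: continuous_sum => d _; apply: continuous_mul.
  exact: continuous_cst.
apply: continuous_prod => i _; elim: (d i) => [|k IH].
  exact: continuous_cst.
under [X in continuous X]funext do rewrite exprS.
exact: continuous_mul.
Qed.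

Lemma zariski_closed_closed n (H : set 'M[R]_n) : zariski_closed H -> closed H.
Proof.
move=> [I ->].
have -> : [set g : 'M[R]_n | forall p, I p -> meval (mxvec g 0) p = 0] =
    \bigcap_(p in I) (fun g : 'M[R]_n => meval (mxvec g 0) p) @^-1` [set 0].
  by apply/seteqP; split=> g hg p Ip; exact: hg.
apply: closed_bigI => p _; apply: preimage_closed => [g _|].
  apply: continuous_meval => i; case/mxvec_indexP: i => i j.
  under [X in continuous X]funext do rewrite mxvecE.
  exact: coord_continuous.
exact: closed_eq.
Qed.

Lemma compact_bounded_mx n (K : R) :
  compact [set g : 'M[R]_n | \det g = 1 /\ forall i j, `|g i j| <= K].
Proof.
pose V := [set v : 'rV[R]_(n * n) | forall i, `[- K, K]%classic (v ord0 i)].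
have cV : compact V.
  by apply: (@rV_compact _ _ (fun=> `[- K, K]%classic)) => _; exact: segment_compact.
have cvec : continuous (@vec_mx R n n).
  apply: continuous_mx => i j; under [X in continuous X]funext do rewrite mxE.
  exact: coord_continuous.
have cG : compact (@vec_mx R n n @` V).
  by apply: continuous_compact => //; apply: continuous_subspaceT.
apply: (subclosed_compact _ cG).
  rewrite (_ : [set g | _] = [set g : 'M[R]_n | \det g = 1] `&`
      \bigcap_(ij in setT) [set g : 'M[R]_n | `|g ij.1 ij.2| <= K]); last first.
    apply/seteqP; split=> g [g1 g2]; split=> //; first by move=> ij _; exact: g2.
    by move=> i j; exact: (g2 (i, j)).
  apply: closedI.
    apply: (@preimage_closed _ _ (fun g : 'M[R]_n => \det g) [set 1]) => [g _|].
      by apply: continuous_det => x; exact: cvg_id.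
    exact: closed_eq.
  apply: closed_bigI => -[i j] _ /=.
  apply: (@preimage_closed _ _ (fun g : 'M[R]_n => g i j) [set x | `|x| <= K]) => [g _|].
    exact: coord_continuous.
  rewrite (_ : [set x | _] = `[- K, K]%classic); last first.
    by apply/seteqP; split=> x /=; rewrite in_itv /= ler_norml.
  exact: itv_closed.
move=> g [_ hg]; exists (mxvec g); last by rewrite mxvecK.
move=> i /=; case/mxvec_indexP: i => i j.
by rewrite mxvecE in_itv /= -ler_norml.
Qed.

End MatrixContinuity.

(** * Topology of the space of lattices *)

Section QuotientTopology.
Variables (R : realType) (n : nat).
Implicit Types (x y g : SL R n) (c : 'M[int]_n).

Definition mkSL (g : 'M[R]_n) (g1 : \det g = 1) : SL R n :=
  SigSub (mem_set (g1 : @SLset R n g)).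

Lemma det_SL x : \det (val x) = 1.
Proof. exact: (set_mem (valP x)). Qed.

Lemma det_SLmul x y : \det (val x *m val y) = 1.
Proof. by rewrite det_mulmx !det_SL mulr1. Qed.

Lemma det_SLintmx c : \det c = 1 -> \det (intmx R c) = 1.
Proof. by move=> c1; rewrite det_intmx c1. Qed.

Lemma SLproj_eq x y : SLproj x = SLproj y <->
  exists2 c, \det c = 1 & val y = val x *m intmx R c.
Proof.
split=> [/eqmodP/asboolP//|h]; apply/eqmodP; exact/asboolP.
Qed.

Lemma val_SL_continuous : continuous (val : SL R n -> 'M[R]_n).
Proof. exact: initial_continuous. Qed.

Lemma continuous_SL (X : topologicalType) (f : X -> SL R n) :
  continuous (fun u => val (f u)) -> continuous f.
Proof. exact: continuous_comp_initial. Qed.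

Definition SLmul x y : SL R n := mkSL (det_SLmul x y).

Lemma SLmul_continuous_l y : continuous (fun x => SLmul x y).
Proof.
apply: continuous_SL => /=; apply: continuous_mulmx; first exact: val_SL_continuous.
exact: cst_continuous.
Qed.

Lemma SLmul_continuous_r x : continuous (SLmul x).
Proof.
apply: continuous_SL => /=; apply: continuous_mulmx; last exact: val_SL_continuous.
exact: cst_continuous.
Qed.

Lemma SLproj_continuous : continuous (@SLproj R n).
Proof. exact: pi_continuous. Qed.

Lemma SLproj_surj (q : SLquot R n) : exists x, q = SLproj x.
Proof. by exists (repr q); rewrite /SLproj reprK. Qed.

(** The saturation of an open set is the union of its right translates by integral matrices. *)
Lemma SLproj_open (U : set (SL R n)) : open U -> open (@SLproj R n @` U).
Proof.
move=> oU; rewrite /open /= /quotient_open.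
have -> : @SLproj R n @^-1` (@SLproj R n @` U) =
    \bigcup_(c in [set c : {c : 'M[int]_n | \det c = 1} | True])
       (fun x => SLmul x (mkSL (det_SLintmx (svalP c)))) @^-1` U.
  apply/seteqP; split=> [x [y Uy /esym/SLproj_eq[c c1 E]]|x [c _ Ux]].
    exists (exist _ c c1) => //=; rewrite /preimage /=.
    by rewrite (_ : SLmul _ _ = y) //; exact: val_inj.
  have e : SLproj x = SLproj (SLmul x (mkSL (det_SLintmx (svalP c)))).
    by apply/SLproj_eq; exists (sval c) => //; exact: (svalP c).
  by exists (SLmul x (mkSL (det_SLintmx (svalP c)))); [exact: Ux | rewrite -e].
apply: bigcup_open => c _; move/continuousP: (@SLmul_continuous_l (mkSL (det_SLintmx (svalP c)))).
exact.
Qed.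

(** Two matrices are in the same coset when the quotient [f], written with the adjugate to make
    continuity plain, is integral. For distinct cosets some entry lies strictly between consecutive
    integers, and it stays there for nearby pairs. *)
Lemma SLquot_hausdorff : hausdorff_space (SLquot R n).
Proof.
rewrite open_hausdorff => p q pq.
have [a pa] := SLproj_surj p; have [b qb] := SLproj_surj q; subst p q.
pose f (uv : SL R n * SL R n) := \adj (val uv.1) *m val uv.2.
have cf : continuous f.
  apply: continuous_mulmx; [apply: continuous_adj|] => uv.
    by apply: continuous_comp; [exact: cvg_fst | exact: val_SL_continuous].
  by apply: continuous_comp; [exact: cvg_snd | exact: val_SL_continuous].
have [i [j nint]] : exists i j, f (a, b) i j \isn't a Num.int.
  apply: contrapT => nh; move/eqP: pq; apply; apply/SLproj_eq.
  have hint i j : f (a, b) i j \is a Num.int.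
    by apply/negPn/negP => h; apply: nh; exists i, j.
  pose c : 'M[int]_n := \matrix_(i, j) Num.floor (f (a, b) i j).
  have cE : intmx R c = f (a, b).
    by apply/matrixP => i j; rewrite [LHS]mxE [c _ _]mxE floorK // hint.
  have bE : val b = val a *m intmx R c by rewrite cE /f /= mulmxA mul_mx_adj det_SL mul1mx.
  exists c => //; apply/eqP; rewrite -(eqr_int R) -det_intmx.
  by have := congr1 determinant bE; rewrite det_mulmx !det_SL mul1r => <-.
pose k : int := Num.floor (f (a, b) i j).
have kint : f (a, b) i j \in `]k%:~R, (k + 1)%:~R[.
  rewrite in_itv /= lt_neqAle; have /andP[-> ->] := floor_itv (f (a, b) i j).
  by rewrite !andbT; apply: contraNneq nint => <-; exact: intr_int.
have : nbhs (a, b) ((fun uv => f uv i j) @^-1` `]k%:~R, (k + 1)%:~R[%classic).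
  have := @continuous_coord _ _ _ _ f i j cf (a, b).
  move=> /(_ `]k%:~R, (k + 1)%:~R[%classic); apply.
  by apply: open_nbhs_nbhs; split; [exact: itv_open | exact: kint].
move=> [[U V] /= [Ua Vb] UV].
exists (@SLproj R n @` U°, @SLproj R n @` V°) => /=.
  by split; apply/mem_set; [exists a | exists b].
split; [exact/SLproj_open/open_interior | exact/SLproj_open/open_interior |].
apply/eqP/seteqP; split=> // _ [[u Uu <-] [v Vv /esym/SLproj_eq[c c1 E]]].
have := UV (u, v) (conj (interior_subset Uu) (interior_subset Vv)).
rewrite /= /f /= E mulmxA mul_adj_mx det_SL mul1mx mxE in_itv /= !ltr_int.
by lia.
Qed.

Lemma compact_bounded_SL (K : R) : compact [set x : SL R n | forall i j, `|val x i j| <= K].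
Proof.
move=> F FF FK; have := compact_bounded_mx (n := n) (K := K).
move=> /(_ (val @ F)) [].
  rewrite /fmap /=; apply: filterS FK => x hx; split; [exact: det_SL | exact: hx].
move=> g [[g1 gK] cg]; exists (mkSL g1); split=> // A U FA.
move=> [_ [[V oV <-] /= Vg VU]].
have FA' : F (val @^-1` (val @` A)) by apply: filterS FA => x Ax; exists x.
have Vg' : nbhs g V by exact: open_nbhs_nbhs.
have [y [[x Ax <-] Vx]] := cg _ _ FA' Vg'.
by exists x; split=> //; exact: VU.
Qed.

(** The thick part of the space of lattices: no nonzero vector of [x Z^n] has squared length below
    [m]. *)
Definition SLthick (m : R) : set (SL R n) := [set x | forall v : 'cV[int]_n,
  v != 0 -> m <= \sum_i (val x *m intmx R v) i 0 ^+ 2].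

Lemma SLthick_closed m : closed (SLthick m).
Proof.
have -> : SLthick m = \bigcap_(v in [set v : 'cV[int]_n | v != 0])
    (fun x : SL R n => \sum_i (val x *m intmx R v) i 0 ^+ 2) @^-1` [set r | m <= r].
  by apply/seteqP; split=> x hx v v0; exact: hx.
apply: closed_bigI => v _; apply: preimage_closed => [x _|]; last exact: closed_ge.
apply: continuous_sum => i _.
under [X in continuous X]funext do rewrite expr2.
have ci : continuous (fun x : SL R n => (val x *m intmx R v) i 0).
  apply: continuous_coord; apply: continuous_mulmx; first exact: val_SL_continuous.
  exact: cst_continuous.
exact: continuous_mul.
Qed.

Lemma SLthick_invariant m x y : SLproj x = SLproj y -> SLthick m x -> SLthick m y.
Proof.
move=> /SLproj_eq[c c1 yE] hx v v0; rewrite yE -mulmxA -intmxM; apply: hx.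
have cu : c \in unitmx by rewrite unitmxE c1 unitr1.
by apply: contraNneq v0 => h; rewrite -(mulKmx cu v) h mulmx0.
Qed.

Lemma SLthick_proj_closed m : closed (@SLproj R n @` SLthick m).
Proof.
rewrite -[X in closed X]setCK; apply: open_closedC; rewrite /open /= /quotient_open.
have -> : @SLproj R n @^-1` (~` (@SLproj R n @` SLthick m)) = ~` SLthick m.
  apply/seteqP; split=> x hx h; apply: hx; first by exists x.
  by case: h => y hy /SLthick_invariant; exact.
exact/closed_openC/SLthick_closed.
Qed.

(* Mahler's criterion *)
Lemma SLthick_proj_compact m : 0 < m -> compact (@SLproj R n @` SLthick m).
Proof.
move=> m0; have [K hK] := @lattice_reduction R n m m0.
have cK : compact (@SLproj R n @` [set x : SL R n | forall i j, `|val x i j| <= K]).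
  apply: continuous_compact; last exact: compact_bounded_SL.
  exact/continuous_subspaceT/SLproj_continuous.
apply: (subclosed_compact _ cK); first exact: SLthick_proj_closed.
move=> _ [x hx <-]; have [c c1 hc] := hK (val x) (det_SL x) hx.
have e : SLproj x = SLproj (SLmul x (mkSL (det_SLintmx c1))).
  by apply/SLproj_eq; exists c.
by exists (SLmul x (mkSL (det_SLintmx c1))); [exact: hc | rewrite -e].
Qed.

End QuotientTopology.

(** * Recurrence in compact orbits *)

Section CompactOrbits.
Variables (R : realType) (n : nat) (H : set 'M[R]_n) (g : SL R n).
Hypotheses (Hsub : subgroup_of_SL H) (Hcl : closed H)
  (Hco : compact (SLorbit H g)).
Implicit Types (x y : SL R n) (c : 'M[int]_n).

Let H1 : H `<=` @SLset R n. Proof. by case: Hsub. Qed.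
Let HM a b : H a -> H b -> H (a *m b). Proof. by case: Hsub => _ _ + _; exact. Qed.
Let HV a : H a -> H (invmx a). Proof. by case: Hsub => _ _ _; exact. Qed.

Definition orbit_sheet c : set (SL R n) :=
  [set x | \det c = 1 /\ exists2 h, H h & val x = h *m val g *m intmx R c].

Definition orbit_lift : set (SL R n) := [set x | exists c, orbit_sheet c x].

Lemma orbit_liftE : orbit_lift = @SLproj R n @^-1` SLorbit H g.
Proof.
apply/seteqP; split=> [x [c [c1 [h Hh xE]]]|x [y [h Hh yE] yx]].
  exists (SLmul (mkSL (H1 Hh)) g); first by exists h.
  by apply/SLproj_eq; exists c.
have [c c1 xE] := (SLproj_eq y x).1 yx.
by exists c; split=> //; exists h => //; rewrite xE yE.
Qed.

Lemma orbit_lift_closed : closed orbit_lift.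
Proof.
rewrite orbit_liftE; apply: preimage_closed => [x _|]; first exact: SLproj_continuous.
by apply: compact_closed => //; exact: SLquot_hausdorff.
Qed.

Lemma orbit_sheet_closed c : closed (orbit_sheet c).
Proof.
have [c1|c1] := pselect (\det c = 1); last first.
  suff -> : orbit_sheet c = set0 by exact: closed0.
  by apply/seteqP; split=> x // [].
pose f x := val x *m (\adj (intmx R c) *m \adj (val g)).
rewrite (_ : orbit_sheet c = f @^-1` H).
  apply: preimage_closed => // x _; apply: continuous_mulmx; first exact: val_SL_continuous.
  exact: cst_continuous.
have cK : intmx R c *m \adj (intmx R c) = 1%:M by rewrite mul_mx_adj det_SLintmx.
have Kc : \adj (intmx R c) *m intmx R c = 1%:M by rewrite mul_adj_mx det_SLintmx.
have gK : val g *m \adj (val g) = 1%:M by rewrite mul_mx_adj det_SL.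
have Kg : \adj (val g) *m val g = 1%:M by rewrite mul_adj_mx det_SL.
apply/seteqP; split=> x.
  move=> [_ [h Hh xE]]; rewrite /preimage /= /f xE -!mulmxA.
  by rewrite (mulmxA (intmx R c)) cK mul1mx gK mulmx1.
move=> Hx; split=> //; exists (f x) => //.
by rewrite /f -!mulmxA (mulmxA (\adj (val g))) Kg mul1mx Kc mulmx1.
Qed.

Let leaf : set (SL R n) := [set x | exists2 h, H h & val x = h *m val g].

Lemma orbit_lift_base : orbit_lift g.
Proof.
exists 1%:M; split; first exact: det1.
by exists 1%:M; [case: Hsub | rewrite mul1mx /intmx map_mx1 mulmx1].
Qed.

(* Baire category, for the closed set orbit_lift and its countable cover by
   the closed sets orbit_sheet c: if no neighbourhood of g meets orbit_lift in
   H g only, then, by homogeneity, every sheet is nowhere dense. *)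
Lemma orbit_isolated : nbhs g [set x | orbit_lift x -> leaf x].
Proof.
apply: contrapT => nh.
have escape (U : set (SL R n)) : nbhs g U -> exists x, [/\ U x, orbit_lift x & ~ leaf x].
  move=> gU; apply: contrapT => nx; apply: nh; apply: filterS gU => x Ux lx.
  by apply: contrapT => nl; apply: nx; exists x.
(* The doubled radius replaces closed balls: the limit point of the nested construction is only
   known to lie within [r' + r'] of each centre. *)
have step c s (r : R) : orbit_lift s -> 0 < r -> exists s' (r' : R),
    [/\ orbit_lift s', 0 < r', forall y, ball s' (r' + r') y -> ball s r y &
        forall y, ball s' (r' + r') y -> ~ orbit_sheet c y].
  move=> ls r0.
  have nb : nbhs s (ball s r)° by apply/nbhs_interior/nbhsx_ballx.
  have [s' [ls' ss' ncs']] : exists s', [/\ orbit_lift s', (ball s r)° s' & ~ orbit_sheet c s'].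
    have [[c1 [h Hh sE]]|ncs] := pselect (orbit_sheet c s); last first.
      by exists s; split=> //; exact: nbhs_singleton.
    (* The homeomorphism [phi] carries [g] to [s], the leaf to the sheet of [c], and preserves the
       lift; so a point leaving the leaf near [g] becomes one leaving the sheet near [s]. *)
    pose phi x := SLmul (SLmul (mkSL (H1 Hh)) x) (mkSL (det_SLintmx R c1)).
    have phi_cont : continuous phi.
      move=> x; apply: (@continuous_comp _ _ _ (SLmul (mkSL (H1 Hh)))
        (fun y => SLmul y (mkSL (det_SLintmx R c1)))).
        exact: SLmul_continuous_r.
      exact: SLmul_continuous_l.
    have phig : phi g = s by apply: val_inj; rewrite /= sE.
    have [|x [Ux [c' [c'1 [h' Hh' xE]]] nx]] := escape (phi @^-1` (ball s r)°).
      by apply: phi_cont; rewrite phig.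
    exists (phi x); split=> //.
      exists (c' *m c); split; first by rewrite det_mulmx c'1 c1 mulr1.
      exists (h *m h'); first exact: HM.
      by rewrite /= xE intmxM !mulmxA.
    move=> [_ [h2 Hh2 /= E]]; apply: nx; exists (invmx h *m h2).
      by apply: HM => //; exact: HV.
    have cu : intmx R c \in unitmx by rewrite unitmxE det_SLintmx // unitr1.
    have hu : h \in unitmx by rewrite unitmxE (H1 Hh) unitr1.
    apply: (can_inj (mulKmx hu)); rewrite -mulmxA mulKVmx //.
    by apply: (can_inj (mulmxK cu)).
  have : nbhs s' (ball s r `&` ~` orbit_sheet c).
    apply: filterI; first exact: ss'.
    apply: open_nbhs_nbhs; split=> //; exact/closed_openC/orbit_sheet_closed.
  move=> /nbhs_ballP[e /= e0 he]; exists s', (e / 2); split=> //.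
  - by rewrite divr_gt0.
  - by move=> y; rewrite -splitr => /he[].
  - by move=> y; rewrite -splitr => /he[].
(* Every [c] is [ex (pickle c)], so its sheet is avoided from stage [(pickle c).+1] on; the default
   at codes that decode to nothing is arbitrary. *)
pose ex k : 'M[int]_n := odflt 0 (unpickle k).
have [f fP] : exists f : nat -> SL R n * R -> SL R n * R, forall k sr,
    orbit_lift sr.1 -> 0 < sr.2 ->
    [/\ orbit_lift (f k sr).1, 0 < (f k sr).2,
      forall y, ball (f k sr).1 ((f k sr).2 + (f k sr).2) y -> ball sr.1 sr.2 y &
      forall y, ball (f k sr).1 ((f k sr).2 + (f k sr).2) y -> ~ orbit_sheet (ex k) y].
  have h (ksr : nat * (SL R n * R)) : exists sr' : SL R n * R,
     orbit_lift ksr.2.1 -> 0 < ksr.2.2 ->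
    [/\ orbit_lift sr'.1, 0 < sr'.2,
      forall y, ball sr'.1 (sr'.2 + sr'.2) y -> ball ksr.2.1 ksr.2.2 y &
      forall y, ball sr'.1 (sr'.2 + sr'.2) y -> ~ orbit_sheet (ex ksr.1) y].
    case: ksr => k [s r] /=; have [[ls r0]|nlr] := pselect (orbit_lift s /\ 0 < r).
      by have [s' [r' ?]] := step (ex k) s r ls r0; exists (s', r').
    by exists (s, r) => ls r0; case: nlr.
  have [f hf] := boolp.choice h; exists (fun k sr => f (k, sr)) => k sr.
  exact: (hf (k, sr)).
pose u := fix u k := if k is k'.+1 then f k' (u k') else (g, 1 : R).
have uP k : orbit_lift (u k).1 /\ 0 < (u k).2.
  elim: k => [|k [lk rk]]; first by split; [exact: orbit_lift_base | exact: ltr01].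
  by have [] := fP k (u k) lk rk.
have sub k m y : ball (u (k + m)%N).1 (u (k + m)%N).2 y -> ball (u k).1 (u k).2 y.
  elim: m => [|m IH]; first by rewrite addn0.
  rewrite addnS => hy; apply: IH; have [lk rk] := uP (k + m)%N.
  have [_ rk' h _] := fP (k + m)%N (u (k + m)%N) lk rk; apply: h.
  by apply: le_ball hy; rewrite lerDl ltW.
have cen k m : ball (u k).1 (u k).2 (u (k + m)%N).1.
  by apply: (sub k m); apply: ballxx; case: (uP (k + m)%N).
(* All centres lie in the unit ball around [g], so their entries are bounded; compactness of that
   bounded part of the group supplies a limit point in place of completeness. *)
pose K : R := 1 + \sum_i \sum_j `|val g i j|.
pose F := (fun k => (u k).1) @ \oo.
have FK : F [set x : SL R n | forall i j, `|val x i j| <= K].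
  exists 0%N => // k _ /= i j.
  have /= [_ /(_ i j)] := cen 0%N k; rewrite add0n /ball /= => h.
  have gK : `|val g i j| <= \sum_i \sum_j `|val g i j|.
    rewrite (bigD1 i) //= (bigD1 j) //= -addrA lerDl addr_ge0 // ?sumr_ge0 //.
    by move=> i' _; rewrite sumr_ge0.
  have := ler_distD (val g i j) 0 (val (u k).1 i j); rewrite !sub0r !normrN.
  by rewrite /K; lra.
have [p [_ pF]] := compact_bounded_SL (K := K) _ FK.
have lp : orbit_lift p.
  apply: orbit_lift_closed => B pB.
  apply: pF => //; exists 0%N => // k _ /=; by case: (uP k).
have pk k : ball (u k).1 ((u k).2 + (u k).2) p.
  have [lk rk] := uP k.
  have [||y [[m /= km <-] py]] := pF [set (u m).1 | m in [set m | (k <= m)%N]] (ball p (u k).2).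
  - by exists k => // m /= km; exists m.
  - exact: nbhsx_ballx.
  apply: ball_triangle (ball_sym py).
  by rewrite -(subnKC km); exact: cen.
have [c sc] := lp.
have [lk rk] := uP (pickle c).
have [_ _ _ h] := fP (pickle c) (u (pickle c)) lk rk.
by apply: (h p); [exact: (pk (pickle c).+1) | rewrite /ex pickleK].
Qed.

(** In the compact orbit the projections of [hs k *m g] accumulate at some [h0 g]. Translating by
    the inverse of [h0] moves the accumulation to [g], where [orbit_isolated] turns closeness in the
    quotient into closeness along [H g]. The returned element lies within 1 of [h0], whence the
    choice of [K]. *)
Lemma orbit_return (hs : nat -> 'M[R]_n) : (forall k, H (hs k)) ->
  exists K : R, forall N : nat, exists k, (N <= k)%N /\
    exists h c, [/\ H h, \det c = 1, forall i j, `|h i j| <= K &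
      hs k *m val g *m intmx R c = h *m val g].
Proof.
move=> Hhs; pose o k := SLproj (SLmul (mkSL (H1 (Hhs k))) g).
have [q [[x0 [h0 Hh0 x0E] <-] qc]] : SLorbit H g `&` cluster (o @ \oo) !=set0.
  apply: Hco; exists 0%N => // k _ /=.
  by exists (SLmul (mkSL (H1 (Hhs k))) g) => //; exists (hs k).
pose K : R := 1 + \sum_i \sum_j `|h0 i j|; exists K => N.
have h0V : \det (invmx h0) = 1 by exact: H1 (HV Hh0).
have h0u : h0 \in unitmx by rewrite unitmxE (H1 Hh0) unitr1.
pose phi := SLmul (mkSL h0V).
have phix0 : phi x0 = g by apply: val_inj; rewrite /= x0E mulKmx.
pose psi x := val x *m \adj (val g).
have psix0 : psi x0 = h0 by rewrite /psi x0E -mulmxA mul_mx_adj det_SL mulmx1.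
have psic : continuous psi.
  by apply: continuous_mulmx; [exact: val_SL_continuous | exact: cst_continuous].
have n1 : nbhs x0 (phi @^-1` [set x | orbit_lift x -> leaf x]).
  apply: SLmul_continuous_r; rewrite -/phi phix0; exact: orbit_isolated.
have n2 : nbhs x0 (psi @^-1` ball h0 1).
  by apply: psic; rewrite psix0; exact: nbhsx_ballx.
pose V := phi @^-1` [set x | orbit_lift x -> leaf x] `&` psi @^-1` ball h0 1.
have nV : nbhs x0 V by exact: filterI.
have [||_ [[k /= Nk <-] [x Vx xo]]] :=
    qc [set o k | k in [set k | (N <= k)%N]] (@SLproj R n @` V°).
- by exists N => // k /= Nk; exists k.
- apply: open_nbhs_nbhs; split; first exact/SLproj_open/open_interior.
  by exists x0 => //; exact: nV.
have {Vx} [Vx1 Vx2] := interior_subset Vx.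
exists k; split=> //.
have /SLproj_eq[c c1 /= xE] := esym xo.
have [h Hh xh] : leaf (phi x).
  apply: Vx1; exists c; split=> //; exists (invmx h0 *m hs k).
    by apply: HM => //; exact: HV.
  by rewrite /= xE !mulmxA.
exists (h0 *m h), c; split=> //; first exact: HM.
  move=> i j; have hE : psi x = h0 *m h.
    rewrite /psi -(mulKVmx h0u (val x)) -[invmx h0 *m val x]/(val (phi x)) xh.
    by rewrite -!mulmxA mul_mx_adj det_SL mulmx1.
  have [_ /(_ i j)] := Vx2; rewrite hE /ball /= => h1.
  have gK : `|h0 i j| <= \sum_i \sum_j `|h0 i j|.
    rewrite (bigD1 i) //= (bigD1 j) //= -addrA lerDl addr_ge0 // ?sumr_ge0 //.
    by move=> i' _; rewrite sumr_ge0.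
  have := ler_distD (h0 i j) 0 ((h0 *m h) i j); rewrite !sub0r !normrN.
  by rewrite /K; lra.
rewrite -xE -mulmxA -xh /=; exact/esym/mulKVmx.
Qed.

End CompactOrbits.

(** * Spectrum of integral matrices *)

Section IntegralSpectrum.
Variable R : realType.
Local Open Scope complex_scope.
Local Notation C := R[i].
Local Notation intC := (map_mx (intr : int -> C)).

Lemma root_prod_seq (I : finType) (a : I -> C) x :
  root (\prod_i ('X - (a i)%:P)) x -> exists i, x = a i.
Proof.
rewrite rootE horner_prod => /eqP/eqP; rewrite prodf_seq_eq0 => /hasP[i _ /=].
by rewrite hornerXsubC subr_eq0 => /eqP ->; exists i.
Qed.

Lemma double_root (I : finType) (a : I -> C) x (q := \prod_i ('X - (a i)%:P)) :
  root q x -> root q^`() x -> exists i j, [/\ i != j, a i = x & a j = x].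
Proof.
move=> /root_prod_seq[i xi]; rewrite /q (bigD1 i) //= derivM derivXsubC mul1r.
rewrite rootE !hornerE xi subrr mul0r addr0 -rootE.
rewrite rootE horner_prod => /eqP/eqP; rewrite prodf_seq_eq0 => /hasP[j _ /=].
by case/andP => ji; rewrite hornerXsubC subr_eq0 => /eqP aij; exists i, j; rewrite eq_sym.
Qed.

Lemma root_double (I : finType) (a : I -> C) i j (q := \prod_i ('X - (a i)%:P)) :
  i != j -> a i = a j -> root q (a i) /\ root q^`() (a i).
Proof.
move=> ij aij; rewrite /q (bigD1 i) //= (bigD1 j) ?(eq_sym j) //= -aij.
split; first by rewrite rootE hornerM hornerXsubC subrr mul0r.
by rewrite rootE derivM derivXsubC mul1r hornerD !hornerM hornerXsubC subrr !mul0r addr0.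
Qed.

Lemma norm_mul_eq1 (x y : int) : `|x| * `|y| = 1 -> `|x| = 1.
Proof.
move=> /(congr1 absz) /eqP; rewrite abszM !absz_id muln_eq1 => /andP[/eqP x1 _].
by rewrite -abszE x1.
Qed.

(* A multiple root would be a root of gcd(q, q'), whose primitive integral
   associate has leading and constant coefficients 1 or -1 but all its roots in
   the open unit disc. *)
Lemma separable_spectrum (I : finType) (a : I -> C) (q : {poly int}) (j0 : I) :
  map_poly intr q = \prod_i ('X - (a i)%:P) -> q \is monic -> `|q`_0| = 1 ->
  (forall i, i != j0 -> `|a i| < 1) -> injective a.
Proof.
move=> qE qm q0 small i j aij; apply/eqP/negPn/negP => ij.
pose qQ : {poly rat} := map_poly intr q.
have qCE : map_poly (ratr : rat -> C) qQ = \prod_i ('X - (a i)%:P).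
  by rewrite -qE -map_poly_comp; apply: eq_map_poly => k /=; rewrite ratr_int.
have [p1 [k k0 dE] [r qr]] := dvdpP_rat_int (dvdp_gcdl qQ qQ^`()).
have droot x : root (map_poly ratr (gcdp qQ qQ^`())) x =
    root (\prod_i ('X - (a i)%:P)) x && root (\prod_i ('X - (a i)%:P))^`() x.
  by rewrite gcdp_map root_gcd -deriv_map qCE.
have p1root x : root (map_poly intr p1) x ->
    root (\prod_i ('X - (a i)%:P)) x && root (\prod_i ('X - (a i)%:P))^`() x.
  rewrite -droot dE map_polyZ rootZ ?fmorph_eq0 // -map_poly_comp.
  by rewrite (eq_map_poly (@ratr_int _)).
have lead1 : `|lead_coef p1| = 1.
  have := congr1 (fun p => `|lead_coef p|) qr; rewrite lead_coefM (monicP qm) normr1 normrM.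
  by move=> /esym/norm_mul_eq1.
have const1 : `|p1`_0| = 1.
  by move: q0; rewrite qr coef0M normrM => /norm_mul_eq1.
have [z pz] := closed_field_poly_normal (map_poly (intr : int -> C) p1).
have lC : lead_coef (map_poly (intr : int -> C) p1) = (lead_coef p1)%:~R.
  by rewrite lead_coef_map_inj //; exact: intr_inj.
have lC0 : lead_coef (map_poly (intr : int -> C) p1) != 0.
  by rewrite lC intr_eq0 -normr_eq0 lead1.
(* A double root is the value of [a] at two distinct indices, at least one of which differs from
   [j0]. *)
have zsmall x : x \in z -> `|x| < 1.
  move=> xz; have /p1root/andP[h1 h2] : root (map_poly (intr : int -> C) p1) x.
    by rewrite pz rootZ // root_prod_XsubC.
  have [i' [j' [ij' <- aj']]] := double_root h1 h2.
  have [i'0|i'0] := eqVneq i' j0; last exact: small.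
  by rewrite -aj'; apply: small; rewrite eq_sym -i'0.
have z0 : z != [::].
  apply/eqP => z0; have [h1 h2] := root_double ij aij.
  have : root (map_poly ratr (gcdp qQ qQ^`())) (a i) by rewrite droot h1 h2.
  rewrite dE map_polyZ rootZ ?fmorph_eq0 // -map_poly_comp.
  rewrite (eq_map_poly (@ratr_int _)) pz z0 big_nil rootZ //.
  by rewrite rootE hornerC oner_eq0.
have : `|(map_poly (intr : int -> C) p1).[0]| = 1.
  by rewrite horner_coef0 coef_map /= -intr_norm const1.
rewrite pz hornerZ normrM lC -intr_norm lead1 mul1r horner_prod normr_prod => h.
move: z0 zsmall h; case: z {pz} => // x z _ zsmall; rewrite big_cons hornerXsubC sub0r normrN.
move=> h; have : `|x| * \prod_(y <- z) `|('X - y%:P).[0]| < 1.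
  apply: le_lt_trans (_ : `|x| * 1 < 1); last by rewrite mulr1 zsmall ?mem_head.
  apply: ler_wpM2l => //; rewrite big_seq; apply: prodr_ile1 => y yz.
  by rewrite hornerXsubC sub0r normrN normr_ge0 ltW // zsmall // inE yz orbT.
by rewrite h ltxx.
Qed.

Variables (n : nat) (c : 'M[int]_n) (L : 'M[C]_n) (chi : 'rV[C]_n).
Hypotheses (Lu : L \in unitmx) (Lc : L *m intC c = diag_mx chi *m L).

Lemma char_poly_spectrum : map_poly intr (char_poly c) = \prod_i ('X - (chi 0 i)%:P).
Proof.
have -> : \prod_i ('X - (chi 0 i)%:P) = char_poly (diag_mx chi).
  rewrite char_poly_trig; last exact/diag_mx_is_trig.
  by apply: eq_bigr => i _; rewrite mxE eqxx mulr1n.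
rewrite map_char_poly /char_poly.
have E : map_mx polyC L *m char_poly_mx (intC c) =
    char_poly_mx (diag_mx chi) *m map_mx polyC L.
  by rewrite /char_poly_mx mulmxBr mulmxBl -!map_mxM Lc scalar_mxC.
move/(congr1 determinant): E; rewrite !det_mulmx [RHS]mulrC => /mulfI; apply.
by rewrite det_map_mx polyC_eq0 -unitfE -unitmxE.
Qed.

Lemma spectrum_algebraic i : algebraic (chi 0 i).
Proof.
apply: (@algebraic_intr_root _ (char_poly c)); first exact/monic_neq0/char_poly_monic.
by rewrite char_poly_spectrum rootE horner_prod (bigD1 i) //= hornerXsubC subrr mul0r.
Qed.

Lemma prod_spectrum : \prod_i chi 0 i = (\det c)%:~R.
Proof.
have /(congr1 determinant) := Lc; rewrite !det_mulmx det_diag [LHS]mulrC det_map_mx.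
by move=> /mulIf -> //; rewrite -unitfE -unitmxE.
Qed.

Definition eigenspace_mx i0 : 'M[C]_n := kermx (intC c - (chi 0 i0)%:M).

Lemma eigenspace_mx_algebraic i0 : algebraic_mx (eigenspace_mx i0).
Proof.
apply: algebraic_kermx => i j; rewrite !mxE; apply: algebraic_sub.
  exact: algebraic_int.
case: (i == j); rewrite ?mulr1n ?mulr0n; last exact: algebraic0.
exact: spectrum_algebraic.
Qed.

(** In the basis of rows of [L], an eigenvector has nonzero coordinates only on rows with its own
    eigenvalue. *)
Lemma eigenspace_mx_sub i0 m (W : 'M[C]_(m, n)) :
  (forall i, chi 0 i = chi 0 i0 -> (row i L <= W)%MS) -> (eigenspace_mx i0 <= W)%MS.
Proof.
move=> hW; apply/row_subP => k; set w := row k _.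
have wc : w *m intC c = chi 0 i0 *: w.
  have : w *m (intC c - (chi 0 i0)%:M) = 0.
    by rewrite /w -row_mul /eigenspace_mx mulmx_ker row0.
  by rewrite mulmxBr mul_mx_scalar => /eqP; rewrite subr_eq0 => /eqP.
pose a := w *m invmx L; have wa : w = a *m L by rewrite mulmxKV.
have ai i : chi 0 i != chi 0 i0 -> a 0 i = 0.
  move=> hi; have : a *m diag_mx chi = chi 0 i0 *: a.
    apply: (can_inj (mulmxK Lu)); rewrite -mulmxA -Lc mulmxA -wa wc wa.
    by rewrite scalemxAl.
  rewrite mul_mx_diag => /rowP/(_ i); rewrite !mxE => /eqP.
  by rewrite mulrC -subr_eq0 -mulrBl mulf_eq0 subr_eq0 (negPf hi) => /eqP.
rewrite wa mulmx_sum_row; apply: summx_sub => i _.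
have [hi|hi] := eqVneq (chi 0 i) (chi 0 i0); first by rewrite scalemx_sub // hW.
by rewrite ai // scale0r sub0mx.
Qed.

Lemma row_eigenspace_mx i i0 : chi 0 i = chi 0 i0 -> (row i L <= eigenspace_mx i0)%MS.
Proof.
move=> hi; apply/sub_kermxP; rewrite mulmxBr mul_mx_scalar -row_mul Lc.
by rewrite row_diag_mul hi subrr.
Qed.

End IntegralSpectrum.

(** * Orbits of tori *)

Section GenericOrbit.
Variable R : realType.
Local Open Scope complex_scope.
Local Notation C := R[i].
Local Notation RC := (real_complex R).

Lemma nth_root (a : R) k : (0 < k)%N -> 0 < a -> exists2 r : R, 0 < r & r ^+ k = a.
Proof.
move=> k0 a0; exists (a `^ k%:R^-1); first exact: powR_gt0.
rewrite -powR_mulrn ?powR_ge0 // -powRrM mulVf ?powRr1 ?ltW //.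
by rewrite pnatr_eq0 -lt0n.
Qed.

Lemma conj_planeM m p (x : 'rV[C]_m) (D : 'M[R]_(m, p)) :
  conj_plane (x *m map_mx RC D) = conj_plane x *m map_mx RC D.
Proof. by rewrite /conj_plane mul_col_mx conj_mulmx conj_RC. Qed.

(** An integral involution permutes the nonzero integral vectors and preserves algebraic matrices,
    so genericity survives. It serves to change the sign of a determinant. *)
Lemma generic_stack_mulmx s t n (i0 : 'I_s) (X Y : 'M[R]_(s, n)) (B : 'M[R]_(t, n))
    (D : 'M[int]_n) : D *m D = 1%:M -> generic_stack i0 X Y B ->
  generic_stack i0 (X *m intmx R D) (Y *m intmx R D) (B *m intmx R D).
Proof.
move=> DD [full [e e0 bound] line plane].
have DR : intmx R D *m intmx R D = 1%:M by rewrite -intmxM DD /intmx map_mx1.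
have DC : map_mx RC (intmx R D) *m map_mx RC (intmx R D) = 1%:M.
  by rewrite -map_mxM DR map_mx1.
have algD : algebraic_mx (map_mx RC (intmx R D)).
  by move=> i j; rewrite !mxE rmorph_int; exact: algebraic_int.
have shift p q (N : 'M[C]_(p, n)) (W : 'M[C]_(q, n)) :
    (N == W *m map_mx RC (intmx R D))%MS -> (N *m map_mx RC (intmx R D) == W)%MS.
  move=> /andP[h1 h2]; rewrite -[W]mulmx1 -DC mulmxA.
  by apply/andP; split; apply: submxMr.
split.
- apply: row_full_inj => x; rewrite -cplx_mul -conj_stack_mul -mulmxA => h.
  have : map_mx RC (intmx R D) *m x = 0.
    have [L hL] := row_fullP full.
    by rewrite -[LHS]mul1mx -hL -mulmxA h mulmx0.
  by move/(congr1 (mulmx (map_mx RC (intmx R D)))); rewrite mulmxA DC mul1mx mulmx0.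
- exists e => // v v0; rewrite /form_value -!mulmxA -intmxM; apply: bound.
  by apply: contraNneq v0 => h; rewrite -[v]mul1mx -DD -mulmxA h mulmx0.
- move=> m N algN; rewrite -cplx_mul row_mul; apply/negP => /shift.
  by apply/negP/line/algebraic_mulmx.
- move=> t0 m N algN; rewrite -cplx_mul row_mul conj_planeM; apply/negP => /shift.
  by apply/negP/plane/algebraic_mulmx.
Qed.

(** The real matrix [G] carrying the given forms to generic ones need not have determinant 1. Once
    its determinant is positive, an [n]-th root normalises it, at the price of the harmless scalar
    [r]. *)
Lemma exists_generic_SL s t (n := (s + (s + t))%N) (i0 : 'I_s)
    (A : 'M[C]_(s, n)) (B : 'M[R]_(t, n)) : (2 < n)%N -> row_free (conj_stack A B) ->
  exists (X Y : 'M[R]_(s, n)) (B' : 'M[R]_(t, n)) (r : R) (g : SL R n),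
    [/\ generic_stack i0 X Y B', 0 < r &
        conj_stack A B *m map_mx RC (val g) = r%:C *: conj_stack (cplx X Y) B'].
Proof.
move=> n3 free; set M := conj_stack A B.
pose G X Y B' : 'M[R]_n :=
  map_mx (@complex.Re R) (invmx M *m conj_stack (cplx X Y) B').
have GE X Y B' : M *m map_mx RC (G X Y B') = conj_stack (cplx X Y) B'.
  by rewrite stack_solve // mulKVmx // stack_unit.
suff [X [Y [B' [gen d0]]]] : exists X Y B', generic_stack i0 X Y B' /\ 0 < \det (G X Y B').
  have [r r0 rn] : exists2 r : R, 0 < r & r ^+ n = (\det (G X Y B'))^-1.
    by apply: nth_root; [exact: ltn_trans n3 | rewrite invr_gt0].
  have g1 : \det (r *: G X Y B') = 1 by rewrite detZ rn mulVf // gt_eqF.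
  by exists X, Y, B', r, (mkSL g1); split=> //=; rewrite map_mxZ -scalemxAr GE.
have [X [Y [B' gen]]] := exists_generic_stack R i0 n3 (erefl n).
have d0 : \det (G X Y B') != 0.
  have : conj_stack (cplx X Y) B' \in unitmx.
    by rewrite -row_full_unit; exact: generic_full gen.
  rewrite -GE unitmxE det_mulmx unitrM => /andP[_].
  by rewrite det_map_mx unitfE fmorph_eq0.
case/orP: (lt_total d0) => [dn|dp]; last by exists X, Y, B'.
have n0 : (0 < n)%N by exact: ltn_trans n3.
(* An integral reflection changes the sign of the determinant. *)
pose d : 'rV[int]_n := \row_i if i == Ordinal n0 then -1 else 1.
have DD : diag_mx d *m diag_mx d = 1%:M.
  rewrite mulmx_diag -diag_const_mx; congr diag_mx; apply/rowP => i; rewrite !mxE.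
  by case: ifP.
have detD : \det (diag_mx d) = -1.
  rewrite det_diag (bigD1 (Ordinal n0)) //= mxE eqxx big1 ?mulr1 // => i.
  by rewrite mxE => /negPf ->.
exists (X *m intmx R (diag_mx d)), (Y *m intmx R (diag_mx d)), (B' *m intmx R (diag_mx d)).
split; first exact: generic_stack_mulmx.
have -> : G (X *m intmx R (diag_mx d)) (Y *m intmx R (diag_mx d)) (B' *m intmx R (diag_mx d))
    = G X Y B' *m intmx R (diag_mx d).
  apply: (@map_mx_inj _ _ RC); apply: (can_inj (mulKmx (stack_unit free))).
  by rewrite GE map_mxM mulmxA GE conj_stack_mul cplx_mul.
by rewrite det_mulmx det_intmx detD mulrN1 oppr_gt0.
Qed.

Lemma form_valueE s t n (X Y : 'M[R]_(s, n)) (B : 'M[R]_(t, n)) v :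
  (form_value X Y B v)%:C =
    \prod_k (conj_stack (cplx X Y) B *m map_mx RC v) k 0.
Proof.
rewrite conj_stack_mul cplx_mul /conj_stack !big_split_ord /= mulrA -big_split /=.
rewrite /form_value rmorphM !rmorph_prod; congr (_ * _); apply: eq_bigr => i _.
  by rewrite col_mxEu col_mxEd col_mxEu [(map_mx conjc _) _ _]mxE mulr_conjc [in RHS]mxE.
by rewrite col_mxEd col_mxEd [RHS]mxE.
Qed.

Lemma norm_real_complex (x : R) : `|x%:C| = `|x|%:C.
Proof. by rewrite normc_def /= expr0n addr0 sqrtr_sqr. Qed.

Lemma mx_norm_bound p q (M : 'M[C]_(p, q)) :
  exists2 K : R, 0 < K & forall i j, `|M i j| <= K%:C.
Proof.
have pos i j : 0 <= complex.Re `|M i j|.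
  by have := normr_ge0 (M i j); rewrite lecE /= => /andP[].
exists (1 + \sum_i \sum_j complex.Re `|M i j|).
  by rewrite ltr_pwDl // sumr_ge0 // => i _; rewrite sumr_ge0.
move=> i j; rewrite -(RRe_real (normr_real (M i j))) lecR.
rewrite (bigD1 i) //= (bigD1 j) //= addrCA -addrA lerDl.
apply: addr_ge0; first by apply: sumr_ge0 => l _; exact: pos.
apply: addr_ge0 => //; apply: sumr_ge0 => k _; apply: sumr_ge0 => l _; exact: pos.
Qed.

Lemma sqnorm_lower_bound p q (M : 'M[C]_(p, q)) (e : R) : (0 < p)%N -> 0 < e ->
  exists2 m : R, 0 < m & forall y : 'cV[R]_q,
    e%:C <= `|\prod_k (M *m map_mx RC y) k 0| -> m <= \sum_i y i 0 ^+ 2.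
Proof.
move=> p0 e0; have [K K0 hK] := mx_norm_bound M.
(* From [c <= 1] and [0 < p] follow [c ^+ p <= c < e]. The bound [eta] on the entries of [y] makes
   those of [M y] at most [K * eta * q <= c]; adding 1 to [q] keeps the denominator positive. *)
pose c := Num.min 1 (e / 2%:R); have c0 : 0 < c by rewrite lt_min ltr01 divr_gt0.
have c1 : c <= 1 by rewrite ge_min lexx.
have ce : c < e by rewrite gt_min; apply/orP; right; lra.
have q0 : 0 < q%:R + 1 :> R by rewrite ltr_wpDl.
pose eta := c / (K * (q%:R + 1)).
have eta0 : 0 < eta by rewrite divr_gt0 // mulr_gt0.
exists (eta ^+ 2); first by rewrite exprn_gt0.
move=> y; apply: contraTT; rewrite -ltNge => hy.
have ybound j : `|y j 0| <= eta.
  rewrite -(ler_pXn2r (n := 2)) ?nnegrE ?(ltW eta0) // -normrX ger0_norm ?sqr_ge0 //.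
  apply: le_trans (ltW hy); rewrite (bigD1 j) //= lerDl sumr_ge0 // => i _.
  exact: sqr_ge0.
have Mbound k : `|(M *m map_mx RC y) k 0| <= c%:C.
  rewrite mxE; apply: le_trans (ler_norm_sum _ _ _) _.
  apply: le_trans (_ : \sum_(j < q) (K * eta)%:C <= _).
    apply: ler_sum => j _; rewrite normrM rmorphM ler_pM // mxE norm_real_complex.
    by rewrite lecR.
  rewrite sumr_const card_ord -rmorphMn lecR -mulr_natr /eta.
  have -> : K * (c / (K * (q%:R + 1))) * q%:R = c * q%:R / (q%:R + 1).
    by field; rewrite !gt_eqF.
  by rewrite ler_pdivrMr // ler_wpM2l ?ltW // ltrDl.
have le1 : `|\prod_k (M *m map_mx RC y) k 0| <= c%:C ^+ p.
  rewrite normr_prod -[X in _ ^+ X]card_ord -prodr_const.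
  by apply: ler_prod => k _; rewrite normr_ge0 Mbound.
have h : `|\prod_k (M *m map_mx RC y) k 0| < e%:C.
  apply: le_lt_trans le1 _; rewrite -rmorphXn ltcR; apply: le_lt_trans ce.
  by case: (p) p0 => // p' _; rewrite exprS ler_piMr ?exprn_ile1 // ltW.
by apply/negP => h'; move: (lt_le_trans h h'); rewrite ltxx.
Qed.

(** * Precompactness and non-compactness of the orbit *)

Section Orbit.
Variables (s t : nat).
Local Notation n := (s + (s + t))%N.
Variables (A : 'M[C]_(s, n)) (B : 'M[R]_(t, n)) (i0 : 'I_s).
Hypothesis free : row_free (conj_stack A B).
Variables (X Y : 'M[R]_(s, n)) (B' : 'M[R]_(t, n)) (r : R) (g : SL R n).
Hypotheses (gen : generic_stack i0 X Y B') (r0 : 0 < r).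
Local Notation M := (conj_stack A B).
Local Notation L := (conj_stack (cplx X Y) B').
Hypothesis Mg : M *m map_mx RC (val g) = r%:C *: L.

Lemma stack_torus_prod h e : \det h = 1 -> M *m map_mx RC h = diag_mx e *m M ->
  \prod_i e 0 i = 1.
Proof.
move=> h1 /(congr1 determinant); rewrite !det_mulmx det_diag det_map_mx h1 mulrC.
by rewrite rmorph1 => /mulIf <- //; rewrite -unitfE -unitmxE stack_unit.
Qed.

Lemma generic_orbit_precompact : precompact (SLorbit (stack_torus A B) g).
Proof.
have [e e0 he] := generic_bound gen.
have n0 : (0 < n)%N by case: (i0) => i /= /(leq_ltn_trans (leq0n i)); case: (s).
have re0 : 0 < r ^+ n * e by rewrite mulr_gt0 ?exprn_gt0.
have [m m0 hm] := sqnorm_lower_bound M n0 re0.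
apply: (@precompact_subset _ _ (@SLproj R n @` SLthick m)).
  move=> _ [x [h Hh xE] <-]; exists x => // v v0; rewrite xE; apply: hm.
  have [h1 [z [u hzu]]] := (stack_torusP A B h).1 Hh.
  rewrite -mulmxA map_mxM mulmxA hzu -mulmxA map_mxM [M *m (_ *m _)]mulmxA Mg.
  have -> : \prod_k (diag_mx (eigen_row z u) *m (r%:C *: L *m map_mx RC (intmx R v))) k 0
      = (r ^+ n * form_value X Y B' (intmx R v))%:C.
    rewrite [RHS]rmorphM /= form_valueE rmorphXn /=.
    have -> : r%:C ^+ n = \prod_(k < n) r%:C by rewrite prodr_const card_ord.
    transitivity (\prod_k eigen_row z u 0 k * (\prod_(k < n) r%:C *
        \prod_k (L *m map_mx RC (intmx R v)) k 0)); last first.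
      by rewrite (stack_torus_prod h1 hzu) mul1r.
    rewrite -!big_split; apply: eq_bigr => k _ /=.
    by rewrite mul_diag_mx [LHS]mxE -scalemxAl; congr (_ * _); rewrite [LHS]mxE.
  rewrite norm_real_complex lecR normrM (gtr0_norm (exprn_gt0 _ r0)).
  by rewrite ler_wpM2l ?he // exprn_ge0 // ltW.
rewrite precompact_closed; first exact: SLthick_proj_compact.
exact: SLthick_proj_closed.
Qed.

Lemma eigen_rowM (z z' : 'rV[C]_s) (u u' : 'rV[R]_t) l :
  eigen_row z u 0 l * eigen_row z' u' 0 l =
    eigen_row (\row_i (z 0 i * z' 0 i)) (\row_j (u 0 j * u' 0 j)) 0 l.
Proof.
rewrite /eigen_row -[l]splitK; case: (fintype.split l) => [i|j] /=.
  by rewrite !row_mxEl mxE.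
rewrite !row_mxEr -[j]splitK; case: (fintype.split j) => [i|k] /=.
  by rewrite !row_mxEl !mxE rmorphM.
by rewrite !row_mxEr !mxE rmorphM.
Qed.

Lemma eigen_row_neq0 (z : 'rV[C]_s) (u : 'rV[R]_t) : (forall l, eigen_row z u 0 l != 0) ->
  (forall i, z 0 i != 0) /\ (forall j, u 0 j != 0).
Proof.
move=> h; split=> [i|j]; first by have := h (lshift _ i); rewrite /eigen_row row_mxEl.
have := h (rshift _ (rshift _ j)); rewrite /eigen_row !row_mxEr mxE.
by apply: contraNneq => ->.
Qed.

(** Reading [hk g c = h g] in the basis of generic forms, [c] is diagonal and its eigenvalues are
    the quotients of those of [h] by those of [hk]. The former are bounded because [h] is. *)
Lemma compact_orbit_spectrum (z : nat -> 'rV[C]_s) (u : nat -> 'rV[R]_t) :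
  compact (SLorbit (stack_torus A B) g) ->
  (forall k, stack_torus A B (diag_elt A B (z k) (u k))) ->
  exists K : R, forall N : nat, exists k, (N <= k)%N /\
    exists (c : 'M[int]_n) (zc : 'rV[C]_s) (uc : 'rV[R]_t),
      [/\ \det c = 1, L *m map_mx intr c = diag_mx (eigen_row zc uc) *m L &
          forall l, `|eigen_row (z k) (u k) 0 l| * `|eigen_row zc uc 0 l| <= K%:C].
Proof.
move=> Hco Hzu.
have Hcl := zariski_closed_closed (stack_torus_closed free).
have [K hK] := orbit_return (stack_torus_subgroup A B) Hcl Hco Hzu.
have [KM KM0 hM] := mx_norm_bound M; have [KI KI0 hI] := mx_norm_bound (invmx M).
(* An eigenvalue of [h] is a diagonal entry of [M h M^-1], a sum of [n * n] products of three
   bounded factors. *)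
exists (KM * K * KI *+ n *+ n) => N; have [k [Nk [h [c [Hh c1 hKh hcE]]]]] := hK N.
exists k; split=> //; set hk := diag_elt A B (z k) (u k) in hcE.
have [h1 [z' [u' hzu']]] := (stack_torusP A B h).1 Hh.
have hkzu : M *m map_mx RC hk = diag_mx (eigen_row (z k) (u k)) *m M.
  exact: diag_elt_mul.
have e0 l : eigen_row (z k) (u k) 0 l != 0.
  have [hk1 _] := Hzu k; have /eqP := stack_torus_prod hk1 hkzu.
  apply: contraTneq => el; rewrite (bigD1 l) //= el mul0r eq_sym; exact: oner_neq0.
have [z0 u0] := eigen_row_neq0 e0.
pose zc := \row_i (z' 0 i / z k 0 i); pose uc := \row_j (u' 0 j / u k 0 j).
have ezu l : eigen_row (z k) (u k) 0 l * eigen_row zc uc 0 l = eigen_row z' u' 0 l.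
  rewrite eigen_rowM; congr (eigen_row _ _ 0 l); apply/rowP => i; rewrite !mxE mulrC divfK //.
exists c, zc, uc; split=> //.
  apply/row_matrixP => l; rewrite row_diag_mul; apply: (scalerI (e0 l)).
  rewrite scalerA ezu -!row_diag_mul; congr row.
  have r0' : r%:C != 0 by rewrite fmorph_eq0 gt_eqF.
  have intC : map_mx RC (intmx R c) = map_mx intr c.
    by apply/matrixP => i j; rewrite !mxE rmorph_int.
  apply: (scalerI r0').
  transitivity (M *m map_mx RC (hk *m val g *m intmx R c)).
    by rewrite !map_mxM !mulmxA hkzu -(mulmxA _ M) Mg -scalemxAr -!scalemxAl intC.
  by rewrite hcE map_mxM mulmxA hzu' -(mulmxA _ M) Mg -scalemxAr.
move=> l; rewrite -normrM ezu.
have -> : eigen_row z' u' 0 l = (M *m map_mx RC h *m invmx M) l l.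
  by rewrite hzu' mulmxK ?stack_unit // [RHS]mxE eqxx mulr1n.
rewrite mxE; apply: le_trans (ler_norm_sum _ _ _) _.
apply: le_trans (_ : \sum_(j < n) (KM * K * KI *+ n)%:C <= _); last first.
  by rewrite sumr_const card_ord [X in _ <= X]rmorphMn.
apply: ler_sum => j _; rewrite normrM rmorphMn rmorphM -mulrnAl.
apply: ler_pM => //; rewrite mxE; apply: le_trans (ler_norm_sum _ _ _) _.
apply: le_trans (_ : \sum_(i < n) (KM * K)%:C <= _); last by rewrite sumr_const card_ord.
apply: ler_sum => i _; rewrite normrM rmorphM; apply: ler_pM => //.
by rewrite mxE norm_real_complex lecR.
Qed.

(** [S] collects the indices that pay for the expansion of the others. A return time [k] with
    [2 ^ k > K] makes the remaining eigenvalues of [c] smaller than 1. *)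
Lemma contracted_spectrum (S : pred 'I_n) (z : nat -> 'rV[C]_s) (u : nat -> 'rV[R]_t) :
  compact (SLorbit (stack_torus A B) g) ->
  (forall k, stack_torus A B (diag_elt A B (z k) (u k))) ->
  (forall k l, ~~ S l -> (2%:R ^+ k)%:C <= `|eigen_row (z k) (u k) 0 l|) ->
  exists (c : 'M[int]_n) (zc : 'rV[C]_s) (uc : 'rV[R]_t),
    [/\ \det c = 1, L *m map_mx intr c = diag_mx (eigen_row zc uc) *m L &
        forall l, ~~ S l -> `|eigen_row zc uc 0 l| < 1].
Proof.
move=> Hco Hzu hbig; have [K hK] := compact_orbit_spectrum Hco Hzu.
have [k [Nk [c [zc [uc [c1 Lc hl]]]]]] := hK (Num.bound `|K|).
exists c, zc, uc; split=> // l Sl.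
rewrite real_ltNge ?normr_real ?real1 //; apply/negP => ge1.
have : (2%:R ^+ k)%:C <= K%:C :> C.
  apply: le_trans (hl l); apply: le_trans (hbig k l Sl) _.
  by rewrite ler_peMr.
rewrite lecR; apply/negP; rewrite -ltNge; apply: le_lt_trans (ler_norm K) _.
apply: lt_le_trans (archi_boundP (normr_ge0 K)) _.
rewrite -natrX ler_nat; apply: leq_trans Nk _; apply: ltnW; exact: ltn_expl.
Qed.

Lemma eigen_rowE (z : 'rV[C]_s) (u : 'rV[R]_t) :
  ((forall i, eigen_row z u 0 (lshift _ i) = z 0 i) *
   (forall i, eigen_row z u 0 (rshift _ (lshift _ i)) = conjc (z 0 i)) *
   (forall j, eigen_row z u 0 (rshift _ (rshift _ j)) = (u 0 j)%:C))%type.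
Proof.
by split; [split|] => i;
  rewrite /eigen_row ?row_mxEl // row_mxEr ?row_mxEl ?row_mxEr mxE.
Qed.

Lemma stack_unit_generic : L \in unitmx.
Proof. rewrite -row_full_unit; exact: generic_full gen. Qed.

Lemma row_stack_l : row (lshift _ i0) L = row i0 (cplx X Y).
Proof. exact: rowKu. Qed.

Lemma row_stack_m : row (rshift _ (lshift _ i0)) L = map_mx conjc (row i0 (cplx X Y)).
Proof. by rewrite /conj_stack rowKd rowKu map_row. Qed.

(** Every form is expanded by [w k] except the real one at [j0], which takes the compensating
    factor. Only one eigenvalue of [c] may then leave the unit disc, so the spectrum is simple and
    the eigenspace of index [l0] is the line of [i0]. *)
Lemma generic_orbit_not_compact_real (j0 : 'I_t) :
  ~ compact (SLorbit (stack_torus A B) g).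
Proof.
move=> Hco; pose w k : R := 2%:R ^+ k.
have w0 k : 0 < w k by rewrite exprn_gt0.
pose P k : R := \prod_(i < s) (w k * w k) * \prod_(j < t | j != j0) w k.
have P0 k : P k != 0.
  by rewrite mulf_neq0 //; apply/prodf_neq0 => i _; rewrite ?mulf_neq0 ?gt_eqF.
pose z k : 'rV[C]_s := const_mx (w k)%:C.
pose u k : 'rV[R]_t := \row_j if j == j0 then (P k)^-1 else w k.
have Hzu k : stack_torus A B (diag_elt A B (z k) (u k)).
  apply: stack_torus_diag_elt => //.
  rewrite (bigD1 j0 (F := fun j => (u k 0 j)%:C)) //= mxE eqxx mulrCA.
  transitivity (((P k)^-1 * P k)%:C); last by rewrite mulVf.
  rewrite rmorphM; congr (_ * _); rewrite /P rmorphM !rmorph_prod; congr (_ * _).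
    by apply: eq_bigr => i _; rewrite mxE rmorphM conjc_real.
  by apply: eq_bigr => j jj; rewrite mxE (negPf jj).
pose p0 : 'I_n := rshift s (rshift s j0).
have [|c [zc [uc [c1 Lc small]]]] := contracted_spectrum (S := pred1 p0) Hco Hzu.
  move=> k l; rewrite -[l]splitK; case: (fintype.split l) => [i|l'] /=.
    by rewrite eigen_rowE mxE norm_real_complex gtr0_norm ?w0.
  rewrite -[l']splitK; case: (fintype.split l') => [i|j] /=.
    by rewrite eigen_rowE mxE conjc_real norm_real_complex gtr0_norm ?w0.
  rewrite !(inj_eq (@rshift_inj _ _)) => jj.
  by rewrite eigen_rowE mxE (negPf jj) norm_real_complex gtr0_norm ?w0.
have Lu := stack_unit_generic.
have inj : injective (eigen_row zc uc 0).
  apply: (separable_spectrum (q := char_poly c) (j0 := p0)).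
  - exact: char_poly_spectrum Lu Lc.
  - exact: char_poly_monic.
  - by rewrite char_poly_det c1 mulr1 normrX normrN1 expr1n.
  - by move=> l lp; exact: small.
pose l0 : 'I_n := lshift (s + t) i0.
have /negP := generic_line gen (eigenspace_mx_algebraic Lu Lc l0); apply.
rewrite -row_stack_l; apply/andP; split; last exact: row_eigenspace_mx.
by apply: (eigenspace_mx_sub Lu Lc) => l /inj ->.
Qed.

(** The compensating factor now sits on the pair [i0], and simplicity of the spectrum is no longer
    available. The pair's eigenvalues are conjugate and the total product is 1, so neither lies in
    the open unit disc, where all the others are. The eigenspace of index [l0] is therefore the line
    if the two differ, and the plane if they coincide. *)
Lemma generic_orbit_not_compact_complex :
  t = 0%N -> ~ compact (SLorbit (stack_torus A B) g).
Proof.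
move=> t0 Hco; pose w k : R := 2%:R ^+ k.
have w0 k : 0 < w k by rewrite exprn_gt0.
have noj (j : 'I_t) : False by move: (ltn_ord j); rewrite {2}t0.
pose P k : R := \prod_(i < s | i != i0) w k.
have P0 k : P k != 0 by apply/prodf_neq0 => i _; rewrite gt_eqF.
pose z k : 'rV[C]_s := \row_i (if i == i0 then (P k)^-1 else w k)%:C.
have Hzu k : stack_torus A B (diag_elt A B (z k) 0).
  apply: stack_torus_diag_elt => //.
  rewrite [X in _ * X]big1 ?mulr1; last by move=> j; case: (noj j).
  transitivity ((((P k)^-1 * P k) ^+ 2)%:C); last by rewrite mulVf // expr1n.
  rewrite (bigD1 i0) //= mxE eqxx conjc_real exprMn rmorphM; congr (_ * _).
    by rewrite expr2 rmorphM.
  rewrite /P -prodrXl rmorph_prod; apply: eq_bigr => i ii.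
  by rewrite mxE (negPf ii) conjc_real expr2 rmorphM.
pose l0 : 'I_n := lshift (s + t) i0; pose l1 : 'I_n := rshift s (lshift t i0).
have [|c [zc [uc [c1 Lc small]]]] := contracted_spectrum (S := pred2 l0 l1) Hco Hzu.
  move=> k l; rewrite -[l]splitK; case: (fintype.split l) => [i|l'] /=.
    rewrite negb_or => /andP[ii _]; rewrite (inj_eq (@lshift_inj _ _)) in ii.
    by rewrite eigen_rowE mxE (negPf ii) norm_real_complex gtr0_norm ?w0.
  rewrite -[l']splitK; case: (fintype.split l') => [i|j] /=; last by case: (noj j).
  rewrite negb_or => /andP[_ ii].
  rewrite (inj_eq (@rshift_inj _ _)) (inj_eq (@lshift_inj _ _)) in ii.
  by rewrite eigen_rowE mxE (negPf ii) conjc_real norm_real_complex gtr0_norm ?w0.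
have Lu := stack_unit_generic.
set chi := eigen_row zc uc in Lc small.
have chi01 : chi 0 l1 = conjc (chi 0 l0) by rewrite /chi !eigen_rowE.
have big0 : ~~ (`|chi 0 l0| < 1).
  apply/negP => lt1; have all1 l : `|chi 0 l| < 1.
    have [/= /orP[/eqP ->|/eqP ->]//|] := boolP (pred2 l0 l1 l); last exact: small.
    by rewrite chi01 norm_conjC.
  have : `|\prod_l chi 0 l| < 1.
    rewrite (bigD1 l0) //= normrM; apply: le_lt_trans lt1.
    by rewrite ler_piMr // normr_prod prodr_ile1 // => l _; rewrite normr_ge0 ltW.
  by rewrite (prod_spectrum Lu Lc) c1 normr1 ltxx.
have eq01 l : chi 0 l = chi 0 l0 -> l = l0 \/ l = l1.
  move=> e; have [/= /orP[/eqP ->|/eqP ->]|/small] := boolP (pred2 l0 l1 l); [by left|by right|].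
  by rewrite e (negPf big0).
have alg := eigenspace_mx_algebraic Lu Lc l0.
have [e|e] := eqVneq (chi 0 l1) (chi 0 l0).
  have /negP := generic_plane gen t0 alg; apply; rewrite /conj_plane -row_stack_m -row_stack_l.
  apply/andP; split.
    apply: (eigenspace_mx_sub Lu Lc) => l /eq01[] ->.
      exact: col_mx_subl.
    exact: col_mx_subr.
  by rewrite col_mx_sub !row_eigenspace_mx.
have /negP := generic_line gen alg; apply; rewrite -row_stack_l.
apply/andP; split; last exact: row_eigenspace_mx.
apply: (eigenspace_mx_sub Lu Lc) => l hl; case: (eq01 l hl) => lE.
  by rewrite lE.
by rewrite -lE hl eqxx in e.
Qed.

End Orbit.
End GenericOrbit.

Theorem theorem1p4 (R : realType) (n : nat) (hn : (3 <= n)%N)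
    (Z : set 'cV[int]_n) (Z_nonempty : Z !=set0)
    (Z_nonzero : forall v, Z v -> v != 0)
    (Z_invariant : forall (c : 'M[int]_n) v, SLset c -> Z v -> Z (c *m v)) :
  (forall s t : nat, n = (2 * s + t)%N -> (0 < s)%N ->
     exists f : mpoly n R,
       [/\ is_form f /\ has_conj_pairs f s t,
           ~ is_norm_form f, ~ is_quasi_norm_form f,
           ~ represents_zero f &
           discrete_at_0 (values_on f Z)]) /\
  (forall H : set 'M[R]_n, maximal_torus H -> ~ diagonalizable_over idfun H ->
     exists g : SL R n, precompact (SLorbit H g) /\ ~ compact (SLorbit H g)).
Proof.
split=> [s t nE s0|H Hmax nd].
  have n' : n = (s + (s + t))%N by rewrite nE mul2n -addnn addnA.
  by clear nE; subst n; exact: form_with_conj_pairs.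
have [s [t [A [B [nE s0 free ->]]]]] := maximal_torus_stack Hmax nd.
clear Hmax nd Z_invariant Z_nonzero Z_nonempty; subst n; pose i0 := Ordinal s0.
have [X [Y [B' [r [g [gen r0 Mg]]]]]] := exists_generic_SL i0 hn free.
exists g; split; first exact: generic_orbit_precompact gen r0 Mg.
case: (posnP t) => t0; first exact: generic_orbit_not_compact_complex gen r0 Mg t0.
exact: generic_orbit_not_compact_real gen r0 Mg (Ordinal t0).
Qed.
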